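(* Let $T>0$, let $U\subset\mathbb{R}^m$ be compact, let $\theta$ be a Borel probability measure on $\mathbb{R}^n$, and let $v\colon[0,T]\times\mathbb{R}^n\times U\to\mathbb{R}^n$ be a continuous map for which there are positive constants $L,C$ such that for all $t\in[0,T]$, $u\in U$, $x,x'\in\mathbb{R}^n$, $$|v(t,x,u)-v(t,x',u)|\le L|x-x'|\quad\text{and}\quad |v(t,x,u)|\le C(1+|x|).$$ For a generalized control $\nu\in\mathcal{Y}([0,T];U)$ let $\mu_\nu\colon[0,T]\to\mathcal{P}(\mathbb{R}^n)$ denote the trajectory corresponding to $\nu$ with $\mu_\nu(0)=\theta$. If the target set $A\subset\mathbb{R}^n$ is closed, then the problem of maximizing $\mu_\nu(T)(A)$ has a solution within the space of generalized controls, i.e. there exists $\nu_0\in\mathcal{Y}([0,T];U)$ such that $\mu_\nu(T)(A)\le\mu_{\nu_0}(T)(A)$ for all $\nu\in\mathcal{Y}([0,T];U)$.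
   Context: $|\cdot|$ is the Euclidean norm. $\mathcal{P}(\mathbb{R}^n)$ is the set of Borel probability measures on $\mathbb{R}^n$ with the topology of narrow convergence (convergence against bounded continuous functions). Generalized controls. A Young measure on $[0,T]\times\mathbb{R}^m$ is a positive Borel measure $\nu$ on $[0,T]\times\mathbb{R}^m$ with $\nu(B\times\mathbb{R}^m)=\lambda(B)$ (Lebesgue measure) for every Borel $B\subseteq[0,T]$. A generalized control is a Young measure whose support is contained in $[0,T]\times U$; the set of these is $\mathcal{Y}([0,T];U)$. The disintegration of $\nu$ is the family $(\nu_t)_{t\in[0,T]}$ of probability measures with $\int\psi\,d\nu=\int_0^T\int_{\mathbb{R}^m}\psi(t,\omega)\,d\nu_t(\omega)\,dt$ for all $\nu$-integrable $\psi$. Trajectories. The trajectory corresponding to $\nu$ is the (unique) distributional solution $\mu\in C^0([0,T];\mathcal{P}(\mathbb{R}^n))$ of $$\mu_t+\mathrm{div}_x(\bar v(t,x)\mu)=0,\qquad \mu(0)=\theta,\qquad \bar v(t,x)=\int_U v(t,x,\omega)\,d\nu_t(\omega),$$ meaning $\mu(0)=\theta$ and $\int_0^T\int_{\mathbb{R}^n}(\varphi_t+\bar v\cdot\nabla_x\varphi)\,d\mu(t)\,dt=0$ for all $\varphi\in C_c^\infty((0,T)\times\mathbb{R}^n)$. It is known that this solution is $\mu(t)(E)=\theta(V_t^0(E))$ for Borel $E$, i.e. the pushforward of $\theta$ under $V_0^t$, where $V$ is the flow of $\bar v$: $s\mapsto V_t^s(x)$ solves $\dot y(s)=\bar v(s,y(s))$,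 $y(t)=x$. *)

(* Defs.v *)
From HB Require Import structures.
From mathcomp Require Import all_boot all_order all_algebra.
From mathcomp Require Import all_classical all_reals all_analysis.

Set Implicit Arguments.
Unset Strict Implicit.
Unset Printing Implicit Defensive.

Import Order.TTheory GRing.Theory Num.Theory.
Import numFieldNormedType.Exports.

Local Open Scope classical_set_scope.
Local Open Scope ring_scope.

(* The library norm on row vectors is the sup norm. *)
Definition enorm {R : realType} {n : nat} (x : 'rV[R]_n) : R :=
  Num.sqrt (\sum_(i < n) x ord0 i ^+ 2).

(* R^n with its Borel sigma-algebra.  Products are given the product
   sigma-algebra, which for R * R^n is again the Borel one since both factors
   are second countable. *)
Notation borelRn R n := (g_sigma_algebraType (@open 'rV[R]_n)).

Notation timeR R := (measurableTypeR R).

Section generalized_controls.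
Context {R : realType} {m : nat}.

Definition msupport (nu : {measure set (timeR R * borelRn R m) -> \bar R}) :
    set (R * 'rV[R]_m) :=
  [set z | forall N : set (R * 'rV[R]_m), open N -> N z -> (0 < nu N)%E].

(* A measure on [0, T] x R^m is encoded as a measure on R x R^m that does not
   charge the complement of [0, T] x R^m. *)
Definition young_measure (T : R)
    (nu : {measure set (timeR R * borelRn R m) -> \bar R}) : Prop :=
  nu ((~` `[0, T]) `*` setT) = 0%E /\
  forall B : set (timeR R), measurable B -> B `<=` `[0, T] ->
    nu (B `*` setT) = lebesgue_measure B.

Definition generalized_control (T : R) (U : set 'rV[R]_m)
    (nu : {measure set (timeR R * borelRn R m) -> \bar R}) : Prop :=
  young_measure T nu /\ msupport nu `<=` `[0, T] `*` U.

(* Only the values of the kernel at times in [0, T] matter. *)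
Definition disintegration (T : R)
    (nu : {measure set (timeR R * borelRn R m) -> \bar R})
    (nu_ : R.-pker (timeR R) ~> (borelRn R m)) : Prop :=
  forall psi : timeR R * borelRn R m -> \bar R, nu.-integrable setT psi ->
    (\int[nu]_z psi z =
     \int[lebesgue_measure]_(t in `[0%R, T]) \int[nu_ t]_w psi (t, w))%E.

End generalized_controls.

Section test_functions.
Context {R : realType}.

Definition iter_deriv {V : normedModType R} (f : V -> R) (s : seq V) : V -> R :=
  foldr (fun (e : V) (g : V -> R) (z : V) => 'D_e g z) f s.

(* C^infinity: the directional derivatives of every order, along all finite
   lists of directions, exist and are continuous. *)
Definition smooth {V : normedModType R} (f : V -> R) : Prop :=
  forall s : seq V, continuous (iter_deriv f s) /\
    forall z e : V, derivable (iter_deriv f s) z e.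

Definition test_function {n : nat} (T : R) (phi : R * 'rV[R]_n -> R) : Prop :=
  [/\ smooth phi,
      compact (closure [set z | phi z != 0]) &
      closure [set z | phi z != 0] `<=` `]0, T[ `*` setT].

Definition time_deriv {n : nat} (phi : R * 'rV[R]_n -> R)
    (t : R) (x : 'rV[R]_n) : R := 'D_(1 : R, 0 : 'rV[R]_n) phi (t, x).

Definition space_grad {n : nat} (phi : R * 'rV[R]_n -> R)
    (t : R) (x : 'rV[R]_n) : 'rV[R]_n :=
  \row_i 'D_(0 : R, delta_mx ord0 i : 'rV[R]_n) phi (t, x).

End test_functions.

Section trajectories.
Context {R : realType} {n m : nat}.

Definition dotv (x y : 'rV[R]_n) : R := \sum_(i < n) x ord0 i * y ord0 i.

(* \bar v(t, x), the integral being taken componentwise. *)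
Definition averaged_field (U : set 'rV[R]_m)
    (v : R -> 'rV[R]_n -> 'rV[R]_m -> 'rV[R]_n)
    (nu_ : R.-pker (timeR R) ~> (borelRn R m)) (t : R) (x : 'rV[R]_n) :
    'rV[R]_n :=
  \row_i \int[nu_ t]_(w in U) v t x w ord0 i.

(* mu \in C^0([0, T]; P(R^n)) for the narrow topology, which is the initial
   topology of the maps P |-> \int f dP, f bounded and continuous. *)
Definition narrowly_continuous (T : R)
    (mu : R -> probability (borelRn R n) R) : Prop :=
  forall f : 'rV[R]_n -> R, continuous f ->
    (exists M : R, forall x, `|f x| <= M) ->
    {within `[0, T], continuous (fun t : R => \int[mu t]_x f x)}.

Definition continuity_equation (T : R) (w : R -> 'rV[R]_n -> 'rV[R]_n)
    (mu : R -> probability (borelRn R n) R) : Prop :=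
  forall phi : R * 'rV[R]_n -> R, test_function T phi ->
    \int[lebesgue_measure]_(t in `[0, T])
      \int[mu t]_x (time_deriv phi t x + dotv (w t x) (space_grad phi t x)) = 0.

(* Two disintegrations of nu agree for almost every t, so that the choice of
   nu_ is irrelevant.  Only the values of mu on [0, T] matter. *)
Definition trajectory (T : R) (U : set 'rV[R]_m)
    (theta : probability (borelRn R n) R)
    (v : R -> 'rV[R]_n -> 'rV[R]_m -> 'rV[R]_n)
    (nu : {measure set (timeR R * borelRn R m) -> \bar R})
    (mu : R -> probability (borelRn R n) R) : Prop :=
  exists nu_ : R.-pker (timeR R) ~> (borelRn R m),
    [/\ disintegration T nu nu_,
        narrowly_continuous T mu,
        (forall E : set (borelRn R n), measurable E -> mu 0 E = theta E) &
        continuity_equation T (averaged_field U v nu_) mu].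

End trajectories.

(* Main.v *)
(** A maximizing sequence of controls nu_k with trajectories mu_k is followed
    along an ultrafilter, which makes all bounded real sequences converge.
    Testing the continuity equation against a tensor product of a cut-off in
    time and a test function f in space shows that the integral of f against
    mu_k(t) is Lipschitz in t, with a constant that does not depend on k.
    Logarithmic cut-offs give uniform tightness, hence narrow limits mu_0(t)
    that depend continuously on t. The controls converge on products of a
    Borel set of times and a cell of a fixed countable family; the limits are
    absolutely continuous in time, and their densities determine a random
    point of U for each t, which provides both the limit control nu_0 and its
    disintegration. Integrating in x first, the weak equation becomes the
    integral against nu_k of a function that is continuous on [0, T] x U and
    converges uniformly, so it passes to the limit. Since A is closed, mu |->
    mu(T)(A) is upper semicontinuous, so the limit is optimal. That some
    trajectory exists is obtained in the same way from Euler polygons for a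
    constant control. *)

(* The difficulty is that controls and trajectories both converge only weakly while the equation
   multiplies them. The product passes to the limit because equicontinuity in time makes the
   integrals in x converge uniformly on the compact set of times and controls. An ultrafilter treats
   all times, test functions and cells at once, where subsequences would call for a diagonal
   extraction. The price is that limits of measures are only finitely additive. Sigma-additivity is
   recovered in space by realizing the limit masses of nested cells as lengths of nested
   subintervals of [0, 1[ and transporting Lebesgue measure, and in time by domination by Lebesgue
   measure. Mass may accumulate on the boundary of a cell, so the limit measure need not give a cell
   its limit mass. Therefore only integrals of continuous functions are compared, through their
   values at one representative of each cell. The existence of some trajectory is what makes the set
   of attained values nonempty; freezing the control at one point of U leaves an ordinary continuous
   field, for which Euler polygons suffice. *)
From HB Require Import structures.
Require Import Defs.
From mathcomp Require Import all_boot all_order all_algebra.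
From mathcomp Require Import all_classical all_reals all_analysis.
From mathcomp Require Import measurable_realfun.
From mathcomp Require Import ring lra zify.
Set Implicit Arguments.
Unset Strict Implicit.
Unset Printing Implicit Defensive.
Import Order.TTheory GRing.Theory Num.Theory.
Import numFieldNormedType.Exports.
Local Open Scope classical_set_scope.
Local Open Scope ring_scope.

(** * Smooth cut-off functions *)

(* The factor x ^- k makes the family closed under differentiation. *)
Definition flatexp {R : realType} (k : nat) (x : R) : R :=
  if 0 < x then x ^- k * expR (- x^-1) else 0.

Lemma flatexp_ge0 {R : realType} k (x : R) : 0 <= flatexp k x.
Proof.
rewrite /flatexp; case: ifPn => // x0.
by rewrite mulr_ge0 ?expR_ge0// invr_ge0 exprn_ge0// ltW.
Qed.

Lemma flatexp_gt0 {R : realType} k (x : R) : 0 < x -> 0 < flatexp k x.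
Proof. by move=> x0; rewrite /flatexp x0 mulr_gt0 ?expR_gt0// invr_gt0 exprn_gt0. Qed.

Lemma flatexp_eq0 {R : realType} k (x : R) : x <= 0 -> flatexp k x = 0.
Proof. by rewrite /flatexp leNgt => /negbTE ->. Qed.

(** The term of degree [k.+1] of the exponential series already bounds [expR x^-1] from below. The
    linear decay at the origin is what makes the derivative at 0 vanish in [is_derive_flatexp]. *)
Lemma flatexp_le {R : realType} k (x : R) : flatexp k x <= k.+1`!%:R * `|x|.
Proof.
rewrite /flatexp; case: ifPn => [x0|_]; last by rewrite mulr_ge0.
rewrite gtr0_norm// expRN.
have xi : 0 <= x^-1 by rewrite invr_ge0 ltW.
have := expR_ge1Dxn k xi.
have f0 : 0 < (k.+1`!%:R : R) by rewrite ltr0n fact_gt0.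
have xk : 0 < x^-1 ^+ k.+1 / k.+1`!%:R by rewrite divr_gt0// exprn_gt0// invr_gt0.
move=> h.
have h2 : x^-1 ^+ k.+1 / k.+1`!%:R <= expR x^-1 by apply: le_trans h; rewrite lerDr.
apply: (@le_trans _ _ (x ^- k * (x^-1 ^+ k.+1 / k.+1`!%:R)^-1)).
  by rewrite ler_pM2l ?invr_gt0 ?exprn_gt0// lef_pV2// posrE ?expR_gt0.
rewrite invfM invrK exprVn invrK exprS mulrA [_^-1 * (x * _)]mulrCA mulVf ?mulr1 1?mulrC//.
by rewrite expf_neq0// gt_eqF.
Qed.

Lemma near_eq_is_derive1 {R : realType} (f g : R -> R) (x df : R) :
  (\forall y \near x, f y = g y) -> is_derive x 1 f df -> is_derive x 1 g df.
Proof. exact: near_eq_is_derive. Qed.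

Lemma is_derive_flatexp {R : realType} k (x : R) :
  is_derive x 1 (flatexp k) (- k%:R * flatexp k.+1 x + flatexp k.+2 x).
Proof.
have [x0|x0|->] := ltgtP x 0.
- apply: (@near_eq_is_derive1 _ (cst 0)).
  + near=> y; rewrite /flatexp/= ltNge ifF//; apply/negbF/ltW; near: y.
    exact: lt_nbhsl.
  + by apply: is_derive_eq; rewrite !flatexp_eq0 ?ltW// mulr0 addr0.
- apply: (@near_eq_is_derive1 _ (fun y => (y ^+ k)^-1 * expR (- y^-1))).
  + near=> y; rewrite /flatexp/= ifT//; near: y; exact: lt_nbhsr.
  + have xn : x != 0 by rewrite gt_eqF.
    have h1 : is_derive x 1 (fun y : R => expR (- y^-1)) (expR (- x^-1) * x ^- 2).
      apply: (@is_derive1_comp _ expR (fun y => - y^-1)).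
      have h := @is_deriveV R id x 1 1 xn (is_derive_id _ _).
      by apply: (is_derive_eq (is_deriveN h)); rewrite /GRing.scale/= mulr1 opprK.
    have h2 : is_derive x 1 (fun y : R => (y ^+ k)^-1) (- k%:R * x ^- k.+1).
      have h := @is_deriveX _ _ (id : R -> R) k x 1 1 (is_derive_id _ _).
      have xk : (id ^+ k : R -> R) x != 0 by rewrite exprfctE/= expf_neq0.
      have h3 := is_deriveV xk h.
      rewrite (_ : (fun y : R => (y ^+ k)^-1) = (fun y => ((id ^+ k : R -> R) y)^-1)); last first.
        by apply/funext => y; rewrite exprfctE.
      apply: is_derive_eq; rewrite !exprfctE /= {h h3 xk}.
      case: k => [|k] /=; rewrite ?expr0 /GRing.scale/= ?mulr0n.
        by rewrite !mul0r mulr0 oppr0 mul0r.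
      rewrite mulr1 !mulNr; congr (- _); rewrite mulrCA; congr (_ * _).
      by rewrite !exprS; field; rewrite xn expf_neq0.
    have h3 := is_deriveM h2 h1; apply: is_derive_eq.
    rewrite /flatexp x0 /GRing.scale/= addrC; congr (_ + _); first by rewrite mulrC mulrA.
    by rewrite -(addn2 k) exprD; field; rewrite xn expf_neq0.
(* At the origin the factor [h^-1] of the difference quotient is absorbed into the power, so the
   quotient is again a member of the family, with limit 0 by [flatexp_le]. *)
- have H : forall h : R, h != 0 ->
      h^-1 *: ((flatexp k \o shift 0) (h *: 1) - flatexp k 0) = flatexp k.+1 h.
    move=> h h0; rewrite /= /GRing.scale/= mulr1 addr0 (@flatexp_eq0 _ _ 0)// subr0.
    rewrite /flatexp; case: ifPn => _; last by rewrite mulr0.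
    by rewrite mulrA -invfM -exprS.
  have C : h^-1 *: ((flatexp k \o shift 0) (h *: 1) - flatexp k 0) @[h --> (0:R)^'] --> (0:R).
    apply/cvgrPdist_le => /= e e0; near=> h.
    rewrite H; last by near: h; exact: nbhs_dnbhs_neq.
    rewrite sub0r normrN ger0_norm ?flatexp_ge0//.
    apply: le_trans (flatexp_le _ _) _.
    rewrite -ler_pdivlMl ?ltr0n ?fact_gt0//.
    near: h; apply: dnbhs0_le.
    by rewrite mulr_gt0// invr_gt0 ltr0n fact_gt0.
  apply: DeriveDef; first by apply/cvg_ex; exists 0.
  by rewrite !flatexp_eq0// mulr0 addr0; apply/cvg_lim.
Unshelve. all: by end_near. Qed.

(* Since [smooth] quantifies over all iterated derivatives, test functions are
   built from a class of functions that is closed under differentiation. *)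
Inductive smc {R : realType} {V : normedModType R} : (V -> R) -> Prop :=
| smc_cst c : smc (cst c)
| smc_lin l : (forall x, differentiable l x) ->
    (forall e, exists c, forall x, 'D_e l x = c) -> smc l
| smcD f g : smc f -> smc g -> smc (fun x => f x + g x)
| smcM f g : smc f -> smc g -> smc (fun x => f x * g x)
| smcV f : smc f -> (forall x, f x != 0) -> smc (fun x => (f x)^-1)
| smc_ln f : smc f -> (forall x, 0 < f x) -> smc (fun x => ln (f x))
| smc_flatexp k f : smc f -> smc (fun x => flatexp k (f x)).

Section smc_theory.
Context {R : realType} {V : normedModType R}.
Implicit Types f g : V -> R.

Lemma diff_comp1 (h : R -> R) (dh : R) f x : differentiable f x ->
  is_derive (f x) 1 h dh -> differentiable (fun y => h (f y)) x /\
  forall e, 'D_e (fun y => h (f y)) x = dh * 'D_e f x.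
Proof.
move=> df hh.
have dh1 : differentiable h (f x) by apply/derivable1_diffP.
have dc : differentiable (h \o f) x by exact: differentiable_comp.
split=> // e; rewrite (deriveE _ dc) diff_comp//= diff1E//= /GRing.scale/=.
by rewrite -(deriveE _ df) derive1E derive_val mulrC.
Qed.

Lemma smc_diff f : smc f -> forall x, differentiable f x.
Proof.
elim=> {f} [c|l dl _|f g _ hf _ hg|f g _ hf _ hg|f _ hf f0|f _ hf f0|k f _ hf] x.
- exact: differentiable_cst.
- exact: dl.
- exact: differentiableD.
- exact: differentiableM.
- have /= := @is_deriveV R id (f x) 1 1 (f0 x) (is_derive_id _ _).
  by move=> /(diff_comp1 (hf x))[].
- by have [] := diff_comp1 (hf x) (is_derive1_ln (f0 x)).
- by have [] := diff_comp1 (hf x) (is_derive_flatexp k (f x)).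
Qed.

Lemma smc_eq f g : f =1 g -> smc f -> smc g.
Proof. by move=> /funext ->. Qed.

Lemma smcZ (c : R) f : smc f -> smc (fun x => c * f x).
Proof. by move=> hf; apply: (@smcM _ _ (cst c)) => //; exact: smc_cst. Qed.

Lemma smc_derive f : smc f -> forall e, smc ('D_e f).
Proof.
elim=> {f} [c|l dl hl|f g hf Hf hg Hg|f g hf Hf hg Hg|f hf Hf f0|f hf Hf f0|k f hf Hf] e.
- by apply: (smc_eq _ (smc_cst 0)) => x; rewrite derive_cst.
- by have [c hc] := hl e; apply: (smc_eq _ (smc_cst c)) => x; rewrite hc.
- apply: (smc_eq _ (smcD (Hf e) (Hg e))) => x.
  by rewrite deriveD//; apply/diff_derivable/smc_diff.
- apply: (smc_eq _ (smcD (smcM hf (Hg e)) (smcM hg (Hf e)))) => x.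
  by rewrite deriveM//; apply/diff_derivable/smc_diff.
- apply: (smc_eq _ (smcZ (-1) (smcM (smcM (smcV hf f0) (smcV hf f0)) (Hf e)))) => x.
  have /= := @is_deriveV R id (f x) 1 1 (f0 x) (is_derive_id _ _).
  move=> /(diff_comp1 (smc_diff hf x))[_ /(_ e) ->].
  by rewrite /GRing.scale/= mulr1 expr2 invfM mulN1r mulNr.
- apply: (smc_eq _ (smcM (smcV hf (fun x => lt0r_neq0 (f0 x))) (Hf e))) => x.
  by have [_ ->] := diff_comp1 (smc_diff hf x) (is_derive1_ln (f0 x)).
- apply: (smc_eq _ (smcM (smcD (smcZ (- k%:R) (smc_flatexp k.+1 hf))
     (smc_flatexp k.+2 hf)) (Hf e))) => x.
  by have [_ ->] := diff_comp1 (smc_diff hf x) (is_derive_flatexp k (f x)).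
Qed.

Lemma smc_continuous f : smc f -> continuous f.
Proof. by move=> hf x; apply/differentiable_continuous/smc_diff. Qed.

Lemma smc_smooth f : smc f -> smooth f.
Proof.
move=> hf s.
have hs : smc (iter_deriv f s) by elim: s => //= e s hs; exact: smc_derive.
split; first exact: smc_continuous.
by move=> z e; apply/diff_derivable/smc_diff.
Qed.

Lemma smcB f g : smc f -> smc g -> smc (fun x => f x - g x).
Proof.
by move=> hf hg; apply: (smc_eq _ (smcD hf (smcZ (-1) hg))) => x; rewrite mulN1r.
Qed.

Lemma smc_sum (I : Type) (r : seq I) (P : pred I) (F : I -> V -> R) :
  (forall i, smc (F i)) -> smc (fun x => \sum_(i <- r | P i) F i x).
Proof.
move=> h; elim: r => [|i r ih].
  by apply: (smc_eq _ (smc_cst 0)) => x; rewrite big_nil.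
have [Pi|Pi] := boolP (P i).
  by apply: (smc_eq _ (smcD (h i) ih)) => x; rewrite big_cons Pi.
by apply: (smc_eq _ ih) => x; rewrite big_cons (negbTE Pi).
Qed.

Lemma smc_prod (I : Type) (r : seq I) (P : pred I) (F : I -> V -> R) :
  (forall i, smc (F i)) -> smc (fun x => \prod_(i <- r | P i) F i x).
Proof.
move=> h; elim: r => [|i r ih].
  by apply: (smc_eq _ (smc_cst 1)) => x; rewrite big_nil.
have [Pi|Pi] := boolP (P i).
  by apply: (smc_eq _ (smcM (h i) ih)) => x; rewrite big_cons Pi.
by apply: (smc_eq _ ih) => x; rewrite big_cons (negbTE Pi).
Qed.

End smc_theory.

(** On the line the constructor [smc_lin] yields only affine functions, so composing one with [f]
    stays in the class. This is the one case of [smc_comp] that is not a mere closure rule. *)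
Lemma constant_derivative_affine {R : realType} (l : R -> R) :
  (forall x, differentiable l x) -> (forall e, exists c, forall x, 'D_e l x = c) ->
  exists c, forall x, l x = c * x + l 0.
Proof.
move=> dl hl; have [c hc] := hl 1; exists c => x.
have h : forall x0 : R, is_derive x0 (1 : R) (fun y => l y - c * y) 0.
  move=> y; have h1 : is_derive y 1 l c.
    by rewrite -(hc y); apply/derivableP/diff_derivable.
  have h2 : is_derive y 1 (fun y => c * y) c.
    have := is_deriveZ c (is_derive_id y (1:R)).
    by rewrite /GRing.scale/= mulr1.
  by have := is_deriveB h1 h2; rewrite subrr.
have := is_derive_0_is_cst x 0 h; rewrite mulr0 subr0 => <-.
by rewrite addrC subrK.
Qed.

Lemma smc_comp {R : realType} {V : normedModType R} (g : R -> R) (f : V -> R) :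
  smc g -> smc f -> smc (fun x => g (f x)).
Proof.
move=> hg hf; elim: hg => {g} [c|l dl hl|g h _ Hg _ Hh|g h _ Hg _ Hh|g _ Hg g0|g _ Hg g0|k g _ Hg].
- exact: smc_cst.
- have [c lE] := constant_derivative_affine dl hl.
  apply: (smc_eq _ (smcD (smcZ c hf) (smc_cst (l 0)))) => x /=.
  by rewrite [RHS]lE.
- exact: smcD.
- exact: smcM.
- exact: smcV.
- exact: smc_ln.
- exact: smc_flatexp.
Qed.

Lemma smc_id {R : realType} : smc (id : R -> R).
Proof.
by apply: smc_lin => // e; exists e => x; rewrite derive_id.
Qed.

Definition smoothstep {R : realType} (x : R) : R :=
  flatexp 0 x / (flatexp 0 x + flatexp 0 (1 - x)).

Section smoothstep.
Context {R : realType}.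
Implicit Types x y : R.

Let den_gt0 x : 0 < flatexp 0 x + flatexp 0 (1 - x).
Proof.
have [x0|x0] := ltP 0 x; first by rewrite ltr_pwDl ?flatexp_gt0 ?flatexp_ge0.
by rewrite ltr_wpDl ?flatexp_ge0// flatexp_gt0// subr_gt0 (le_lt_trans x0).
Qed.

Lemma smc_smoothstep : smc (@smoothstep R).
Proof.
have h1 : smc (fun x : R => flatexp 0 (1 - x)).
  by apply: smc_flatexp; apply: (smcB (smc_cst 1) smc_id).
apply: (smcM (smc_flatexp 0 smc_id)); apply: (smcV (smcD (smc_flatexp 0 smc_id) h1)).
by move=> x; rewrite gt_eqF.
Qed.

Lemma smoothstep_eq0 x : x <= 0 -> smoothstep x = 0.
Proof. by move=> x0; rewrite /smoothstep flatexp_eq0// mul0r. Qed.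

Lemma smoothstep_eq1 x : 1 <= x -> smoothstep x = 1.
Proof.
move=> x1; rewrite /smoothstep (@flatexp_eq0 _ _ (1 - x)) ?subr_le0// addr0 divff//.
by rewrite gt_eqF// flatexp_gt0// (lt_le_trans _ x1).
Qed.

Lemma smoothstep_ge0 x : 0 <= smoothstep x.
Proof. by rewrite divr_ge0 ?addr_ge0 ?flatexp_ge0. Qed.

Lemma smoothstep_nd : {homo @smoothstep R : x y / x <= y}.
Proof.
move=> x y xy; rewrite /smoothstep ler_pdivrMr// mulrAC ler_pdivlMr//.
have mono : forall a b : R, a <= b -> flatexp 0 a <= flatexp 0 b.
  move=> a b ab; have [a0|a0] := ltP 0 a; last by rewrite flatexp_eq0// flatexp_ge0.
  have b0 := lt_le_trans a0 ab.
  by rewrite /flatexp a0 b0 !expr0 invr1 !mul1r ler_expR lerN2 lef_pV2.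
rewrite !mulrDr [flatexp 0 y * flatexp 0 x]mulrC lerD2l.
by rewrite ler_pM ?flatexp_ge0 ?mono// lerD2l lerN2.
Qed.

Lemma smoothstep_le1 x : smoothstep x <= 1.
Proof.
have [x1|x1] := leP x 1; last by rewrite smoothstep_eq1// ltW.
by rewrite -(@smoothstep_eq1 1)// smoothstep_nd.
Qed.

Lemma derive_smoothstep_ge0 x : 0 <= 'D_1 (@smoothstep R) x.
Proof.
have dx : derivable (@smoothstep R) x 1 by apply/diff_derivable/smc_diff/smc_smoothstep.
rewrite /derive; apply: (@limr_ge _ _ _ _ _ _ dx).
near=> h; rewrite /= /GRing.scale/= mulr1.
have h0 : h != 0 by near: h; exact: nbhs_dnbhs_neq.
have [hp|hn|hz] := ltgtP h 0; last by rewrite hz eqxx in h0.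
- rewrite nmulr_rge0 ?invr_lt0// subr_le0 smoothstep_nd//.
  by rewrite gerDr ltW.
- by rewrite mulr_ge0// ?invr_ge0 ?(ltW hn)// subr_ge0 smoothstep_nd// lerDr ltW.
Unshelve. all: by end_near. Qed.

Lemma derive_smoothstep_eq0 x : x < 0 \/ 1 < x -> 'D_1 (@smoothstep R) x = 0.
Proof.
case=> x0.
- have h : is_derive x 1 (@smoothstep R) 0.
    apply: (@near_eq_is_derive1 _ (cst 0)).
    by near=> y; rewrite /= smoothstep_eq0// ltW//; near: y; exact: lt_nbhsl.
  by rewrite derive_val.
- have h : is_derive x 1 (@smoothstep R) 0.
    apply: (@near_eq_is_derive1 _ (cst 1)).
    by near=> y; rewrite /= smoothstep_eq1// ltW//; near: y; exact: lt_nbhsr.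
  by rewrite derive_val.
Unshelve. all: by end_near. Qed.

Lemma derive_smoothstep_bounded : exists2 K : R, 0 <= K & forall x, 'D_1 (@smoothstep R) x <= K.
Proof.
have [|c c01 hc] := @EVT_max R ('D_1 smoothstep) 0 1 ler01.
  by apply: continuous_subspaceT; exact/smc_continuous/smc_derive/smc_smoothstep.
exists ('D_1 smoothstep c); first exact: derive_smoothstep_ge0.
move=> x; have [x0|x0] := ltP x 0.
  by rewrite derive_smoothstep_eq0 ?derive_smoothstep_ge0//; left.
have [x1|x1] := ltP 1 x.
  by rewrite derive_smoothstep_eq0 ?derive_smoothstep_ge0//; right.
by apply: hc; rewrite in_itv/= x0.
Qed.

End smoothstep.

(** * Integral estimates *)

Section integral_tools.
Context d (X : measurableType d) (R : realType) (mu : {measure set X -> \bar R}).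

(* Neither f nor g is assumed measurable: in [continuity_equation] the inner
   integral, for an arbitrary disintegration, is only known through bounds. *)
Lemma le_integral_nomeas (D : set X) (f g : X -> \bar R) :
  (forall x, D x -> (f x <= g x)%E) -> (\int[mu]_(x in D) f x <= \int[mu]_(x in D) g x)%E.
Proof.
move=> fg.
have fgD : forall x, ((f \_ D) x <= (g \_ D) x)%E.
  by move=> x; rewrite !patchE; case: ifPn => // /set_mem /fg.
rewrite /integral; apply: leeB; apply: ereal_sup_le => _ [h hh <-].
- exists h => // x; apply: (le_trans (hh x)).
  by apply: (@funepos_le _ _ setT) => [y _|]; [exact: fgD|exact: in_setT].
- exists h => // x; apply: (le_trans (hh x)).
  by apply: (@funeneg_le _ _ setT) => [y _|]; [exact: fgD|exact: in_setT].
Qed.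

Lemma Rintegral_squeeze (D : set X) (l h u : X -> R) : measurable D ->
  mu.-integrable D (EFin \o l) -> mu.-integrable D (EFin \o u) ->
  (forall x, D x -> l x <= h x <= u x) ->
  \int[mu]_(x in D) l x <= \int[mu]_(x in D) h x <= \int[mu]_(x in D) u x.
Proof.
move=> mD il iu lhu.
have il' := integrable_fin_num mD il.
have iu' := integrable_fin_num mD iu.
have lh : (\int[mu]_(x in D) (l x)%:E <= \int[mu]_(x in D) (h x)%:E)%E.
  by apply: le_integral_nomeas => x Dx; rewrite lee_fin; case/andP: (lhu x Dx).
have hu : (\int[mu]_(x in D) (h x)%:E <= \int[mu]_(x in D) (u x)%:E)%E.
  by apply: le_integral_nomeas => x Dx; rewrite lee_fin; case/andP: (lhu x Dx).
(* Since [fine] sends infinite values to 0, it preserves order only once the middle integral is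
   known to be finite, as the two integrable bounds ensure. *)
have hf : (\int[mu]_(x in D) (h x)%:E)%E \is a fin_num.
  rewrite fin_numElt (lt_le_trans _ lh) ?(le_lt_trans hu)//.
    by rewrite ltey_eq iu'.
  by rewrite ltNye_eq il'.
by rewrite !fine_le.
Qed.

Lemma bounded_integrable (D : set X) (f : X -> R) (M : R) : measurable D -> (mu D < +oo)%E ->
  measurable_fun D f -> (forall x, D x -> `|f x| <= M) -> mu.-integrable D (EFin \o f).
Proof.
move=> mD Dfin mf fM; apply: measurable_bounded_integrable => //.
exists M; split; first exact: num_real.
by move=> K MK x /= Dx; apply: (le_trans (fM x Dx)); exact: ltW.
Qed.

End integral_tools.

Lemma open_preimage_measurable_fun d (X : measurableType d) (R : realType) (D : set X) (f : X -> R) :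
  (forall O : set R, open O -> measurable (D `&` f @^-1` O)) -> measurable_fun D f.
Proof.
move=> h; apply: (measurability _ (measurable_realfun.RGenOpens.measurableE R)).
move=> _ [_ [x [y ->]] <-]; apply: h; exact: itv_open.
Qed.

Lemma continuous_measurable_rV (R : realType) n (f : 'rV[R]_n -> R) :
  continuous f -> measurable_fun setT (f : borelRn R n -> R).
Proof.
move=> /continuousP cf; apply: open_preimage_measurable_fun => O /cf oO.
by rewrite setTI; apply: sub_sigma_algebra.
Qed.

Lemma open_measurable_rV (R : realType) n (O : set 'rV[R]_n) :
  open O -> measurable (O : set (borelRn R n)).
Proof. by move=> oO; apply: sub_sigma_algebra. Qed.

Lemma closed_measurable_rV (R : realType) n (O : set 'rV[R]_n) :
  closed O -> measurable (O : set (borelRn R n)).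
Proof.
by move=> cO; rewrite -(setCK O); apply: measurableC; apply: open_measurable_rV; exact: closed_openC.
Qed.

Lemma probability_bounded_integrable (R : realType) n (P : probability (borelRn R n) R)
    (f : 'rV[R]_n -> R) (M : R) : continuous f -> (forall x, `|f x| <= M) ->
  P.-integrable setT (EFin \o f).
Proof.
move=> cf fM; apply: (@bounded_integrable _ _ _ _ _ _ M) => //.
  by rewrite (le_lt_trans (probability_le1 _ _))// ltey.
exact: continuous_measurable_rV.
Qed.

Section probability_integral.
Context d (X : measurableType d) (R : realType) (P : probability X R).

Lemma Rintegral_prob_cst (b : R) : \int[P]_x b = b.
Proof. by rewrite /Rintegral integral_cst//= probability_setT mule1. Qed.

Lemma prob_integrable_cst (b : R) : P.-integrable setT (EFin \o cst b).
Proof.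
apply: (@bounded_integrable _ _ _ _ _ _ `|b|) => //.
by rewrite (le_lt_trans (probability_le1 _ _))// ltey.
Qed.

End probability_integral.

(** * Tensor products of cut-offs in time and space *)

Lemma smc_comp_linear {R : realType} {V W : normedModType R} (f : V -> R) (l : {linear W -> V}) :
  continuous l -> smc f -> smc (fun x => f (l x)).
Proof.
move=> cl; elim=> {f} [c|k dk hk|f g _ hf _ hg|f g _ hf _ hg|f _ hf f0|f _ hf f0|k f _ hf].
- exact: smc_cst.
- have dl x : differentiable l x by exact: linear_differentiable.
  have dkl x : differentiable (k \o l) x by exact: differentiable_comp.
  apply: (@smc_lin _ _ (k \o l)) => // e.
  have [c hc] := hk (l e); exists c => x.
  by rewrite deriveE// diff_comp//= diff_lin// -deriveE// hc.
- exact: smcD.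
- exact: smcM.
- exact: smcV.
- exact: smc_ln.
- exact: smc_flatexp.
Qed.

Lemma smc_fst {R : realType} {V : normedModType R} (f : R -> R) :
  smc f -> smc (fun z : R * V => f z.1).
Proof.
move=> hf; apply: (@smc_comp_linear _ _ _ f fst) => //.
by move=> x; apply: cvg_fst.
Qed.

Lemma smc_snd {R : realType} {V : normedModType R} (f : V -> R) :
  smc f -> smc (fun z : R * V => f z.2).
Proof.
move=> hf; apply: (@smc_comp_linear _ _ _ f snd) => //.
by move=> x; apply: cvg_snd.
Qed.

Lemma is_derive_coord {R : realType} {n : nat} (i : 'I_n) (x e : 'rV[R]_n) :
  is_derive x e (fun x : 'rV[R]_n => x ord0 i) (e ord0 i).
Proof.
have H : h^-1 *: (((fun x : 'rV[R]_n => x ord0 i) \o shift x) (h *: e) - x ord0 i)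
    @[h --> (0:R)^'] --> e ord0 i.
  apply: (@cvg_trans _ ((fun=> e ord0 i) @ (0:R)^')); last exact: cvg_cst.
  apply: near_eq_cvg; near=> h.
  have h0 : h != 0 by near: h; exact: nbhs_dnbhs_neq.
  by rewrite /= !mxE /GRing.scale/= addrK mulKf.
by apply: DeriveDef; [apply/cvg_ex; exists (e ord0 i)|exact/cvg_lim].
Unshelve. all: by end_near. Qed.

Lemma smc_coord {R : realType} {n : nat} (i : 'I_n) : smc (fun x : 'rV[R]_n => x ord0 i).
Proof.
apply: smc_lin => [x|e].
  by apply: (@differentiable_coord R 1 n x ord0 i).
exists (e ord0 i) => x.
by have h := is_derive_coord i x e; rewrite derive_val.
Qed.

(** A smooth substitute for the indicator of [s, t] whose two transitions have width [e]. Its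
    derivative is a smoothed Dirac mass at [s] minus one at [t], so that testing with it compares
    the two times. *)
Definition tbump {R : realType} (s t e : R) (r : R) : R :=
  smoothstep ((r - s) / e) - smoothstep ((r - t) / e).

Section tbump.
Context {R : realType} (s t e : R).
Hypotheses (st : s <= t) (e0 : 0 < e).

Lemma smc_step_affine (a : R) : smc (fun r : R => smoothstep ((r - a) / e)).
Proof.
apply: (smc_comp smc_smoothstep).
by apply: (@smcM _ _ _ (cst e^-1)); [exact: (smcB smc_id (smc_cst a))|exact: smc_cst].
Qed.

Lemma smc_tbump : smc (tbump s t e).
Proof. by apply: smcB; exact: smc_step_affine. Qed.

Lemma tbump_ge0 r : 0 <= tbump s t e r.
Proof.
rewrite subr_ge0 smoothstep_nd// ler_pM2r ?invr_gt0//.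
by rewrite lerD2l lerN2.
Qed.

Lemma tbump_le1 r : tbump s t e r <= 1.
Proof.
by rewrite lerBlDr (le_trans (smoothstep_le1 _))// lerDl smoothstep_ge0.
Qed.

Lemma tbump_supp r : tbump s t e r != 0 -> s <= r <= t + e.
Proof.
apply: contraNT; rewrite negb_and -!ltNge => /orP[rs|tr]; apply/eqP.
  rewrite /tbump !smoothstep_eq0 ?subrr// pmulr_lle0 ?invr_gt0// subr_le0 ltW//.
  exact: (lt_le_trans rs).
rewrite /tbump !smoothstep_eq1 ?subrr// ler_pdivlMr// mul1r lerBrDl// ltW//.
by rewrite (le_lt_trans _ tr)// lerD2r.
Qed.

Lemma derive_step_affine (a r : R) :
  is_derive r 1 (fun r : R => smoothstep ((r - a) / e)) ('D_1 smoothstep ((r - a) / e) / e).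
Proof.
have h : is_derive r 1 (fun r : R => (r - a) / e) e^-1.
  have h1 : is_derive r (1:R) (fun r : R => r - a) 1.
    by have := is_deriveB (is_derive_id r (1:R)) (is_derive_cst a r (1:R)); rewrite subr0.
  have := is_deriveM h1 (is_derive_cst e^-1 r (1:R)).
  by rewrite /GRing.scale/= mulr0 add0r mulr1.
apply: (is_derive1_comp _ h).
by apply/derivableP/diff_derivable/smc_diff/smc_smoothstep.
Qed.

Lemma derive_tbump r : 'D_1 (tbump s t e) r =
  'D_1 smoothstep ((r - s) / e) / e - 'D_1 smoothstep ((r - t) / e) / e.
Proof.
by have h := is_deriveB (derive_step_affine s r) (derive_step_affine t r); rewrite derive_val.
Qed.

End tbump.

Section tensor_test.
Context {R : realType} {n : nat} (chi : R -> R) (f : 'rV[R]_n -> R).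
Hypotheses (hchi : smc chi) (hf : smc f).

Let phi (z : R * 'rV[R]_n) := chi z.1 * f z.2.

Lemma smc_tensor : smc phi.
Proof. by apply: smcM; [exact: smc_fst|exact: smc_snd]. Qed.

Lemma derive_fst (g : R -> R) (z : R * 'rV[R]_n) (e : R * 'rV[R]_n) : smc g ->
  is_derive z e (fun z : R * 'rV[R]_n => g z.1) (e.1 * 'D_1 g z.1).
Proof.
move=> hg; have dg : differentiable g z.1 by exact: smc_diff.
have dl : differentiable (fst : R * 'rV[R]_n -> R) z.
  by apply: linear_differentiable => x; exact: cvg_fst.
have dc : differentiable (fun z : R * 'rV[R]_n => g z.1) z by exact: (smc_diff (smc_fst hg)).
apply: DeriveDef; first exact: diff_derivable.
rewrite deriveE// (_ : (fun z => g z.1) = g \o fst)// diff_comp//= diff_lin/=; last first.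
  by move=> x; exact: cvg_fst.
by rewrite diff1E//= /GRing.scale/= derive1E.
Qed.

Lemma derive_snd (g : 'rV[R]_n -> R) (z : R * 'rV[R]_n) (e : R * 'rV[R]_n) : smc g ->
  is_derive z e (fun z : R * 'rV[R]_n => g z.2) ('D_(e.2) g z.2).
Proof.
move=> hg; have dg : differentiable g z.2 by exact: smc_diff.
have dl : differentiable (snd : R * 'rV[R]_n -> 'rV[R]_n) z.
  by apply: linear_differentiable => x; exact: cvg_snd.
have dc : differentiable (fun z : R * 'rV[R]_n => g z.2) z by exact: (smc_diff (smc_snd hg)).
apply: DeriveDef; first exact: diff_derivable.
rewrite deriveE// (_ : (fun z => g z.2) = g \o snd)// diff_comp//= diff_lin/=; last first.
  by move=> x; exact: cvg_snd.
by rewrite -deriveE.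
Qed.

Lemma derive_tensor (z e : R * 'rV[R]_n) :
  'D_e phi z = e.1 * 'D_1 chi z.1 * f z.2 + chi z.1 * 'D_(e.2) f z.2.
Proof.
have h := is_deriveM (derive_fst z e hchi) (derive_snd z e hf).
rewrite /phi (_ : (fun z => _) = ((fun z => chi z.1) * (fun z => f z.2)))//.
rewrite derive_val /GRing.scale/= addrC; congr (_ + _); by rewrite mulrC.
Qed.

Lemma time_deriv_tensor t x : time_deriv phi t x = 'D_1 chi t * f x.
Proof. by rewrite /time_deriv derive_tensor/= derive0 mulr0 addr0 mul1r. Qed.

Lemma space_grad_tensor t x :
  space_grad phi t x = chi t *: (\row_i 'D_(delta_mx ord0 i) f x).
Proof.
by apply/rowP => i; rewrite !mxE derive_tensor/= mul0r mul0r add0r.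
Qed.

Lemma test_function_tensor (T a b M : R) : 0 < a -> b < T ->
  (forall r, chi r != 0 -> a <= r <= b) -> (forall x, f x != 0 -> `|x| <= M) ->
  test_function T phi.
Proof.
move=> a0 bT chiab fM.
have sub : [set z | phi z != 0] `<=` `[a, b] `*` closed_ball_ (fun x => `|x|) (0 : 'rV[R]_n) M.
  move=> [r x] /=; rewrite /phi/= mulf_eq0 negb_or => /andP[/chiab rab /fM xM].
  by split=> //=; rewrite ?in_itv//= /closed_ball_/= sub0r normrN.
have cp : compact (`[a, b] `*` closed_ball_ (fun x => `|x|) (0 : 'rV[R]_n) M).
  apply: compact_setX; first exact: segment_compact.
  apply: bounded_closed_compact; last exact: closed_closed_ball_.
  exists M; split; first exact: num_real.
  by move=> K MK x /=; rewrite /closed_ball_/= sub0r normrN => /le_trans; apply; exact: ltW.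
have cl : closed (`[a, b] `*` closed_ball_ (fun x => `|x|) (0 : 'rV[R]_n) M).
  by apply: compact_closed => //; exact: norm_hausdorff.
have clsub : closure [set z | phi z != 0] `<=`
    `[a, b] `*` closed_ball_ (fun x => `|x|) (0 : 'rV[R]_n) M.
  by rewrite closureE => z; apply; split.
split.
- exact/smc_smooth/smc_tensor.
- by apply: (subclosed_compact _ cp clsub); exact: closed_closure.
- move=> z /clsub[/= + _]; rewrite in_itv/= => /andP[az zb]; split=> //=.
  by rewrite in_itv/= (lt_le_trans a0)//= (le_lt_trans zb).
Qed.

End tensor_test.

(** * The Lipschitz estimate in time *)

Section lebesgue_segment.
Context {R : realType}.
Notation lam := (@lebesgue_measure R).

Lemma segment_integrable (f : R -> R) (a b : R) :
  {within `[a, b], continuous f} -> lam.-integrable `[a, b] (EFin \o f).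
Proof.
by move=> cf; apply: continuous_compact_integrable => //; exact: segment_compact.
Qed.

Lemma lebesgue_segment_lty (a b : R) : (lam `[a, b]%classic < +oo)%E.
Proof. by rewrite lebesgue_measure_itv/=; case: ifPn => _; rewrite ltry. Qed.

Lemma within_segmentP (f : R -> R) (a b : R) : {within `[a, b], continuous f} <->
  forall s, s \in `[a, b] -> forall eps, 0 < eps -> exists2 d, 0 < d &
    forall r, r \in `[a, b] -> `|r - s| < d -> `|f r - f s| <= eps.
Proof.
rewrite subspace_continuousP; split=> h s sab.
  move=> eps e0; have := h s sab => /cvgrPdist_le/(_ _ e0).
  rewrite near_withinE /= => -[d /= d0 hd]; exists d => // r rab rs.
  by rewrite distrC; apply: hd => //=; rewrite distrC.
apply/cvgrPdist_le => eps e0; have [d d0 hd] := h s sab _ e0.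
rewrite near_withinE; exists d => //= r rs rab.
by rewrite distrC; apply: hd => //; rewrite distrC.
Qed.

Lemma within_continuousM (A : set R) (f g : R -> R) : {within A, continuous f} ->
  {within A, continuous g} -> {within A, continuous (fun r => f r * g r)}.
Proof. by move=> cf cg x; apply: cvgM; [exact: cf|exact: cg]. Qed.

Lemma within_continuousD (A : set R) (f g : R -> R) : {within A, continuous f} ->
  {within A, continuous g} -> {within A, continuous (fun r => f r + g r)}.
Proof. by move=> cf cg x; apply: cvgD; [exact: cf|exact: cg]. Qed.

Lemma within_continuousB (A : set R) (f g : R -> R) : {within A, continuous f} ->
  {within A, continuous g} -> {within A, continuous (fun r => f r - g r)}.
Proof. by move=> cf cg x; apply: cvgB; [exact: cf|exact: cg]. Qed.

Variables (a e T : R).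
Hypotheses (a0 : 0 < a) (e0 : 0 < e) (aeT : a + e < T).
Let w (r : R) : R := 'D_1 smoothstep ((r - a) / e) / e.

Let w_cont : continuous w.
Proof.
apply: smc_continuous; apply: (@smcM _ _ _ (cst e^-1)); last exact: smc_cst.
apply: (@smc_comp _ _ ('D_1 smoothstep) (fun r => (r - a) / e)).
  exact/smc_derive/smc_smoothstep.
by apply: (@smcM _ _ _ (cst e^-1)); [exact: (smcB smc_id (smc_cst a))|exact: smc_cst].
Qed.

Let w_ge0 r : 0 <= w r.
Proof. by rewrite mulr_ge0 ?derive_smoothstep_ge0// invr_ge0 ltW. Qed.

Let T_gt0 : 0 < T.
Proof. by rewrite (lt_trans _ aeT)// addr_gt0. Qed.

Let w_int : \int[lam]_(r in `[0, T]) w r = 1.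
Proof.
rewrite /Rintegral (@continuous_FTC2 _ _ (fun r => smoothstep ((r - a) / e)))//.
- have h0 : smoothstep ((0 - a) / e) = 0.
    by rewrite smoothstep_eq0// sub0r pmulr_lle0 ?invr_gt0// oppr_le0 ltW.
  have h1 : smoothstep ((T - a) / e) = 1.
    by rewrite smoothstep_eq1// ler_pdivlMr// mul1r lerBrDl ltW.
  by rewrite h0 h1 sube0.
- by apply: continuous_subspaceT.
- have cs : continuous (fun r : R => smoothstep ((r - a) / e)).
    by apply: smc_continuous; exact: smc_step_affine.
  split.
  + move=> r _; have h := derive_step_affine e a r; exact: ex_derive.
  + by apply: cvg_at_right_filter; exact: cs.
  + by apply: cvg_at_left_filter; exact: cs.
- by move=> r _; rewrite derive1E; have h := derive_step_affine e a r; rewrite derive_val.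
Qed.

Let w_supp r : w r != 0 -> a <= r <= a + e.
Proof.
apply: contraNT; rewrite negb_and -!ltNge => h; apply/eqP; rewrite /w derive_smoothstep_eq0 ?mul0r//.
case/orP : h => h; [left|right].
  by rewrite pmulr_llt0 ?invr_gt0// subr_lt0.
by rewrite ltr_pdivlMr// mul1r ltrBrDl.
Qed.

(** [w] is the derivative of a step from 0 to 1, hence a probability density on [[0, T]], and it is
    supported in [a, a + e]: the integral is a weighted mean of values of [m] close to [c]. *)
Lemma step_average (m : R -> R) (c d : R) : {within `[0, T], continuous m} ->
  (forall r, a <= r <= a + e -> `|m r - c| <= d) ->
  c - d <= \int[lam]_(r in `[0, T]) (w r * m r) <= c + d.
Proof.
move=> cm hm.
have iw : lam.-integrable `[0, T] (EFin \o w).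
  by apply: segment_integrable; exact: continuous_subspaceT.
have iz (k : R) : lam.-integrable `[0, T] (EFin \o (fun r => w r * k)).
  by apply: segment_integrable; apply: within_continuousM;
    [exact: continuous_subspaceT|apply: continuous_subspaceT; exact: cst_continuous].
have zE (k : R) : \int[lam]_(r in `[0, T]) (w r * k) = k.
  by rewrite RintegralZr// w_int mul1r.
rewrite -[X in X <= _ <= _]zE -[X in _ <= _ <= X]zE.
apply: (@Rintegral_squeeze _ _ _ lam `[0, T] (fun r => w r * (c - d)) (fun r => w r * m r)
  (fun r => w r * (c + d)) (measurable_itv _) (iz _) (iz _)) => r _.
have [->|wr] := eqVneq (w r) 0; first by rewrite !mul0r lexx.
have := hm _ (w_supp wr); rewrite ler_distl => /andP[h1 h2].
by rewrite !ler_wpM2l.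
Qed.

End lebesgue_segment.

(** The bookkeeping of [a_priori_interior], kept apart so that [lra] runs in a small context. [A1]
    and [A2] are the averages near [s] and [t], and [A3] is [N] times the integral of the
    cut-off. *)
Lemma a_priori_arith (R : realType) (A1 A2 A3 ms mt eps N s t e : R) :
  0 <= A1 - A2 + A3 -> A3 <= N * (t + e - s) -> A1 <= ms + eps / 3 ->
  mt - eps / 3 <= A2 -> N * e <= eps / 3 -> mt - ms <= eps + N * (t - s).
Proof. lra. Qed.

Section a_priori.
Context {R : realType} {n : nat}.
Notation lam := (@lebesgue_measure R).
Variables (T : R) (w : R -> 'rV[R]_n -> 'rV[R]_n) (mu : R -> probability (borelRn R n) R).
Hypothesis (mu_cont : narrowly_continuous T mu) (ce : continuity_equation T w mu).

Definition grad (f : 'rV[R]_n -> R) (x : 'rV[R]_n) : 'rV[R]_n :=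
  \row_i 'D_(delta_mx ord0 i) f x.

Lemma compact_supp_bounded (f : 'rV[R]_n -> R) (M : R) : continuous f ->
  (forall x, f x != 0 -> `|x| <= M) -> exists K, forall x, `|f x| <= K.
Proof.
move=> cf fM.
have cp : compact (closed_ball_ (fun x => `|x|) (0 : 'rV[R]_n) M).
  apply: bounded_closed_compact; last exact: closed_closed_ball_.
  exists M; split; first exact: num_real.
  by move=> K MK x /=; rewrite /closed_ball_/= sub0r normrN => /le_trans; apply; exact: ltW.
have cfc : {within closed_ball_ (fun x => `|x|) (0 : 'rV[R]_n) M, continuous f}.
  exact: continuous_subspaceT.
have [K [_ hK]] := compact_bounded (continuous_compact cfc cp).
exists (`|K + 1|) => x; have [->|fx] := eqVneq (f x) 0; first by rewrite normr0.
apply: (le_trans _ (ler_norm _)); apply: hK; first by rewrite ltrDl.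
by exists x => //; rewrite /closed_ball_/= sub0r normrN; exact: fM.
Qed.

Variables (f : 'rV[R]_n -> R) (M N : R).
Hypotheses (sf : smc f) (fM : forall x, f x != 0 -> `|x| <= M).
Hypothesis (wN : forall r x, r \in `[0, T] -> `|dotv (w r x) (grad f x)| <= N).

Let m (r : R) : R := \int[mu r]_x f x.

Let cf : continuous f := smc_continuous sf.

Let m_cont : {within `[0, T], continuous m}.
Proof. by apply: mu_cont => //; exact: compact_supp_bounded fM. Qed.

Lemma dotvZr (x y : 'rV[R]_n) c : dotv x (c *: y) = c * dotv x y.
Proof. by rewrite /dotv mulr_sumr; apply: eq_bigr => i _; rewrite !mxE mulrCA. Qed.

(** Test with [tbump s t e] times [f]. The time derivative contributes an average of [m] near [s]
    minus one near [t]; the transport term is at most [N] times the integral of the cut-off, itself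
    at most [t + e - s]. For small [e] this is the bound up to [eps]. *)
Lemma a_priori_interior s t : 0 < s -> s <= t -> t < T -> m t - m s <= N * (t - s).
Proof.
move=> s0 st tT.
have N0 : 0 <= N.
  apply: le_trans (normr_ge0 _) (@wN 0 0 _).
  by rewrite in_itv/= lexx (le_trans (ltW s0))// (le_trans st)// ltW.
apply/ler_addgt0Pl => eps eps0.
have s01 : s \in `[0, T] by rewrite in_itv/= ltW//= (le_trans st)// ltW.
have t01 : t \in `[0, T] by rewrite in_itv/= (ltW tT) (le_trans (ltW s0)).
have eps3 : 0 < eps / 3 by rewrite divr_gt0.
have [d1 d10 hd1] := (within_segmentP m 0 T).1 m_cont s s01 _ eps3.
have [d2 d20 hd2] := (within_segmentP m 0 T).1 m_cont t t01 _ eps3.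
(* [t + e < T] keeps the support of the cut-off inside the open interval, [e < d1] and [e < d2] keep
   the averages within [eps / 3] of [m s] and [m t], and the last condition absorbs the excess
   length [e] of the support. *)
have [e [e0 teT ed1 ed2 Ne]] : exists e : R,
    [/\ 0 < e, t + e < T, e < d1, e < d2 & N * e <= eps / 3].
  pose e := Num.min (Num.min ((T - t) / 2) (d1 / 2)) (Num.min (d2 / 2) (eps / 3 / (N + 1))).
  have N1 : 0 < N + 1 by rewrite ltr_wpDl.
  have e0 : 0 < e by rewrite !lt_min !divr_gt0 ?subr_gt0.
  have : e <= e by []. rewrite {2}/e !le_min => /andP[/andP[e1 e2] /andP[e3 e4]].
  exists e; split => //.
  - by rewrite -ltrBrDl (le_lt_trans e1)// ltr_pdivrMr// ltr_pMr ?subr_gt0// ltr1n.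
  - by rewrite (le_lt_trans e2)// ltr_pdivrMr// ltr_pMr// ltr1n.
  - by rewrite (le_lt_trans e3)// ltr_pdivrMr// ltr_pMr// ltr1n.
  - rewrite (le_trans (ler_wpM2l N0 e4))// mulrCA ger_pMr// ler_pdivrMr// mul1r.
    by rewrite lerDl.
pose chi := tbump s t e.
pose phi (z : R * 'rV[R]_n) := chi z.1 * f z.2.
have schi : smc chi by exact: smc_tbump.
have tphi : test_function T phi.
  by apply: (test_function_tensor schi sf s0 teT _ fM) => r; exact: tbump_supp.
have := ce tphi.
pose F r x := time_deriv phi r x + dotv (w r x) (space_grad phi r x).
have chi0 r : 0 <= chi r by exact: tbump_ge0.
have dchi_cont : continuous ('D_1 chi) by exact/smc_continuous/smc_derive.
have [K fK] := compact_supp_bounded cf fM.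
have intf r (a b : R) : (mu r).-integrable setT (EFin \o (fun x => a * f x + b)).
  apply: (@probability_bounded_integrable _ _ _ _ (`|a| * K + `|b|)).
    exact: smc_continuous (smcD (smcZ a sf) (smc_cst b)).
  by move=> x; rewrite (le_trans (ler_normD _ _))// lerD2r normrM ler_wpM2l.
have Eint r (a b : R) : \int[mu r]_x (a * f x + b) = a * m r + b.
  have h1 := @probability_bounded_integrable _ _ (mu r) f K cf fK.
  have h2 : (mu r).-integrable setT (EFin \o (fun x => a * f x)).
    by apply: eq_integrable (intf r a 0) => // x _ /=; rewrite addr0.
  have h3 : (mu r).-integrable setT (EFin \o (fun x : borelRn R n => b)).
    exact: prob_integrable_cst.
  by rewrite RintegralD// RintegralZl// Rintegral_prob_cst.
(* The inner integral is not known to depend measurably on [r]; it is only enclosed between two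
   continuous functions, which is all that [Rintegral_squeeze] asks for. *)
have bd r : r \in `[0, T] -> 'D_1 chi r * m r - N * chi r <= \int[mu r]_x F r x <= 'D_1 chi r * m r + N * chi r.
  move=> rT; rewrite -!Eint; apply: (Rintegral_squeeze _ (intf _ _ _) (intf _ _ _)) => // x _.
  have := wN x rT; rewrite ler_norml => /andP[h1 h2].
  rewrite /F (time_deriv_tensor schi sf) (space_grad_tensor schi sf) dotvZr -/(grad f x).
  rewrite lerD2l lerD2l -mulNr [N * _]mulrC [- N * _]mulrC.
  by apply/andP; split; apply: ler_wpM2l.
have ccont : {within `[0, T], continuous chi}.
  by apply: continuous_subspaceT; exact: smc_continuous.
have cN : {within `[0, T], continuous (fun r => N * chi r)}.
  by apply: within_continuousM => //; apply: continuous_subspaceT; exact: cst_continuous.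
have cdm : {within `[0, T], continuous (fun r => 'D_1 chi r * m r)}.
  by apply: within_continuousM => //; exact: continuous_subspaceT.
have := @Rintegral_squeeze _ _ _ lam `[0, T] (fun r => 'D_1 chi r * m r - N * chi r)
  (fun r => \int[mu r]_x F r x) (fun r => 'D_1 chi r * m r + N * chi r) (measurable_itv _)
  (segment_integrable (within_continuousB cdm cN)) (segment_integrable (within_continuousD cdm cN)) bd.
move=> /andP[_ H] H0; rewrite H0 RintegralD// in H; last 2 first.
  exact: segment_integrable.
  exact: segment_integrable.
have Hchi : \int[lam]_(r in `[0, T]) (N * chi r) <= N * (t + e - s).
  rewrite RintegralZl//; last exact: segment_integrable.
  apply: ler_wpM2l => //.
  have ii : lam.-integrable `[0, T] (EFin \o (\1_`[s, t + e] : R -> R)).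
    apply: (@bounded_integrable _ _ _ _ _ _ 1) => //.
    - exact: lebesgue_segment_lty.
    - by move=> r _; rewrite indicE; case: (_ \in _); rewrite ?normr1 ?normr0.
  apply: (@le_trans _ _ (\int[lam]_(r in `[0, T]) (\1_`[s, t + e] r))).
    apply: le_Rintegral => //; first exact: segment_integrable.
    move=> r _; rewrite indicE; have [->|cr] := eqVneq (chi r) 0; first exact: ler0n.
    rewrite mem_set ?tbump_le1//=; rewrite in_itv/=; exact: tbump_supp cr.
  have setE : `[s, t + e]%classic `&` `[0, T]%classic = `[s, t + e]%classic :> set R.
    apply: setIidl => r /=; rewrite !in_itv/= => /andP[r1 r2].
    by rewrite (le_trans (ltW s0))//= (le_trans r2)// ltW.
  rewrite /Rintegral integral_indic//= setE lebesgue_measure_itv/= lte_fin ifT//.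
  by rewrite (le_lt_trans st)// ltrDl.
have seT : s + e < T by rewrite (le_lt_trans _ teT)// lerD2r.
have w1 : m s - eps / 3 <= \int[lam]_(r in `[0, T])
    ('D_1 smoothstep ((r - s) / e) / e * m r) <= m s + eps / 3.
  apply: step_average => // r /andP[r1 r2]; apply: hd1.
    by rewrite in_itv/= (le_trans (ltW s0))//= (le_trans r2)// ltW.
  by rewrite ger0_norm ?subr_ge0// ltrBlDl (le_lt_trans r2)// ltrD2l.
have w2 : m t - eps / 3 <= \int[lam]_(r in `[0, T])
    ('D_1 smoothstep ((r - t) / e) / e * m r) <= m t + eps / 3.
  apply: step_average => //; first exact: (lt_le_trans s0 st).
  move=> r /andP[r1 r2]; apply: hd2.
    by rewrite in_itv/= (le_trans (ltW s0)) ?(le_trans st)//= (le_trans r2)// ltW.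
  by rewrite ger0_norm ?subr_ge0// ltrBlDl (le_lt_trans r2)// ltrD2l.
have cw (a : R) : {within `[0, T], continuous (fun r => 'D_1 smoothstep ((r - a) / e) / e * m r)}.
  apply: within_continuousM => //; apply: continuous_subspaceT.
  rewrite (_ : (fun r => _) = 'D_1 (fun r : R => smoothstep ((r - a) / e))).
    exact: smc_continuous (smc_derive (smc_step_affine e a) 1).
  by apply/funext => r; have h := derive_step_affine e a r; rewrite derive_val.
have E : \int[lam]_(r in `[0, T]) ('D_1 chi r * m r) =
    \int[lam]_(r in `[0, T]) ('D_1 smoothstep ((r - s) / e) / e * m r) -
    \int[lam]_(r in `[0, T]) ('D_1 smoothstep ((r - t) / e) / e * m r).
  rewrite -RintegralB//; try exact: segment_integrable.
  by apply: eq_Rintegral => r _; rewrite derive_tbump// mulrBl.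
rewrite E in H.
move: w1 w2 => /andP[_ w1] /andP[w2 _].
exact: a_priori_arith H Hchi w1 w2 Ne.
Qed.

(** Test functions vanish near the end points, so these are reached from the interior estimate by
    continuity of [m]. *)
Lemma a_priori_segment_le s t : 0 < T -> 0 <= s -> s <= t -> t <= T -> m t - m s <= N * (t - s).
Proof.
move=> T0 s0 st tT.
have N0 : 0 <= N.
  apply: le_trans (normr_ge0 _) (@wN 0 0 _).
  by rewrite in_itv/= lexx ltW.
apply/ler_addgt0Pl => eps eps0.
have s01 : s \in `[0, T] by rewrite in_itv/= s0 (le_trans st).
have t01 : t \in `[0, T] by rewrite in_itv/= tT (le_trans s0).
have eps2 : 0 < eps / 2 by rewrite divr_gt0.
have [d1 d10 hd1] := (within_segmentP m 0 T).1 m_cont s s01 _ eps2.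
have [d2 d20 hd2] := (within_segmentP m 0 T).1 m_cont t t01 _ eps2.
pose l : R := Num.min (1 / 2) (Num.min (d1 / (T + T)) (d2 / (T + T))).
have l0 : 0 < l by rewrite !lt_min !divr_gt0// addr_gt0.
have : l <= l by []. rewrite {2}/l !le_min => /andP[l12 /andP[ld1 ld2]].
have l1 : l < 1 by rewrite (le_lt_trans l12)// ltr_pdivrMr// mul1r ltr1n.
(* A contraction towards the midpoint [T / 2]: it maps [[0, T]] into the open interval, shortens
   [t - s] and moves each point by at most [l * T], which is below [d1] and [d2] by the choice of
   [l]. *)
pose c (r : R) := (1 - l) * r + l * (T / 2).
have cin r : 0 <= r <= T -> 0 < c r < T.
  move=> /andP[r0 rT]; apply/andP; split; rewrite /c.
    by rewrite ltr_wpDl ?mulr_ge0 ?subr_ge0 ?(ltW l1)// mulr_gt0// divr_gt0.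
  have : (1 - l) * r <= (1 - l) * T by rewrite ler_wpM2l// subr_ge0 ltW.
  have : l * (T / 2) < l * T by rewrite ltr_pM2l// ltr_pdivrMr// ltr_pMr// ltr1n.
  lra.
have cd r d : 0 <= r <= T -> 0 < d -> l <= d / (T + T) -> `|c r - r| < d.
  move=> /andP[r0 rT] d0; rewrite ler_pdivlMr ?addr_gt0// => h.
  rewrite (_ : c r - r = l * (T / 2 - r)); last by rewrite /c; ring.
  rewrite normrM (gtr0_norm l0) (@le_lt_trans _ _ (l * T))//.
    by rewrite ler_wpM2l ?(ltW l0)// ler_norml; apply/andP; split; lra.
  by apply: (lt_le_trans _ h); rewrite ltr_pM2l// ltrDl.
have s1 : 0 <= s <= T by rewrite s0 (le_trans st).
have t1 : 0 <= t <= T by rewrite (le_trans s0).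
have /andP[cs0 csT] := cin _ s1; have /andP[ct0 ctT] := cin _ t1.
have cst : c s <= c t by rewrite lerD2r ler_wpM2l// subr_ge0 ltW.
have := a_priori_interior cs0 cst ctT.
have csin : c s \in `[0, T] by rewrite in_itv/= !ltW.
have ctin : c t \in `[0, T] by rewrite in_itv/= !ltW.
have := hd1 (c s) csin (cd _ _ s1 d10 ld1); rewrite ler_norml => /andP[h1 h2].
have := hd2 (c t) ctin (cd _ _ t1 d20 ld2); rewrite ler_norml => /andP[h3 h4].
have E : c t - c s = (1 - l) * (t - s) by rewrite /c; ring.
have : N * (c t - c s) <= N * (t - s).
  by rewrite E ler_wpM2l// ler_piMl ?subr_ge0// gerBl ltW.
lra.
Qed.

End a_priori.

Lemma dotvNr (R : realType) n (x y : 'rV[R]_n) : dotv x (- y) = - dotv x y.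
Proof. by rewrite -scaleN1r dotvZr mulN1r. Qed.

Lemma gradN (R : realType) n (f : 'rV[R]_n -> R) x : smc f ->
  grad (fun x => - f x) x = - grad f x.
Proof.
move=> sf; apply/rowP => i; rewrite !mxE.
by rewrite deriveN//; apply/diff_derivable/smc_diff.
Qed.

(** The reverse inequality is the one-sided estimate for [- f], which has the same support and the
    same bound [N]. *)
Lemma a_priori (R : realType) n (T : R) (w : R -> 'rV[R]_n -> 'rV[R]_n)
    (mu : R -> probability (borelRn R n) R) (f : 'rV[R]_n -> R) (M N : R) :
  0 < T -> narrowly_continuous T mu -> continuity_equation T w mu ->
  smc f -> (forall x, f x != 0 -> `|x| <= M) ->
  (forall r x, r \in `[0, T] -> `|dotv (w r x) (grad f x)| <= N) ->
  forall s t, s \in `[0, T] -> t \in `[0, T] ->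
  `|\int[mu t]_x f x - \int[mu s]_x f x| <= N * `|t - s|.
Proof.
move=> T0 nc ce sf fM wN.
suff H s t : 0 <= s -> s <= t -> t <= T -> `|\int[mu t]_x f x - \int[mu s]_x f x| <= N * (t - s).
  move=> s t; rewrite !in_itv/= => /andP[s0 sT] /andP[t0 tT].
  have [st|ts] := leP s t; first by rewrite (@ger0_norm _ (t - s)) ?subr_ge0// H.
  by rewrite distrC [X in _ * X]distrC (@ger0_norm _ (s - t)) ?subr_ge0 ?H// ltW.
move=> s0 st tT; rewrite ler_norml; apply/andP; split; last exact: (a_priori_segment_le nc ce sf fM wN).
rewrite lerNl opprB.
have sNf : smc (fun x => - f x) by apply: smc_eq (smcZ (-1) sf) => x; rewrite mulN1r.
have [K fK] := compact_supp_bounded (smc_continuous sf) fM.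
have NE r : \int[mu r]_x (- f x) = - \int[mu r]_x f x.
  under eq_Rintegral do rewrite -mulN1r.
  rewrite RintegralZl ?mulN1r//.
  exact: probability_bounded_integrable (smc_continuous sf) fK.
have := @a_priori_segment_le _ _ _ _ _ nc ce (fun x => - f x) M N sNf _ _ s t T0 s0 st tT.
rewrite !NE opprK addrC; apply.
  by move=> x; rewrite oppr_eq0; exact: fM.
by move=> r x rT; rewrite gradN// dotvNr normrN wN.
Qed.

(** * Comparison of norms and logarithmic cut-offs *)

Section euclid.
Context {R : realType}.

Lemma coord_le_enorm n (x : 'rV[R]_n) i : `|x ord0 i| <= enorm x.
Proof.
rewrite -sqrtr_sqr ler_wsqrtr// (bigD1 i)//= lerDl.
by apply: sumr_ge0 => j _; exact: sqr_ge0.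
Qed.

Lemma coord_le_norm n (x : 'rV[R]_n) i : `|x ord0 i| <= `|x|.
Proof.
rewrite [leRHS]/Num.norm/= mx_normrE.
exact: (le_bigmax _ (fun ij => `|x ij.1 ij.2|) (ord0, i)).
Qed.

Lemma enorm_le_norm n (x : 'rV[R]_n) : enorm x <= n%:R * `|x|.
Proof.
rewrite -(@ger0_norm _ (n%:R * `|x|)) ?mulr_ge0// -sqrtr_sqr ler_wsqrtr//.
have h i : x ord0 i ^+ 2 <= `|x| ^+ 2.
  by rewrite -[leLHS]ger0_norm ?sqr_ge0// normrX lerXn2r ?nnegrE// coord_le_norm.
apply: (@le_trans _ _ (\sum_(i < n) `|x| ^+ 2)); first exact: ler_sum.
rewrite sumr_const card_ord -[leLHS]mulr_natl exprMn ler_wpM2r ?sqr_ge0//.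
by rewrite -natrX ler_nat; case: (n) => // k; rewrite expnS expn1 leq_pmulr.
Qed.

Lemma norm_le_coord n (x : 'rV[R]_n) (c : R) : 0 <= c ->
  (forall i, `|x ord0 i| <= c) -> `|x| <= c.
Proof.
move=> c0 h; rewrite [leLHS]/Num.norm/= mx_normrE.
by apply: bigmax_le => // -[i j] _ /=; rewrite (ord1 i).
Qed.

Lemma norm_sqr_le_sum n (x : 'rV[R]_n) : `|x| ^+ 2 <= \sum_(i < n) x ord0 i ^+ 2.
Proof.
have s0 : 0 <= \sum_(i < n) x ord0 i ^+ 2 by apply: sumr_ge0 => j _; exact: sqr_ge0.
rewrite -(@sqr_sqrtr _ (\sum_(i < n) x ord0 i ^+ 2))// lerXn2r ?nnegrE ?sqrtr_ge0//.
by apply: norm_le_coord => [|i]; [exact: sqrtr_ge0|exact: coord_le_enorm].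
Qed.

End euclid.

Section logcut.
Context {R : realType} {n : nat}.

(* [logcut k] tends to 1 while (1 + |x|) |grad (logcut k) x| is O(1/k) uniformly
   in x, so that vector fields of linear growth move no mass to infinity. *)
Definition logcut (k : nat) (x : 'rV[R]_n) : R :=
  smoothstep (2 - ln (1 + \sum_(i < n) x ord0 i ^+ 2) / k.+1%:R).

Let q (x : 'rV[R]_n) : R := 1 + \sum_(i < n) x ord0 i ^+ 2.

Let q_ge1 x : 1 <= q x.
Proof. by rewrite lerDl; apply: sumr_ge0 => j _; exact: sqr_ge0. Qed.

Let q_gt0 x : 0 < q x.
Proof. exact: lt_le_trans (q_ge1 x). Qed.

Let smc_q : smc q.
Proof.
apply: (smcD (smc_cst 1)); apply: smc_sum => i.
by apply: smc_eq (smcM (smc_coord i) (smc_coord i)) => x; rewrite expr2.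
Qed.

Let u (k : nat) (x : 'rV[R]_n) : R := 2 - k.+1%:R^-1 * ln (q x).

Let smc_u k : smc (u k).
Proof.
by apply: (smcB (smc_cst 2)); apply: smcZ; apply: smc_ln.
Qed.

Let logcutE k x : logcut k x = smoothstep (u k x).
Proof. by rewrite /logcut /u mulrC. Qed.

Lemma smc_logcut k : smc (logcut k).
Proof.
by apply: smc_eq (smc_comp smc_smoothstep (smc_u k)) => x; rewrite logcutE.
Qed.

Lemma logcut_ge0 k x : 0 <= logcut k x.
Proof. exact: smoothstep_ge0. Qed.

Lemma logcut_le1 k x : logcut k x <= 1.
Proof. exact: smoothstep_le1. Qed.

Lemma logcut_supp k : exists M : R, forall x, logcut k x != 0 -> `|x| <= M.
Proof.
exists (expR (2 * k.+1%:R)) => x; apply: contraNT; rewrite -ltNge => xM.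
rewrite logcutE smoothstep_eq0// subr_le0 mulrC ler_pdivlMr//.
have M1 : 1 <= expR (2 * k.+1%:R) :> R by rewrite -expR0 ler_expR mulr_ge0.
rewrite -[leLHS]expRK ler_ln ?posrE ?expR_gt0//.
apply: (le_trans (ltW xM)); rewrite /q.
apply: (@le_trans _ _ (`|x| ^+ 2)).
  by rewrite expr2 ler_peMl// (le_trans M1)// ltW.
by rewrite (le_trans (norm_sqr_le_sum x))// lerDr.
Qed.

Lemma logcut_cvg1 x : logcut k x @[k --> \oo] --> (1 : R).
Proof.
apply: (@cvg_trans _ ((fun=> 1 : R) @ \oo)); last exact: cvg_cst.
apply: near_eq_cvg; near=> k.
rewrite logcutE smoothstep_eq1// /u lerBrDr -lerBrDl mulrC ler_pdivrMr//.
rewrite (_ : 2 - 1 = 1) ?mul1r; last by rewrite (_ : 2 = 1 + 1)// addrK.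
apply: (@le_trans _ _ k%:R); last by rewrite ler_nat.
by near: k; exact: nbhs_infty_ger.
Unshelve. all: by end_near. Qed.

(** The partial derivatives of [ln (q x)] are [2 * x ord0 i / q x], and
    [(1 + a) * (2 * a) <= (1 + a ^+ 2) * 4]: the growth factor [1 + |x|] is compensated. The sum
    over coordinates gives [n], and the scaling of the logarithm gives [k.+1]. *)
Lemma grad_logcut_le (K : R) k x : (forall y, 'D_1 (@smoothstep R) y <= K) ->
  (1 + `|x|) * \sum_(i < n) `|grad (logcut k) x ord0 i| <= 4 * n%:R * K / k.+1%:R.
Proof.
move=> hK.
have K0 : 0 <= K by apply: le_trans (hK 0); exact: derive_smoothstep_ge0.
suff H i : (1 + `|x|) * `|grad (logcut k) x ord0 i| <= 4 * K / k.+1%:R.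
  rewrite mulr_sumr (le_trans (ler_sum _ (fun i _ => H i)))//.
  by rewrite sumr_const card_ord -[leLHS]mulr_natl !mulrA [n%:R * 4]mulrC.
have dq : is_derive x (delta_mx ord0 i : 'rV[R]_n) q (2 * x ord0 i).
  rewrite /q; have h1 j : is_derive x (delta_mx ord0 i : 'rV[R]_n)
     (fun x : 'rV[R]_n => x ord0 j ^+ 2) (2 * x ord0 j * (j == i)%:R).
    have h := is_deriveX 2 (is_derive_coord j x (delta_mx ord0 i)).
    apply: is_derive_eq h _; rewrite mxE eqxx/= /GRing.scale/= expr1.
    by ring.
  have h2 := is_deriveD (is_derive_cst (1:R) x (delta_mx ord0 i : 'rV[R]_n)) (is_derive_sum h1).
  rewrite (_ : (fun x => _) = (cst 1 + \sum_(j < n) (fun x : 'rV[R]_n => x ord0 j ^+ 2))); last first.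
    by apply/funext => y; rewrite /= fct_sumE.
  apply: is_derive_eq h2 _; rewrite add0r (bigD1 i)//= eqxx mulr1 big1 ?addr0// => j ji.
  by rewrite (negbTE ji) mulr0.
have dlnq := diff_comp1 (smc_diff smc_q x) (is_derive1_ln (q_gt0 x)).
have du : 'D_(delta_mx ord0 i) (u k) x = - (k.+1%:R^-1 * ((q x)^-1 * (2 * x ord0 i))).
  have /derivableP h : derivable (fun x => ln (q x)) x (delta_mx ord0 i).
    by apply: diff_derivable; exact: dlnq.1.
  have h2 := is_deriveB (is_derive_cst (2:R) x (delta_mx ord0 i : 'rV[R]_n))
    (is_deriveZ k.+1%:R^-1 h).
  rewrite (_ : u k = (cst 2 - (k.+1%:R^-1 \*: (fun x => ln (q x)))))//.
  by rewrite derive_val dlnq.2 derive_val sub0r.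
have [_ dc] := diff_comp1 (smc_diff (smc_u k) x)
  (derivableP (diff_derivable (smc_diff smc_smoothstep (u k x)))).
rewrite mxE (_ : logcut k = (fun y => smoothstep (u k y))); last first.
  by apply/funext => y; rewrite logcutE.
rewrite dc du normrM ger0_norm ?derive_smoothstep_ge0// normrN !normrM !normfV.
rewrite (ger0_norm (ltW (q_gt0 x))) !normr_nat.
have hh : (1 + `|x|) * ((q x)^-1 * (2 * `|x ord0 i|)) <= 4.
  rewrite mulrCA ler_pdivrMl//.
  apply: (@le_trans _ _ ((1 + `|x|) * (2 * `|x|))).
    by rewrite !ler_wpM2l ?addr_ge0// coord_le_norm.
  have := norm_sqr_le_sum x; rewrite -(lerD2l 1) -/(q x) => hq.
  apply: (@le_trans _ _ ((1 + `|x| ^+ 2) * 4)); last by rewrite ler_wpM2r.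
  have ar (a : R) : (1 + a) * (2 * a) <= (1 + a ^+ 2) * 4.
    by have := sqr_ge0 (1 - a); nra.
  exact: ar.
set D := 'D_(1 : R) smoothstep (u k x).
rewrite (_ : _ * (D * _) = D / k.+1%:R * ((1 + `|x|) * ((q x)^-1 * (2 * `|x ord0 i|)))); last by ring.
rewrite (_ : 4 * K / _ = K / k.+1%:R * 4); last by ring.
rewrite ler_pM//; first by rewrite divr_ge0// derive_smoothstep_ge0.
  by rewrite !mulr_ge0 ?addr_ge0// invr_ge0 ltW.
by rewrite ler_wpM2r ?invr_ge0//; exact: hK.
Qed.

End logcut.

(** * Tightness and narrow compactness *)

Section rational_boxes.
Context {R : realType} {d : nat}.

(** Open cubes of radius 1 / (k + 1) around the points of the lattice of the same spacing: a
    countable base of the topology, so that every open set is a countable union of boxes. *)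
Definition qbox (c : {ffun 'I_d -> int} * nat) : set 'rV[R]_d :=
  [set x | forall j, `|x ord0 j - (c.1 j)%:~R / c.2.+1%:R| < c.2.+1%:R^-1].

Lemma qbox_cover k (x : 'rV[R]_d) : exists c : {ffun 'I_d -> int}, qbox (c, k) x.
Proof.
exists [ffun j => Num.floor (x ord0 j * k.+1%:R)] => j; rewrite /= ffunE.
set a := x ord0 j.
have k0 : 0 < k.+1%:R :> R by rewrite ltr0n.
have /andP[h1 h2] : (Num.floor (a * k.+1%:R))%:~R <= a * k.+1%:R < (Num.floor (a * k.+1%:R))%:~R + 1.
  by rewrite floor_le_tmp/= -[1]/(1%:~R) -intrD floorD1_gt.
rewrite ger0_norm; last by rewrite subr_ge0 ler_pdivrMr.
by rewrite ltrBlDl -[X in _ < _ + X]div1r -mulrDl ltr_pdivlMr.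
Qed.

Lemma qbox_small c (x y : 'rV[R]_d) : qbox c x -> qbox c y -> `|x - y| <= 2 / c.2.+1%:R.
Proof.
move=> hx hy; apply: norm_le_coord => [|j]; first by rewrite divr_ge0.
have := ler_normB (x ord0 j - (c.1 j)%:~R / c.2.+1%:R) (y ord0 j - (c.1 j)%:~R / c.2.+1%:R).
rewrite opprB addrA subrK !mxE => /le_trans; apply.
by rewrite mulrDl div1r lerD// ltW// ?hx ?hy.
Qed.

Lemma qbox_measurable c : measurable (qbox c : set (borelRn R d)).
Proof.
rewrite (_ : qbox c = \bigcap_(j in [set: 'I_d])
    ((fun x : borelRn R d => x ord0 j - (c.1 j)%:~R / c.2.+1%:R) @^-1`
       `]- c.2.+1%:R^-1, c.2.+1%:R^-1[)); last first.
  apply/seteqP; split=> x /= h; first by move=> j _ /=; rewrite in_itv/= -ltr_norml h.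
  by move=> j; have := h j I; rewrite /= in_itv/= -ltr_norml.
apply: fin_bigcap_measurable => // j _.
rewrite -[X in measurable X]setTI.
apply: (_ : measurable_fun setT (fun x : borelRn R d => x ord0 j - (c.1 j)%:~R / c.2.+1%:R)) => //.
apply: continuous_measurable_rV.
exact: smc_continuous (smcB (smc_coord j) (smc_cst _)).
Qed.

Lemma open_qbox (O : set 'rV[R]_d) : open O ->
  O = \bigcup_(c in [set c | qbox c `<=` O]) qbox c.
Proof.
move=> oO; apply/seteqP; split => [x Ox|x [c /= h]]; last exact: h.
have /nbhs_ballP[e /= e0 he] : nbhs x O by exact: open_nbhs_nbhs.
have [k hk] : exists k : nat, 2 / k.+1%:R < e.
  have e2 : 0 < e / 2 by rewrite divr_gt0.
  have [k kh] := ltr_add_invr e2.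
  exists k; rewrite mulrC -ltr_pdivlMr//.
  by move: kh; rewrite add0r.
have [c hc] := qbox_cover k x; exists (c, k) => //= y hy.
apply: he; rewrite -ball_normE /=; apply: le_lt_trans hk.
exact: (qbox_small hc hy).
Qed.

(** The Borel sets of row vectors are generated by open sets, not by coordinates. Each open set is a
    countable union of rational boxes, and each box is a finite conjunction of conditions on
    coordinates. *)
Lemma measurable_fun_rV dd (X : measurableType dd) (D : set X) (f : X -> borelRn R d) :
  (forall j, measurable_fun D (fun x => f x ord0 j)) -> measurable_fun D f.
Proof.
move=> mf mD.
suff H : preimage_set_system D f (@open 'rV[R]_d) `<=` measurable.
  by apply: (@measurability _ _ _ (borelRn R d) D f (@open 'rV[R]_d) _ H mD).
move=> _ [W oW <-].
rewrite (open_qbox oW) preimage_bigcup setI_bigcupr bigcup_mkcond.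
apply: countable_bigcupT_measurable => // c; case: ifPn => _ //.
rewrite (_ : D `&` f @^-1` qbox c = D `&` \bigcap_(j in [set: 'I_d])
    (D `&` (fun x => f x ord0 j) @^-1`
      [set a : R | `|a - (c.1 j)%:~R / c.2.+1%:R| < c.2.+1%:R^-1])).
  apply: measurableI => //; apply: fin_bigcap_measurable => // j _; apply: mf => //.
  rewrite (_ : [set a : R | _] = ball ((c.1 j)%:~R / c.2.+1%:R : R) (c.2.+1%:R^-1)).
    exact: measurable_ball.
  by rewrite -ball_normE; apply/seteqP; split => t /=; rewrite distrC.
apply/seteqP; split=> x /=; first by move=> [Dx h]; split=> // j _; split => //; exact: h.
by move=> [Dx h]; split => // j; have [] := h j I.
Qed.

Definition tbox (c : (int * {ffun 'I_d -> int}) * nat) : set (R * 'rV[R]_d) :=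
  ball ((c.1.1)%:~R / c.2.+1%:R : R) (c.2.+1%:R^-1) `*` qbox (c.1.2, c.2).

Lemma tbox_measurable c : measurable (tbox c : set (timeR R * borelRn R d)).
Proof. by apply: measurableX; [exact: measurable_ball|exact: qbox_measurable]. Qed.

Lemma open_tbox (W : set (R * 'rV[R]_d)) z : open W -> W z ->
  exists2 c, tbox c z & tbox c `<=` W.
Proof.
move=> oW Wz.
have /nbhs_ballP[e /= e0 he] : nbhs z W by exact: open_nbhs_nbhs.
have [k hk] : exists k : nat, 2 / k.+1%:R < e.
  have e2 : 0 < e / 2 by rewrite divr_gt0.
  have [k kh] := ltr_add_invr e2.
  by exists k; rewrite mulrC -ltr_pdivlMr//; move: kh; rewrite add0r.
have [c hc] := qbox_cover k z.2.
have k0 : 0 < k.+1%:R :> R by rewrite ltr0n.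
have ht : `|z.1 - (Num.floor (z.1 * k.+1%:R))%:~R / k.+1%:R| < k.+1%:R^-1.
  have /andP[h1 h2] := floor_itv (z.1 * k.+1%:R).
  rewrite intrD in h2.
  rewrite ger0_norm; last by rewrite subr_ge0 ler_pdivrMr.
  by rewrite ltrBlDl -[X in _ < _ + X]div1r -mulrDl ltr_pdivlMr.
exists (Num.floor (z.1 * k.+1%:R), c, k).
  by split => //=; rewrite -ball_normE /= distrC.
move=> [s y] /= []; rewrite -ball_normE /= distrC => hs hy; apply: he; split => /=.
  rewrite -ball_normE /=; apply: le_lt_trans hk.
  have := ler_normB (z.1 - (Num.floor (z.1 * k.+1%:R))%:~R / k.+1%:R)
    (s - (Num.floor (z.1 * k.+1%:R))%:~R / k.+1%:R).
  rewrite opprB addrA subrK => /le_trans; apply.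
  by rewrite mulrDl div1r lerD// ltW.
by rewrite -ball_normE /=; apply: le_lt_trans hk; exact: (qbox_small hc hy).
Qed.

(** Reconciles the Borel sets of the product with the product sigma-algebra: by second countability
    an open set is a countable union of measurable rectangles. *)
Lemma open_prod_measurable (W : set (R * 'rV[R]_d)) : open W ->
  measurable (W : set (timeR R * borelRn R d)).
Proof.
move=> oW.
have -> : W = \bigcup_(c in [set c | tbox c `<=` W]) tbox c.
  apply/seteqP; split => [z /(open_tbox oW)[c cz cW]|z [c cW /cW]//].
  by exists c.
rewrite bigcup_mkcond.
apply: countable_bigcupT_measurable => // c; case: ifPn => _ //.
exact: tbox_measurable.
Qed.

End rational_boxes.

(** * Coding points by binary words *)

Section code.
Context {R : realType} {d : nat}.
Implicit Types (x y : 'rV[R]_d) (w : seq bool).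

(* The i-th digit of x tells on which side of the i-th rational coordinate
   hyperplane x lies; words are stored with their last digit first. *)
Definition digit (i : nat) x : bool :=
  if @unpickle ('I_d * int * nat)%type i is Some c
  then x ord0 c.1.1 < c.1.2%:~R / c.2.+1%:R else false.

Fixpoint word (N : nat) x : seq bool :=
  if N is N'.+1 then digit N' x :: word N' x else [::].

Lemma size_word N x : size (word N x) = N.
Proof. by elim: N => //= N ->. Qed.

Definition cell w : set 'rV[R]_d := [set x | word (size w) x = w].

Lemma cell_word N x : cell (word N x) x.
Proof. by rewrite /cell/= size_word. Qed.

Lemma cell_cons b w : cell (b :: w) = cell w `&` [set x | digit (size w) x = b].
Proof. by apply/seteqP; split => x; rewrite /cell/=; [move=> [h1 h2]|move=> [-> ->]]. Qed.

Lemma measurable_dig i b : measurable ([set x | digit i x = b] : set (borelRn R d)).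
Proof.
rewrite /digit; case: unpickle => [[[j z] k]|]; last first.
  rewrite (_ : [set _ | _] = if b then set0 else setT); first by case: b.
  by apply/seteqP; case: b; split.
have h : measurable ([set x | (x ord0 j < z%:~R / k.+1%:R) = true] : set (borelRn R d)).
  apply: open_measurable_rV.
  have o : open [set t : R | t < z%:~R / k.+1%:R] by exact: open_lt.
  by have /continuousP/(_ _ o) := smc_continuous (@smc_coord R d j).
case: b => //=.
rewrite (_ : [set x | _ = false] = ~` [set x : borelRn R d | (x ord0 j < z%:~R / k.+1%:R) = true]).
  exact: measurableC.
by apply/seteqP; split => x /=; [move=> ->|move/negP/negbTE].
Qed.

Lemma measurable_cell w : measurable (cell w : set (borelRn R d)).
Proof.
elim: w => [|b w ih].
  by rewrite (_ : cell [::] = setT)//; apply/seteqP; split.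
rewrite cell_cons; apply: measurableI => //; exact: measurable_dig.
Qed.

Lemma word_dig N i x y : (i < N)%N -> word N x = word N y -> digit i x = digit i y.
Proof.
elim: N => // N ih; rewrite ltnS leq_eqVlt => /predU1P[-> [->//]|iN [_ h]].
exact: ih.
Qed.

Lemma word_le N N' x y : (N <= N')%N -> word N' x = word N' y -> word N x = word N y.
Proof.
elim: N' => [|N' ih]; first by rewrite leqn0 => /eqP ->.
by rewrite leq_eqVlt => /predU1P[-> //|]; rewrite ltnS => NN' [_ h]; exact: ih.
Qed.

(** Past the indices of finitely many hyperplanes of spacing [k.+1%:R^-1], the word of [x] records
    the slab that contains each coordinate. A bound on [x] alone is enough, since these digits force
    [y] into the same slabs. *)
Lemma word_fine (M e : R) : 0 < e -> exists N, forall x y, `|x| <= M ->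
  word N x = word N y -> `|x - y| <= e.
Proof.
move=> e0; have [k kh] := ltr_add_invr e0; rewrite add0r in kh.
have k0 : 0 < k.+1%:R :> R by rewrite ltr0n.
pose B := Num.bound (`|M| * k.+1%:R).
(* Subtracting [B.+1] makes the ordinals below [B.*2.+3] run through the numerators from [- B.+1] to
   [B.+1]; the margin of one is for the upper face [z + 1] of the slab. *)
pose c (j : 'I_d) (a : 'I_(B.*2.+3)) : 'I_d * int * nat := (j, (a : nat)%:Z - B.+1%:Z, k).
pose N := \max_(j < d) \max_(a < B.*2.+3) (pickle (c j a)).+1.
exists N => x y xM wxy.
have digN j (z : int) : - B.+1%:Z <= z <= B.+1%:Z ->
    (x ord0 j < z%:~R / k.+1%:R) = (y ord0 j < z%:~R / k.+1%:R).
  move=> /andP[z1 z2].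
  have aB : (`|(z + B.+1%:Z)%R|%N < B.*2.+3)%N by lia.
  have := @word_dig N (pickle (c j (Ordinal aB))) x y _ wxy.
  rewrite /digit pickleK /= (_ : (`|(z + B.+1%:Z)%R|%N)%:Z - B.+1%:Z = z); last by lia.
  apply; rewrite /N.
  apply: leq_trans (leq_bigmax j).
  exact: (leq_bigmax (Ordinal aB)).
apply: norm_le_coord => [|j]; first exact: ltW.
rewrite !mxE; set a := x ord0 j; set b := y ord0 j.
have aM : `|a * k.+1%:R| < B%:R.
  rewrite normrM normr_nat; apply: le_lt_trans (archi_boundP _) => //.
  by apply: ler_wpM2r => //; rewrite (le_trans (coord_le_norm _ _))// (le_trans xM)// ler_norm.
have /andP[f1 f2] := floor_itv (a * k.+1%:R).
set z := Num.floor _ in f1 f2.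
have z1 : - B%:Z <= z.
  rewrite floor_ge_int mulrNz; move: aM; rewrite ltr_norml => /andP[h _]; exact: ltW.
have z2 : z <= B%:Z.
  rewrite -(@ler_int R) (le_trans f1)//; move: aM; rewrite ltr_norml => /andP[_ h]; exact: ltW.
have d1 := digN j z; have d2 := digN j (z + 1).
have xz : (a < z%:~R / k.+1%:R) = false by apply/negbTE; rewrite -leNgt ler_pdivrMr.
have xz1 : (a < (z + 1)%:~R / k.+1%:R) by rewrite ltr_pdivlMr.
rewrite -/a xz in d1; rewrite -/a xz1 in d2.
have yz : z%:~R / k.+1%:R <= b by rewrite leNgt -d1//; lia.
have yz1 : b < (z + 1)%:~R / k.+1%:R by rewrite -d2//; lia.
apply: le_trans (ltW kh); rewrite ler_distl.
move: xz => /negbT; rewrite -leNgt => xz.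
rewrite intrD mulrDl div1r in yz1 xz1.
have key (r s u v : R) : u <= r -> r < u + v -> u <= s -> s < u + v -> s - v <= r <= s + v.
  by move=> *; apply/andP; split; lra.
exact: key xz xz1 yz yz1.
Qed.

End code.

(** * Realizing word probabilities on the unit interval *)

Section digit_process.
Context {R : realType} dx (X : measurableType dx) (p : seq bool -> X -> R).
Hypotheses (p_ge0 : forall w t, 0 <= p w t) (p_nil : forall t, p [::] t = 1)
  (p_split : forall w t, p w t = p (false :: w) t + p (true :: w) t)
  (p_meas : forall w, measurable_fun setT (p w)).

(** Left end point of the interval of [w]. Inside the interval of [w'] the [false] child comes
    first, so only a [true] digit shifts the end point, by the length of its sibling. *)
Fixpoint lower (w : seq bool) (t : X) : R :=
  if w is b :: w' then lower w' t + (if b then p (false :: w') t else 0) else 0.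

(* For fixed t, [0, 1[ is cut into successive intervals of lengths p w t, one for
   each word w; [dproc N (t, x)] is the word of length N whose interval contains x. *)
Fixpoint dproc (N : nat) (z : X * timeR R) : seq bool :=
  if N is N'.+1 then
    let w := dproc N' z in (lower w z.1 + p (false :: w) z.1 <= z.2) :: w
  else [::].

Lemma size_dproc N z : size (dproc N z) = N.
Proof. by elim: N => //= N ->. Qed.

Lemma lo_ge0 w t : 0 <= lower w t.
Proof. by elim: w => //= b w ih; rewrite addr_ge0//; case: b. Qed.

Lemma lo_le1 w t : lower w t + p w t <= 1.
Proof.
elim: w => [|b w ih] /=; first by rewrite add0r p_nil.
apply: le_trans ih; rewrite [p w t]p_split -addrA lerD2l.
by case: b => //; rewrite add0r lerDl.
Qed.

(** By [p_split] the half-open intervals of the two children tile that of their parent, and the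
    comparison made by [dproc] selects the tile that contains [z.2]. *)
Lemma dprocP w z : 0 <= z.2 < 1 ->
  (dproc (size w) z == w) = (lower w z.1 <= z.2 < lower w z.1 + p w z.1).
Proof.
move=> z01; elim: w => [|b w ih] /=; first by rewrite p_nil add0r z01 eqxx.
rewrite eqseq_cons; have [e|e] := eqVneq (dproc (size w) z) w; last first.
  have ihF : (lower w z.1 <= z.2 < lower w z.1 + p w z.1) = false by rewrite -ih (negbTE e).
  rewrite andbF; apply/esym/negbTE; apply: contraFN ihF.
  rewrite [p w z.1]p_split; case: b => /= /andP[h1 h2]; apply/andP; split.
  - by apply: le_trans h1; rewrite lerDl.
  - by rewrite addrA.
  - by rewrite addr0 in h1.
  - by rewrite addr0 in h2; apply: (lt_le_trans h2); rewrite lerD2l lerDl.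
move: ih; rewrite e eqxx => /esym/andP[h1 h2]; rewrite andbT.
case: b => /=; first by rewrite eqb_id -addrA -p_split h2 andbT.
by rewrite addr0 eqbF_neg -ltNge h1.
Qed.

Lemma measurable_lo w : measurable_fun setT (lower w).
Proof.
elim: w => [|b w ih] /=; first exact: measurable_cst.
by apply: measurable_funD => //; case: b => //; exact: measurable_cst.
Qed.

Lemma measurable_dproc_eq w : measurable [set z | dproc (size w) z = w].
Proof.
elim: w => [|b w ih] /=; first by rewrite (_ : [set _ | _] = setT)//; apply/seteqP; split.
rewrite (_ : [set _ | _] = [set z | dproc (size w) z = w] `&`
    [set z : X * timeR R | (lower w z.1 + p (false :: w) z.1 <= z.2) = b]); last first.
  by apply/seteqP; split => z /=; [move=> [<- h]; rewrite !h|move=> [-> ->]].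
apply: measurableI => //.
have m1 : measurable_fun setT (fun z : X * timeR R => lower w z.1 + p (false :: w) z.1).
  by apply: measurable_funD; apply: measurableT_comp => //; exact: measurable_lo.
have := measurable_fun_ler m1 (@measurable_snd _ _ X (timeR R)).
move=> /(_ measurableT [set b] I); rewrite setTI.
by congr measurable; apply/seteqP; split.
Qed.

Lemma measurable_dproc N (S : set (seq bool)) : measurable [set z | S (dproc N z)].
Proof.
rewrite (_ : [set _ | _] = \bigcup_(w in [set w | size w = N /\ S w]) [set z | dproc (size w) z = w]).
  by rewrite bigcup_mkcond; apply: countable_bigcupT_measurable => // w; case: ifPn => // _;
    exact: measurable_dproc_eq.
apply/seteqP; split => z /=; last by move=> [w [/= sw Sw]]; rewrite sw => ->.
by move=> Sz; exists (dproc N z); rewrite /= ?size_dproc.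
Qed.

Lemma dproc_law w t :
  lebesgue_measure (`[0, 1[%classic `&` [set x | dproc (size w) (t, x) = w]) = (p w t)%:E.
Proof.
rewrite (_ : _ `&` _ = `[lower w t, (lower w t + p w t)[%classic).
  rewrite lebesgue_measure_itv/= lte_fin ltrDl; case: ifPn => [_|].
    by rewrite -EFinB addrAC subrr add0r.
  by rewrite -leNgt => h; congr EFin; apply/eqP; rewrite eq_le h p_ge0.
apply/seteqP; split => x /=; rewrite !in_itv/=.
  by move=> [x01 /eqP]; rewrite (@dprocP w (t, x)).
move=> h; have x01 : 0 <= x < 1.
  move/andP : h => [h1 h2]; rewrite (le_trans (lo_ge0 w t))//= (lt_le_trans h2)//.
  exact: lo_le1.
by split => //; apply/eqP; rewrite (@dprocP w (t, x)).
Qed.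

Variables (d : nat) (rep : seq bool -> 'rV[R]_d).

(* The upper limit only serves to get a total measurable map: where it is used,
   the sequence converges. *)
Definition dpoint (z : X * timeR R) : borelRn R d :=
  \row_j fine (limn_esup (fun N => (rep (dproc N z) ord0 j)%:E)).

Lemma measurable_rep_dproc N (g : seq bool -> R) : measurable_fun setT (fun z => g (dproc N z)).
Proof.
by move=> _ Y mY; rewrite setTI; exact: (measurable_dproc N (g @^-1` Y)).
Qed.

Lemma measurable_dpoint : measurable_fun setT dpoint.
Proof.
apply: measurable_fun_rV => j.
have h : measurable_fun setT (fun z => fine (limn_esup (fun N => (rep (dproc N z) ord0 j)%:E))).
  apply: (measurableT_comp (fine_measurable measurableT)).
  apply: measurable_fun_limn_esup => N; apply/measurable_EFinP.
  exact: (measurable_rep_dproc N (fun w => rep w ord0 j)).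
by apply: (eq_measurable_fun _ _ h) => z _; rewrite mxE.
Qed.

Lemma dpointE z x : rep (dproc N z) @[N --> \oo] --> x -> dpoint z = x.
Proof.
move=> h; apply/rowP => j; rewrite mxE.
have hj : (rep (dproc N z) ord0 j)%:E @[N --> \oo] --> (x ord0 j)%:E.
  apply: cvg_EFin; first by near=> N.
  apply: (@cvg_comp _ _ _ (fun N => rep (dproc N z)) (fun x : 'rV[R]_d => x ord0 j) _ (nbhs x)) => //.
  exact: smc_continuous (smc_coord j) x.
by have [_ ->] := cvg_limn_einf_sup hj.
Unshelve. all: by end_near. Qed.

End digit_process.

Lemma ler_dist3 (R : realType) (a b c d e1 e2 e3 : R) :
  `|a - b| <= e1 -> `|b - c| <= e2 -> `|c - d| <= e3 -> `|a - d| <= e1 + e2 + e3.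
Proof.
move=> h1 h2 h3; rewrite (_ : a - d = a - b + (b - c) + (c - d)); last by ring.
by do 2 (apply: (le_trans (ler_normD _ _)); apply: lerD => //).
Qed.

Section integrable_real.
Context d (X : measurableType d) (R : realType) (mu : {measure set X -> \bar R}).
Variables (D : set X) (mD : measurable D).
Implicit Types f g : X -> R.

Lemma integrable_addr f g : mu.-integrable D (EFin \o f) -> mu.-integrable D (EFin \o g) ->
  mu.-integrable D (EFin \o (fun x => f x + g x)).
Proof.
move=> hf hg; apply: eq_integrable (integrableD mD hf hg) => // x _.
Qed.

Lemma integrable_subr f g : mu.-integrable D (EFin \o f) -> mu.-integrable D (EFin \o g) ->
  mu.-integrable D (EFin \o (fun x => f x - g x)).
Proof.
move=> hf hg; apply: eq_integrable (integrableB mD hf hg) => // x _.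
Qed.

Lemma integrable_scaler (c : R) f : mu.-integrable D (EFin \o f) ->
  mu.-integrable D (EFin \o (fun x => c * f x)).
Proof.
move=> hf; apply: eq_integrable (integrableZl mD c hf) => // x _.
Qed.

End integrable_real.

Section ultrafilter.
Context {R : realType} {I : Type} (F : set_system I) {UF : UltraFilter F}.

(** Compactness gives a cluster point of the image filter. For each of its neighbourhoods the
    ultrafilter contains the preimage or the complement of the preimage, and clustering excludes the
    latter. *)
Lemma ultra_cvg_bounded (u : I -> R) (M : R) : (forall k, `|u k| <= M) -> cvg (u k @[k --> F]).
Proof.
move=> uM.
have cK : compact `[- M, M]%classic by exact: segment_compact.
have PF : ProperFilter (u k @[k --> F]) by exact: fmap_proper_filter.
have FK : (u k @[k --> F]) `[- M, M]%classic.
  by apply: (@filterE _ F) => k /=; rewrite in_itv/= -ler_norml; exact: uM.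
have [l [_ cl]] := cK _ PF FK.
apply/cvg_ex; exists l => V Vl.
have [//|VC] := in_ultra_setVsetC (u @^-1` V) UF.
have [y [/= ]] := cl (~` V) V VC Vl.
by [].
Qed.

Definition ulim (u : I -> R) : R := lim (u k @[k --> F]).

Lemma ulim_cvg (u : I -> R) (M : R) : (forall k, `|u k| <= M) -> u k @[k --> F] --> ulim u.
Proof. by move=> /ultra_cvg_bounded h; exact: h. Qed.

Lemma ulimE (u : I -> R) (l : R) : u k @[k --> F] --> l -> ulim u = l.
Proof. by move=> h; exact: (cvg_lim _ h). Qed.

End ultrafilter.

Section unif01.
Context {R : realType}.

Definition unif01 : set (timeR R) -> \bar R :=
  mrestr (@lebesgue_measure R) (measurable_itv `[(0 : R), 1[).

HB.instance Definition _ := Measure.on unif01.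

Let unif01T : unif01 setT = 1%E.
Proof. by rewrite /unif01 /mrestr setTI lebesgue_measure_itv/= lte01 oppr0 adde0. Qed.

HB.instance Definition _ := Measure_isProbability.Build _ _ _ unif01 unif01T.

Lemma unif01_lty : (unif01 setT < +oo)%E.
Proof. by rewrite unif01T ltry. Qed.

Lemma unif01E (A : set R) : unif01 A = lebesgue_measure (`[0, 1[%classic `&` A).
Proof. by rewrite /unif01 /mrestr setIC. Qed.

End unif01.

Section finite_range.
Context d (X : measurableType d) (R : realType) (P : {measure set X -> \bar R}).
Hypothesis Pfin : (P setT < +oo)%E.
Variables (N : nat) (W : X -> seq bool).
Hypotheses (sW : forall x, size (W x) = N) (mW : forall w, measurable [set x | W x = w]).

Lemma finite_range_Rintegral (g : seq bool -> R) :
  \int[P]_x g (W x) = \sum_(w : N.-tuple bool) g w * fine (P [set x | W x = w]).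
Proof.
have E x : g (W x) = \sum_(w : N.-tuple bool) g w * \1_[set x | W x = w] x.
  have sx : size (W x) == N by rewrite sW.
  rewrite (bigD1 (Tuple sx))//= indicE mem_set//= mulr1 big1 ?addr0// => w wx.
  rewrite indicE memNset ?mulr0//= => h; move/eqP : wx; apply.
  exact: val_inj.
rewrite /Rintegral; under eq_integral do rewrite E -sumEFin.
have ii (w : N.-tuple bool) : P.-integrable setT
    (EFin \o (fun x => g w * \1_[set x | W x = w] x)).
  apply: (@bounded_integrable _ _ _ _ _ _ `|g w|) => //.
    by apply: measurable_funM => //; exact: measurable_indic.
  move=> x _; rewrite normrM indicE; case: (_ \in _); rewrite ?normr1 ?normr0 ?mulr1 ?mulr0//.
rewrite (integral_sum measurableT ii) -sum_fine; last first.
  by move=> w _; exact: (integrable_fin_num measurableT (ii w)).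
apply: eq_bigr => w _.
transitivity (\int[P]_x (g w * \1_[set x | W x = w] x)); first by [].
rewrite RintegralZl//.
  by congr (_ * _); rewrite /Rintegral integral_indic// setIT.
apply: (@bounded_integrable _ _ _ _ _ _ 1) => //.
by move=> x _; rewrite indicE; case: (_ \in _); rewrite ?normr1 ?normr0.
Qed.

End finite_range.

Section uniform_continuity.
Context {R : realType} {d : nat}.

Lemma compact_ball (M : R) : compact (closed_ball_ (fun x => `|x|) (0 : 'rV[R]_d) M).
Proof.
apply: bounded_closed_compact; last exact: closed_closed_ball_.
exists M; split; first exact: num_real.
by move=> K MK x /=; rewrite /closed_ball_/= sub0r normrN => /le_trans; apply; exact: ltW.
Qed.

Lemma unif_cont_on_ball (f : 'rV[R]_d -> R) (M e : R) : continuous f -> 0 < e ->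
  exists2 dl, 0 < dl & forall x y, `|x| <= M -> `|x - y| <= dl -> `|f x - f y| <= e.
Proof.
move=> cf e0.
have nc := (compact_near_coveringP _).1 (@compact_ball M).
have e2 : 0 < e / 2 by rewrite divr_gt0.
have := nc R (0 : R)^'+ (fun dl x => forall y, `|x - y| <= dl -> `|f x - f y| <= e) _.
case.
  move=> x _.
  have /cvgrPdist_le/(_ _ e2) /nbhs_ballP[r /= r0 hr] := cf x.
  exists (ball x (r / 2), [set dl | dl < r / 2]).
    split; first by apply: nbhsx_ballx; rewrite divr_gt0.
    by apply: nbhs_right_lt; rewrite divr_gt0.
  move=> [x' dl] /= [xx' dlr] y x'y.
  have h1 := hr x'; have h2 := hr y.
  have b1 : ball x r x' by apply: le_ball xx'; rewrite ler_pdivrMr// ler_pMr// ler1n.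
  have b2 : ball x r y.
    rewrite [r]splitr; apply: ball_triangle xx' _.
    by rewrite -ball_normE/=; apply: le_lt_trans dlr.
  move: (h1 b1) (h2 b2) => {}h1 {}h2.
  rewrite (_ : f x' - f y = (f x - f y) - (f x - f x')); last by ring.
  by rewrite (le_trans (ler_normB _ _))// [e]splitr lerD.
move=> dl /= dl0 hdl; exists (dl / 2); first by rewrite divr_gt0.
move=> x y xM xy; apply: (hdl (dl / 2)) => //=; rewrite ?divr_gt0//.
  by rewrite sub0r normrN gtr0_norm ?divr_gt0// ltr_pdivrMr// ltr_pMr// ltr1n.
by rewrite /closed_ball_/= sub0r normrN.
Qed.

Lemma word_unif_cont (f : 'rV[R]_d -> R) (M e : R) : continuous f -> 0 < e ->
  exists N, forall N' x y, (N <= N')%N -> `|x| <= M -> word N' x = word N' y -> `|f x - f y| <= e.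
Proof.
move=> cf e0; have [dl dl0 hdl] := unif_cont_on_ball M cf e0.
have [N hN] := @word_fine R d M _ dl0.
by exists N => N' x y NN' xM /(word_le NN') h; apply: hdl => //; exact: hN.
Qed.

End uniform_continuity.

Lemma cvg_sumr (R : realType) (T I : Type) (F : set_system T) (FF : Filter F) (r : seq I)
    (f : I -> T -> R) (l : I -> R) :
  (forall i, f i x @[x --> F] --> l i) ->
  \sum_(i <- r) f i x @[x --> F] --> \sum_(i <- r) l i.
Proof.
move=> h; elim: r => [|i r ih].
  by under eq_cvg do rewrite big_nil; rewrite big_nil; exact: cvg_cst.
under eq_cvg do rewrite big_cons; rewrite big_cons; exact: cvgD.
Qed.

Lemma integral_indic_comp d (X : measurableType d) (R : realType) (P : {measure set X -> \bar R})
    (U : Type) (W : X -> U) (S : set U) : measurable [set x | S (W x)] ->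
  (\int[P]_x (\1_S (W x))%:E)%E = P [set x | S (W x)].
Proof.
move=> mS; by rewrite -[X in _ = P X]setIT -integral_indic.
Qed.

Section bounded_convergence.
Context d (X : measurableType d) (R : realType) (P : {measure set X -> \bar R}).
Hypothesis Pfin : (P setT < +oo)%E.

Lemma bounded_convergence (f : nat -> X -> R) (g : X -> R) (K : R) :
  (forall N, measurable_fun setT (f N)) -> measurable_fun setT g ->
  (forall N x, `|f N x| <= K) -> {ae P, forall x, f N x @[N --> \oo] --> g x} ->
  \int[P]_x f N x @[N --> \oo] --> \int[P]_x g x.
Proof.
move=> mf mg fK fg.
have iK : P.-integrable setT (EFin \o cst K).
  by apply: (@bounded_integrable _ _ _ _ _ _ `|K|).
have [] := @dominated_convergence _ _ _ P setT measurableT (fun N => EFin \o f N) (EFin \o g)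
  (EFin \o cst K) _ _ _ iK _.
- by move=> N; exact/measurable_EFinP.
- exact/measurable_EFinP.
- by apply: filterS fg => x h _; apply: cvg_EFin => //; apply: nearW.
- by apply: aeW => x N _ /=; rewrite lee_fin.
move=> ig _ h.
have iff N : P.-integrable setT (EFin \o f N).
  by apply: (bounded_integrable (M := K)) => // x _; exact: fK.
rewrite /Rintegral; apply: (@fine_cvg _ _ _ _ (fun N => (\int[P]_x (f N x)%:E)%E)).
rewrite fineK; first exact: h.
exact: integrable_fin_num ig.
Qed.

End bounded_convergence.

Section rep_limit.
Context {R : realType} {d : nat} (K : set 'rV[R]_d).

(** The default 0 is taken only on cells that miss [K]. Wherever a digit process is run, such cells
    have weight 0 and are never visited from a point of [0, 1[. *)
Definition cell_rep (w : seq bool) : 'rV[R]_d := xget 0 (cell w `&` K).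

Lemma cell_repP w : cell w `&` K !=set0 -> (cell w `&` K) (cell_rep w).
Proof. by move=> [x hx]; exact: (xgetPex 0 (ex_intro _ x hx)). Qed.

Lemma word_of_cell w (x : 'rV[R]_d) N : (N <= size w)%N -> cell w x ->
  word N x = drop (size w - N) w.
Proof.
elim: w N => [|b w ih] N; first by rewrite leqn0 => /eqP -> _.
rewrite cell_cons => + [cw db]; rewrite leq_eqVlt => /predU1P[->|].
  by rewrite subnn drop0 /= db; congr (_ :: _); exact: cw.
by rewrite /= ltnS => Nw; rewrite subSn//= ih.
Qed.

(** Each word extends the preceding one, so later representatives lie in the earlier cells; once
    they are bounded, [word_fine] makes them a Cauchy sequence. Words grow at the head, which is why
    earlier words are recovered with [drop]. *)
Lemma rep_cvg (W : nat -> seq bool) (M : R) (N0 : nat) :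
  (forall N, size (W N) = N) -> (forall N, exists b, W N.+1 = b :: W N) ->
  (forall N, cell (W N) `&` K !=set0) ->
  (forall N, (N0 <= N)%N -> `|cell_rep (W N)| <= M) ->
  cvg (cell_rep (W N) @[N --> \oo]).
Proof.
move=> sW eW nW bW.
have dW N N' : (N <= N')%N -> drop (N' - N) (W N') = W N.
  elim: N' => [|N' ih]; first by rewrite leqn0 => /eqP ->; rewrite drop0.
  rewrite leq_eqVlt => /predU1P[->|]; first by rewrite subnn drop0.
  by rewrite ltnS => NN'; have [b ->] := eW N'; rewrite subSn//= ih.
apply: cauchy_cvg; apply/cauchyP => e e0.
have e2 : 0 < e / 2 by rewrite divr_gt0.
have [N1 hN1] := @word_fine R d M _ e2.
pose N := maxn N0 N1; exists (cell_rep (W N)).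
exists N => // N' /= NN'.
rewrite -ball_normE/=; apply: (@le_lt_trans _ _ (e / 2)); last first.
  by rewrite ltr_pdivrMr// ltr_pMr// ltr1n.
apply: hN1; first by apply: bW; exact: leq_maxl.
have [c1 _] := cell_repP (nW N); have [c2 _] := cell_repP (nW N').
rewrite (word_of_cell _ c1) ?sW ?leq_maxr// (word_of_cell _ c2) ?sW; last first.
  by rewrite (leq_trans _ NN')// leq_maxr.
by rewrite !dW// ?leq_maxr// (leq_trans _ NN')// leq_maxr.
Qed.

End rep_limit.

Lemma measurable_word (R : realType) d N (S : set (seq bool)) :
  measurable ([set x | S (word N x)] : set (borelRn R d)).
Proof.
rewrite (_ : [set _ | _] = \bigcup_(w in [set w | size w = N /\ S w]) cell w).
  by rewrite bigcup_mkcond; apply: countable_bigcupT_measurable => // w; case: ifPn => // _;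
    exact: measurable_cell.
apply/seteqP; split => z /=; last by move=> [w [/= sw Sw]]; rewrite /cell/= sw => ->.
by move=> Sz; exists (word N z); rewrite /= ?size_word// /cell /= size_word.
Qed.

Lemma measurable_word_fun (R : realType) d N (g : seq bool -> R) :
  measurable_fun setT (fun x : borelRn R d => g (word N x)).
Proof. by move=> _ Y mY; rewrite setTI; exact: (measurable_word N (g @^-1` Y)). Qed.

Lemma measurable_norm_gt (R : realType) d (M : R) :
  measurable ([set x : 'rV[R]_d | (M < `|x|)%R] : set (borelRn R d)).
Proof.
apply: open_measurable_rV.
have o : open [set t : R | M < t] by exact: open_gt.
by have /continuousP/(_ _ o) := @norm_continuous R 'rV[R]_d.
Qed.

(** * Narrow limits along an ultrafilter *)

Section prokhorov.
Context {R : realType} {n : nat} (P : nat -> probability (borelRn R n) R).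
Variables (F : set_system nat) (UF : UltraFilter F).
Hypothesis tight : forall e : R, 0 < e ->
  exists M : R, forall k, (P k [set x : 'rV[R]_n | (M < `|x|)%R] <= e%:E)%E.

Let pk (k : nat) (w : seq bool) : R := fine (P k (cell w)).

Let pk_ge0 k w : 0 <= pk k w. Proof. by rewrite fine_ge0. Qed.

Let pk_le1 k w : `|pk k w| <= 1.
Proof.
rewrite ger0_norm// -lee_fin fineK ?probability_le1//; first exact: measurable_cell.
by apply: fin_num_measure; exact: measurable_cell.
Qed.

(** [unit] is the trivial parameter space for the digit process; for controls its place is taken by
    time. *)
Let p (w : seq bool) (_ : unit) : R := ulim F (pk^~ w).

Let p_cvg w t : pk k w @[k --> F] --> p w t.
Proof. exact: (@ulim_cvg _ _ F UF (pk^~ w) 1 (fun k => pk_le1 k w)). Qed.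

Let p_ge0 w t : 0 <= p w t.
Proof. by apply: limr_ge; [apply/cvg_ex; exists (p w t); exact: p_cvg|exact: filterE]. Qed.

Let p_nil t : p [::] t = 1.
Proof.
apply: ulimE; rewrite (_ : (fun k => _) = cst 1); first exact: cvg_cst.
apply/funext => k; rewrite /pk (_ : cell [::] = setT) ?probability_setT//.
by apply/seteqP; split.
Qed.

Let p_split w t : p w t = p (false :: w) t + p (true :: w) t.
Proof.
apply: ulimE; rewrite (_ : (fun k => _) = (fun k => pk k (false :: w) + pk k (true :: w))).
  by apply: cvgD; exact: p_cvg.
apply/funext => k; rewrite /pk -fineD; last 2 first.
  by apply: fin_num_measure; exact: measurable_cell.
  by apply: fin_num_measure; exact: measurable_cell.
rewrite -measureU; last 3 first.
- exact: measurable_cell.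
- exact: measurable_cell.
- by rewrite !cell_cons; apply/seteqP; split => // x /= [[_ ->] [_]].
congr (fine (P k _)); rewrite !cell_cons -setIUr; apply/esym/setIidl => x _ /=.
by case: digit; [right|left].
Qed.

Let p_meas w : measurable_fun setT (p w).
Proof. exact: measurable_cst. Qed.

Let D N (x : timeR R) := dproc p N (tt, x).

Let mD w : measurable [set x | D (size w) x = w].
Proof.
have := measurable_xsection tt (measurable_dproc_eq p_meas w).
by congr measurable; apply/seteqP; split => x; rewrite /xsection/= inE.
Qed.

Let mD' N w : measurable [set x | D N x = w].
Proof.
have [<-|Nw] := eqVneq (size w) N; first exact: mD.
rewrite (_ : [set _ | _] = set0)//; apply/seteqP; split => // x /= h.
by move/eqP : Nw; apply; rewrite -h size_dproc.
Qed.

Let mword N w : measurable ([set x | word N x = w] : set (borelRn R n)).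
Proof.
have [<-|Nw] := eqVneq (size w) N; first exact: measurable_cell.
rewrite (_ : [set _ | _] = set0)//; apply/seteqP; split => // x /= h.
by move/eqP : Nw; apply; rewrite -h size_word.
Qed.

(** A function of the first [N] digits has finitely many values, so both sides are finite sums over
    words; [dproc_law] identifies the weights on the right as the limits of those on the left. *)
Lemma cylinder_cvg (g : seq bool -> R) N :
  \int[P k]_x g (word N x) @[k --> F] --> \int[unif01]_x g (D N x).
Proof.
have Pk k : (P k setT < +oo)%E by rewrite probability_setT ltry.
have U1 : (@unif01 R setT < +oo)%E by rewrite probability_setT ltry.
rewrite (finite_range_Rintegral U1 (fun x => size_dproc p N (tt, x)) (mD' N)).
under eq_cvg do rewrite (finite_range_Rintegral (Pk _) (size_word N) (mword N)).
apply: cvg_sumr => w; apply: cvgM; first exact: cvg_cst.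
have sw : size w = N by rewrite size_tuple.
have E : p w tt = fine (unif01 [set x | D N x = w]).
  have := dproc_law p_ge0 p_nil p_split w tt.
  by rewrite sw -unif01E => ->.
by have := @p_cvg w tt; rewrite E /pk /cell sw.
Qed.

Let rep := cell_rep (@setT 'rV[R]_n).

Let D_nonempty N x : 0 <= x < 1 -> cell (D N x) `&` [set: 'rV[R]_n] !=set0.
Proof.
move=> x01; rewrite setIT; apply/set0P/eqP => h.
have := @dprocP _ _ _ p p_ge0 p_nil p_split (D N x) (tt, x) x01.
rewrite {1}/D size_dproc eqxx => /esym/andP[/= h1 h2].
have : p (D N x) tt = 0.
  by apply: ulimE; rewrite /pk h; under eq_cvg do rewrite measure0; exact: cvg_cst.
by move=> p0; move: (le_lt_trans h1 h2); rewrite p0 addr0 ltxx.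
Qed.

Let D_step x N : exists b, D N.+1 x = b :: D N x.
Proof. by rewrite /D /=; eexists. Qed.

Let D_drop x N N' : (N <= N')%N -> drop (N' - N) (D N' x) = D N x.
Proof.
elim: N' => [|N' ih]; first by rewrite leqn0 => /eqP ->; rewrite drop0.
rewrite leq_eqVlt => /predU1P[->|]; first by rewrite subnn drop0.
by rewrite ltnS => NN'; have [b ->] := D_step x N'; rewrite subSn//= ih.
Qed.

Let rep_cell N x : 0 <= x < 1 -> cell (D N x) (rep (D N x)).
Proof. by move=> /(D_nonempty N)/cell_repP[]. Qed.

Let measurable_D N (S : set (seq bool)) : measurable [set x | S (D N x)].
Proof.
have := measurable_xsection tt (measurable_dproc p_meas N S).
by congr measurable; apply/seteqP; split => x; rewrite /xsection/= inE.
Qed.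

(** Convergence can fail only if the representatives are unbounded. For each [j] tightness bounds
    the probability of this by [j.+1%:R^-1], and the intersection over [j] is null. *)
Let D_cvg_ae : {ae unif01, forall x, cvg (rep (D N x) @[N --> \oo])}.
Proof.
have H (j : nat) : exists S : set (timeR R), [/\ measurable S, (unif01 S <= (j.+1%:R^-1)%:E)%E &
    forall x, 0 <= x < 1 -> ~ S x -> cvg (rep (D N x) @[N --> \oo])].
  have [M hM] := @tight j.+1%:R^-1 (eqbRL (invr_gt0 _) (ltr0Sn _ _)).
  have [N hN] := @word_fine R n M _ (@ltr01 R).
  (* Words whose cell meets the ball of radius [M]. At depth [N] two points of such a cell, one of
     them in the ball, are at distance at most 1, whence the bound [M + 1] for all later
     representatives. *)
  pose G := [set w | exists2 y : 'rV[R]_n, cell w y & `|y| <= M].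
  exists [set x | (~` G) (D N x)]; split; first exact: measurable_D.
    have := @cylinder_cvg (\1_(~` G)) N; set I := Rintegral _ _ _ => cI.
    have -> : unif01 [set x | (~` G) (D N x)] = I%:E.
      rewrite /I /Rintegral fineK; last first.
        apply: (integrable_fin_num measurableT).
        apply: (@bounded_integrable _ _ _ _ _ _ 1) => //.
        - exact: unif01_lty.
        - by move=> _ Y mY; rewrite setTI; exact: (measurable_D N (\1_(~` G) @^-1` Y)).
        - by move=> x _; rewrite indicE; case: (_ \in _); rewrite ?normr1 ?normr0.
      by rewrite integral_indic_comp//; exact: measurable_D.
    rewrite lee_fin -(ulimE cI); apply: limr_le; first by apply/cvg_ex; exists I.
    apply: filterE => k; rewrite -lee_fin /Rintegral fineK; last first.
      apply: (integrable_fin_num measurableT).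
      apply: (@bounded_integrable _ _ _ _ _ _ 1) => //.
      - by rewrite (le_lt_trans (probability_le1 _ _))// ltry.
      - exact: measurable_word_fun.
      - by move=> x _; rewrite indicE; case: (_ \in _); rewrite ?normr1 ?normr0.
    rewrite (_ : (\int[P k]_x _)%E = P k [set x | (~` G) (word N x)]); last first.
      by apply: integral_indic_comp; exact: (measurable_word N (~` G)).
    apply: le_trans (hM k); apply: le_measure; rewrite ?inE.
    - exact: (measurable_word N (~` G)).
    - exact: measurable_norm_gt.
    - move=> x /= Gx; rewrite ltNge; apply/negP => xM; apply: Gx.
      by exists x => //; exact: cell_word.
  move=> x x01 /= /contrapT[y cy yM].
  apply: (@rep_cvg _ _ setT (fun N => D N x) (M + 1) N).
  - by move=> N'; rewrite size_dproc.
  - exact: D_step.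
  - by move=> N'; exact: D_nonempty.
  - move=> N' NN'.
    have := hN y (rep (D N' x)) yM; have c2 := rep_cell N' x01.
    have s1 := size_dproc p N (tt, x); have s2 := size_dproc p N' (tt, x).
    rewrite (word_of_cell _ cy) ?s1// (word_of_cell _ c2) ?s2//.
    rewrite -/(D N x) -/(D N' x) subnn drop0 D_drop// => /(_ erefl) h.
    rewrite (_ : cell_rep _ _ = y - (y - rep (D N' x))); last by rewrite opprB addrC subrK.
    by rewrite (le_trans (ler_normB _ _))// lerD.
pose S j := sval (cid (H j)).
have HS j := svalP (cid (H j)).
exists (\bigcap_j (S j) `|` ~` `[0, 1[%classic); split.
- apply: measurableU; last exact: measurableC.
  by apply: bigcapT_measurable => j; have [] := HS j.
- apply/eqP; rewrite eq_le measure_ge0 andbT.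
  apply/lee_addgt0Pr => e e0; rewrite add0e.
  have [j hj] := ltr_add_invr e0; rewrite add0r in hj.
  have [mS uS _] := HS j.
  apply: (@le_trans _ _ (unif01 (S j `|` ~` `[0, 1[%classic))).
    apply: le_measure; rewrite ?inE.
    + apply: measurableU; last exact: measurableC.
      by apply: bigcapT_measurable => i; have [] := HS i.
    + by apply: measurableU => //; exact: measurableC.
    + by move=> x [h|h]; [left; exact: h|right].
  rewrite unif01E setIUr setICr setU0 -unif01E.
  by apply: (le_trans uS); rewrite lee_fin ltW.
- move=> x /= hx; have [x01|x01] := pselect (0 <= x < 1); last first.
    by right => /=; rewrite in_itv.
  left => j _; apply: contrapT => nS; apply: hx.
  by have [_ _] := HS j; apply.
Qed.

Let Y (x : timeR R) : borelRn R n := dpoint p rep (tt, x).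

Let mY : measurable_fun setT Y.
Proof.
apply: (measurableT_comp (measurable_dpoint p_meas rep)).
by apply: measurable_fun_pair; [exact: measurable_cst|exact: measurable_id].
Qed.

Let Y_cvg : {ae unif01, forall x, rep (D N x) @[N --> \oo] --> (Y x : 'rV[R]_n)}.
Proof.
apply: filterS D_cvg_ae => x /cvg_ex[l hl].
by rewrite /Y (dpointE hl).
Qed.

(* The limit measure is the image of the uniform measure on [0, 1[ under the map
   that sends x to the point whose cells have the limit probabilities. *)
Lemma prokhorov_ultra : exists P0 : probability (borelRn R n) R,
  forall (f : 'rV[R]_n -> R) (K : R), continuous f -> (forall x, `|f x| <= K) ->
  \int[P k]_x f x @[k --> F] --> \int[P0]_x f x.
Proof.
pose Y' : {mfun timeR R >-> borelRn R n} := HB.pack Y (isMeasurableFun.Build _ _ _ _ Y mY).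
exists (distribution unif01 Y') => f K cf fK.
have mf := continuous_measurable_rV cf.
have U1 : (@unif01 R setT < +oo)%E by rewrite probability_setT ltry.
have -> : \int[distribution unif01 Y']_x f x = \int[unif01]_x f (Y x).
  rewrite /Rintegral integral_pushforward//.
  - exact/measurable_EFinP.
  - apply: (@bounded_integrable _ _ _ _ _ _ K) => //.
    + by rewrite preimage_setT.
    + by rewrite preimage_setT; exact: measurableT_comp.
have dct : \int[unif01]_x f (rep (D N x)) @[N --> \oo] --> \int[unif01]_x f (Y x).
  apply: (bounded_convergence U1 (K := K)) => //.
  - by move=> N _ Z mZ; rewrite setTI; exact: (measurable_D N ((f \o rep) @^-1` Z)).
  - exact: measurableT_comp.
  - by apply: filterS Y_cvg => x h; exact: (@cvg_comp _ _ _ (fun N => rep (D N x)) f _ (nbhs (Y x : 'rV[R]_n)) _ h (cf _)).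
have K0 : 0 <= K by apply: le_trans (fK 0); exact: normr_ge0.
apply/cvgrPdist_le => e e0.
have e4 : 0 < e / 4 by rewrite divr_gt0.
(* Outside the ball of radius [M] the two integrands differ by at most [2 * K]; the mass allowed
   there makes this contribution at most [e / 4], and the added 1 keeps the denominator positive. *)
have [M hM] := @tight (e / 4 / (2 * K + 1)) (divr_gt0 e4 (ltr_wpDl (mulr_ge0 (ler0n _ 2) K0) ltr01)).
have [N1 hN1] := @word_unif_cont R n f M _ cf e4.
have [N2 _ hN2] := (cvgrPdist_le _ _).1 dct _ e4.
pose N := maxn N1 N2.
have hN := hN2 N (leq_maxr _ _); rewrite /= in hN.
have /cvgrPdist_le/(_ _ e4) := @cylinder_cvg (f \o rep) N.
apply: filterS => k hk /=.
have mh := @measurable_word_fun R n N (f \o rep).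
have mMg : measurable ([set x | (M < `|x|)%R] : set (borelRn R n)) by exact: measurable_norm_gt.
have hd x : `|f x - f (rep (word N x))| <= e / 4 + 2 * K * \1_[set x : 'rV[R]_n | (M < `|x|)%R] x.
  rewrite indicE; case: (ltP M `|x|) => xM.
    rewrite mem_set// mulr1 (le_trans (ler_normB _ _))// ler_wpDl ?(ltW e4)//.
    by rewrite mulr_natl mulr2n lerD.
  rewrite memNset; last by move=> /=; rewrite ltNge xM.
  rewrite mulr0 addr0; apply: (hN1 N) => //; first exact: leq_maxl.
  have [c _] : (cell (word N x) `&` setT) (rep (word N x)).
    by apply: cell_repP; exists x; split => //; exact: cell_word.
  by move: c; rewrite /cell/= size_word.
have Pk : (P k setT < +oo)%E by rewrite probability_setT ltry.
have if1 : (P k).-integrable setT (EFin \o f) by apply: (bounded_integrable (M := K)).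
have if2 : (P k).-integrable setT (EFin \o (fun x => f (rep (word N x)))).
  by apply: (bounded_integrable (M := K)).
have ii : (P k).-integrable setT (EFin \o (fun x : borelRn R n => \1_[set x : 'rV[R]_n | (M < `|x|)%R] x)).
  apply: (bounded_integrable (M := 1)) => //; first exact: measurable_indic.
  by move=> x _; rewrite indicE; case: (_ \in _); rewrite ?normr1 ?normr0.
have step : `|\int[P k]_x f x - \int[P k]_x f (rep (word N x))| <= e / 2.
  rewrite -RintegralB//.
  apply: (le_trans (le_normr_Rintegral _ _)) => //; first exact: integrable_subr.
  apply: (@le_trans _ _ (\int[P k]_x (e / 4 + 2 * K * \1_[set x : 'rV[R]_n | (M < `|x|)%R] x))).
    apply: le_Rintegral => //.
    - by apply: integrable_norm; exact: integrable_subr.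
    - by apply: integrable_addr => //; [exact: prob_integrable_cst|exact: integrable_scaler].
  rewrite RintegralD//; last 2 first.
    exact: prob_integrable_cst.
    exact: integrable_scaler.
  rewrite Rintegral_prob_cst RintegralZl//.
  have -> : \int[P k]_x \1_[set x : 'rV[R]_n | (M < `|x|)%R] x = fine (P k [set x : 'rV[R]_n | (M < `|x|)%R]).
    by rewrite /Rintegral integral_indic// setIT.
  have h1 : fine (P k [set x : 'rV[R]_n | (M < `|x|)%R]) <= e / 4 / (2 * K + 1).
    by rewrite -lee_fin fineK ?hM// fin_num_measure.
  have h2 : 2 * K * fine (P k [set x : 'rV[R]_n | (M < `|x|)%R]) <= e / 4.
    apply: (le_trans (ler_wpM2l _ h1)); first by rewrite mulr_ge0.
    rewrite mulrCA ger_pMr// ler_pdivrMr ?mul1r ?lerDl//.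
    by rewrite ltr_wpDl// mulr_ge0.
  lra.
rewrite distrC in step.
apply: (le_trans (ler_dist3 hN hk step)).
by rewrite (_ : e / 4 + e / 4 + e / 2 = e)//; field.
Qed.

End prokhorov.

(** * Limits of trajectories *)

Section partition_of_unity.
Context {R : realType}.

(** A bump whose integer translates telescope to 1: the one-dimensional factor of a smooth partition
    of unity. *)
Definition hat (x : R) : R := smoothstep (x + 1) - smoothstep x.

Lemma smc_hat : smc hat.
Proof.
apply: smcB; last exact: smc_smoothstep.
by apply: (smc_comp smc_smoothstep); apply: smcD; [exact: smc_id|exact: smc_cst].
Qed.

Lemma hat_ge0 x : 0 <= hat x.
Proof. by rewrite subr_ge0 smoothstep_nd// lerDl. Qed.

Lemma hat_supp x : hat x != 0 -> `|x| <= 1.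
Proof.
apply: contraNT; rewrite -ltNge ltr_normr => /orP[x1|x1]; apply/eqP; rewrite /hat.
  by rewrite !smoothstep_eq1 ?subrr ?ltW// ltr_wpDr.
rewrite !smoothstep_eq0 ?subrr//; last by rewrite -lerBrDr sub0r lerNr ltW.
by rewrite -oppr_ge0 ltW// (lt_trans _ x1).
Qed.

Lemma sum_hat (B : nat) (y : R) :
  \sum_(i < B.*2) hat (y - (i%:R - B%:R)) = smoothstep (y + B%:R + 1) - smoothstep (y - B%:R + 1).
Proof.
have E (m : nat) : \sum_(i < m) hat (y - (i%:R - B%:R)) =
    smoothstep (y + B%:R + 1) - smoothstep (y + B%:R + 1 - m%:R).
  elim: m => [|m ih]; first by rewrite big_ord0 subr0 subrr.
  rewrite big_ord_recr/= ih /hat.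
  have -> : y - (m%:R - B%:R) + 1 = y + B%:R + 1 - m%:R by ring.
  have -> : y - (m%:R - B%:R) = y + B%:R + 1 - m.+1%:R by rewrite -[m.+1]addn1 natrD; ring.
  by ring.
rewrite E; congr (_ - smoothstep _).
by rewrite -addnn natrD; ring.
Qed.

End partition_of_unity.

Section density.
Context {R : realType} {n : nat}.

(** The approximant weighs the values of [f] at grid points by a product partition of unity. At [x]
    only grid points within the modulus of uniform continuity carry weight; the grid is finite, so
    the sum remains smooth and compactly supported. *)
Lemma smc_dense (f : 'rV[R]_n -> R) (M e : R) : continuous f ->
  (forall x, f x != 0 -> `|x| <= M) -> 0 < e ->
  exists (h : 'rV[R]_n -> R) (M' : R), [/\ smc h, forall x, h x != 0 -> `|x| <= M' &
    forall x, `|f x - h x| <= e].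
Proof.
move=> cf fM e0.
have [dl dl0 hdl] := unif_cont_on_ball (M + 1) cf e0.
have uc x y : `|x - y| <= Num.min dl 1 -> `|f x - f y| <= e.
  rewrite le_min => /andP[xyd xy1].
  have [xM|xM] := leP `|x| (M + 1); first exact: hdl.
  have fx : f x = 0.
    apply/eqP; apply: contraTT xM => /fM xM; rewrite -leNgt (le_trans xM)// lerDl//.
  have fy : f y = 0.
    apply/eqP; apply: contraTT xM => /fM yM; rewrite -leNgt.
    rewrite (_ : x = y + (x - y)); last by rewrite addrC subrK.
    by rewrite (le_trans (ler_normD _ _))// lerD.
  by rewrite fx fy subr0 normr0 ltW.
have m0 : 0 < Num.min dl 1 by rewrite lt_min dl0 ltr01.
have [k kh] := ltr_add_invr m0; rewrite add0r in kh.
have k0 : 0 < k.+1%:R :> R by rewrite ltr0n.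
(* Large enough for the weights to add up to 1 on the ball of radius [M], outside which [f]
   vanishes; elsewhere it suffices that their sum is at most 1. *)
pose B := (Num.bound (`|M| * k.+1%:R)).+1.
have BM : `|M| * k.+1%:R <= B%:R - 1.
  by rewrite /B -(natr1 (Num.bound _)) addrK ltW// archi_boundP// mulr_ge0.
pose pt (phi : {ffun 'I_n -> 'I_B.*2}) : 'rV[R]_n := \row_j (((phi j : nat)%:R - B%:R) / k.+1%:R).
pose w (phi : {ffun 'I_n -> 'I_B.*2}) (x : 'rV[R]_n) : R :=
  \prod_(j < n) hat (k.+1%:R * x ord0 j - ((phi j : nat)%:R - B%:R)).
have w0 phi x : 0 <= w phi x by apply: prodr_ge0 => j _; exact: hat_ge0.
have wsupp phi x : w phi x != 0 -> `|x - pt phi| <= k.+1%:R^-1.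
  move=> wx; apply: norm_le_coord => [|j]; first by rewrite invr_ge0.
  have /hat_supp : hat (k.+1%:R * x ord0 j - ((phi j : nat)%:R - B%:R)) != 0.
    by apply: contra_neq wx => h; rewrite /w (bigD1 j)//= h mul0r.
  rewrite !mxE => h.
  rewrite (_ : _ - _ = (k.+1%:R * x ord0 j - ((phi j : nat)%:R - B%:R)) / k.+1%:R); last first.
    by field; rewrite gt_eqF.
  by rewrite normrM normfV normr_nat ler_piMl// invr_ge0.
have wsum x : \sum_phi w phi x =
    \prod_(j < n) (smoothstep (k.+1%:R * x ord0 j + B%:R + 1) - smoothstep (k.+1%:R * x ord0 j - B%:R + 1)).
  under [RHS]eq_bigr do rewrite -sum_hat.
  by rewrite bigA_distr_bigA.
have wsum1 x : \sum_phi w phi x <= 1.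
  rewrite wsum; apply: prodr_ile1 => j _.
  rewrite subr_ge0 smoothstep_nd ?lerD2r ?lerD2l//=; last first.
    by rewrite (@le_trans _ _ 0)// oppr_le0.
  by rewrite lerBlDr (le_trans (smoothstep_le1 _))// lerDl smoothstep_ge0.
have wsumM x : `|x| <= M -> \sum_phi w phi x = 1.
  move=> xM; rewrite wsum big1// => j _.
  have : `|k.+1%:R * x ord0 j| <= B%:R - 1.
    apply: le_trans BM; rewrite normrM normr_nat mulrC ler_wpM2r//.
    by rewrite (le_trans (coord_le_norm _ _))// (le_trans xM)// ler_norm.
  rewrite ler_norml => /andP[h1 h2].
  rewrite smoothstep_eq1; last by clear -h1; lra.
  by rewrite smoothstep_eq0 ?subr0//; clear -h2; lra.
exists (fun x => \sum_phi f (pt phi) * w phi x), (B%:R + B%:R + 1); split.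
- apply: smc_sum => phi; apply: smcZ; apply: smc_prod => j.
  by apply: (smc_comp smc_hat); apply: smcB; [apply: smcZ; exact: smc_coord|exact: smc_cst].
- move=> x; apply: contraNT; rewrite -ltNge => xB.
  apply/eqP; apply: big1 => phi _.
  have [->|wx] := eqVneq (w phi x) 0; first by rewrite mulr0.
  have h := wsupp _ _ wx; exfalso.
  move: xB; rewrite ltNge => /negP; apply.
  rewrite (_ : x = pt phi + (x - pt phi)); last by rewrite addrC subrK.
  apply: (le_trans (ler_normD _ _)); apply: lerD; last first.
    by apply: (le_trans h); rewrite invf_le1// ler1n.
  apply: norm_le_coord => [|j]; first by rewrite addr_ge0.
  rewrite mxE normrM normfV normr_nat ler_pdivrMr//.
  apply: (@le_trans _ _ (B%:R + B%:R)).
    have : ((phi j : nat)%:R : R) <= B%:R + B%:R by rewrite -natrD ler_nat addnn ltnW.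
    have : 0 <= ((phi j : nat)%:R : R) by [].
    have : 0 <= (B%:R : R) by [].
    by rewrite ler_norml => *; apply/andP; split; lra.
  by rewrite ler_peMr// ?addr_ge0// -[1]/(1%:R) ler_nat.
- move=> x.
  have fS : f x = f x * \sum_phi w phi x.
    have [->|/fM xM] := eqVneq (f x) 0; first by rewrite mul0r.
    by rewrite wsumM// mulr1.
  rewrite {1}fS mulr_sumr -sumrB.
  apply: (le_trans (ler_norm_sum _ _ _)).
  apply: (@le_trans _ _ (\sum_phi e * w phi x)); last first.
    by rewrite -mulr_sumr ler_piMr// ltW.
  apply: ler_sum => phi _; rewrite -mulrBl normrM (ger0_norm (w0 _ _)).
  have [->|wx] := eqVneq (w phi x) 0; first by rewrite !mulr0.
  rewrite ler_wpM2r//; apply: uc.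
  by apply: (le_trans (wsupp _ _ wx)); exact: ltW.
Qed.

End density.

Section continuous_pointwise.
Context {R : realType} {X : topologicalType}.
Implicit Types f g : X -> R.

Lemma continuousM_fun f g : continuous f -> continuous g -> continuous (fun x => f x * g x).
Proof. by move=> cf cg x; apply: continuousM; [exact: cf|exact: cg]. Qed.

Lemma continuousD_fun f g : continuous f -> continuous g -> continuous (fun x => f x + g x).
Proof. by move=> cf cg x; apply: (@continuousD _ R^o _ f g); [exact: cf|exact: cg]. Qed.

Lemma continuousB_fun f g : continuous f -> continuous g -> continuous (fun x => f x - g x).
Proof. by move=> cf cg x; apply: (@continuousB _ R^o _ f g); [exact: cf|exact: cg]. Qed.

Lemma continuous_max_fun f g : continuous f -> continuous g ->
  continuous (fun x => Num.max (f x) (g x)).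
Proof. by move=> cf cg x; apply: continuous_max; [exact: cf|exact: cg]. Qed.

Lemma continuous_min_fun f g : continuous f -> continuous g ->
  continuous (fun x => Num.min (f x) (g x)).
Proof. by move=> cf cg x; apply: continuous_min; [exact: cf|exact: cg]. Qed.

Lemma continuous_norm_fun f : continuous f -> continuous (fun x => `|f x|).
Proof. by move=> cf x; apply: (continuous_comp (cf x)); exact: (@norm_continuous _ R^o). Qed.

Lemma continuous_sum_fun (I : Type) (r : seq I) (f : I -> X -> R) :
  (forall i, continuous (f i)) -> continuous (fun x => \sum_(i <- r) f i x).
Proof.
move=> cf; elim: r => [|i r ih].
  by under eq_fun do rewrite big_nil; exact: cst_continuous.
by under eq_fun do rewrite big_cons; apply: continuousD_fun.
Qed.

End continuous_pointwise.

Lemma derive_near0 {R : realType} {V : normedModType R} (f : V -> R) (z e : V) :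
  (\forall w \near z, f w = 0) -> 'D_e f z = 0.
Proof.
move=> f0; rewrite /derive; apply: cvg_lim => //.
apply: (@cvg_trans _ ((fun=> 0 : R) @ 0^')); last exact: cvg_cst.
apply: near_eq_cvg.
have : \forall h \near 0^', f (h *: e + z) = 0.
  apply: cvg_within.
  have cg : continuous (fun h : R => h *: e + z).
    by move=> h; apply: cvgD; [exact: scalel_continuous|exact: cvg_cst].
  have := cg 0; rewrite /= => /(_ [set w | f w = 0]).
  by rewrite scale0r add0r; apply.
apply: filterS => h fh.
by move: fh => /= fh; rewrite /= fh (nbhs_singleton f0) subrr scaler0.
Qed.

Lemma growth_bound {R : realType} {n : nat} (c : R) (h : 'rV[R]_n -> R) (M : R) : smc h ->
  (forall x, h x != 0 -> `|x| <= M) ->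
  exists N, forall x, c * ((1 + `|x|) * \sum_(i < n) `|grad h x ord0 i|) <= N.
Proof.
move=> sh hM; pose g x := c * ((1 + `|x|) * \sum_(i < n) `|grad h x ord0 i|).
have cg : continuous g.
  apply: continuousM_fun; first by exact: cst_continuous.
  apply: continuousM_fun.
    by apply: continuousD_fun; [exact: cst_continuous|exact: norm_continuous].
  apply: continuous_sum_fun => i; apply: continuous_norm_fun.
  rewrite (_ : (fun x => _) = 'D_(delta_mx ord0 i) h); last by apply/funext => x; rewrite mxE.
  by apply: smc_continuous; exact: smc_derive.
have [N [_ hN]] := compact_bounded (continuous_compact (continuous_subspaceT cg) (@compact_ball R n M)).
exists (Num.max 0 (N + 1)) => x.
have [xM|xM] := leP `|x| M.
  rewrite le_max; apply/orP; right; apply: (le_trans (ler_norm _)).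
  apply: (hN (N + 1)); rewrite ?ltrDl//; exists x => //.
  by rewrite /closed_ball_/= sub0r normrN.
rewrite le_max; apply/orP; left; rewrite big1 ?mulr0// => i _.
rewrite mxE derive_near0 ?normr0//.
have oM : open [set y : 'rV[R]_n | M < `|y|].
  by rewrite (_ : [set _ | _] = (fun y : 'rV[R]_n => `|y|) @^-1` [set r : R | M < r])//; apply: open_comp; [move=> y _; exact: norm_continuous|exact: open_gt].
have : nbhs x [set y : 'rV[R]_n | M < `|y|] by exact: open_nbhs_nbhs.
by apply: filterS => y /= yM; apply/eqP; apply: contraTT yM => /hM; rewrite -leNgt.
Qed.

(** Bounding [e1 * e1] by [e1] leaves at most [e1 * (4 * K + 5)], which is below twice
    [e1 * (2 * K + 3)]. *)
Lemma equicont_arith {R : realType} (K e1 e : R) : 0 <= K -> 0 <= e1 -> e1 <= 1 ->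
  e1 * (2 * K + 3) <= e / 2 ->
  e1 + (K + K + e1) * e1 + e1 + (e1 + (K + K + e1) * e1) <= e.
Proof. by move=> K0 e10 e11 h; have : e1 * e1 <= e1 * 1 by [exact: ler_wpM2l]; lra. Qed.

Section probability_integrals.
Context {R : realType} {d : measure_display} {X : measurableType d} (P : probability X R).

Lemma prob_lty : (P setT < +oo)%E.
Proof. exact: (le_lt_trans (probability_le1 _ _) (ltry _)). Qed.

Lemma prob_indic_integrable (E : set X) : measurable E ->
  P.-integrable setT (EFin \o (\1_E : X -> R)).
Proof.
move=> mE; apply: (bounded_integrable (M := 1)) => //.
- exact: (le_lt_trans (probability_le1 _ _) (ltry _)).
- by move=> x _; rewrite indicE; case: (_ \in _); rewrite ?normr1 ?normr0.
Qed.

Lemma prob_indicE (E : set X) : measurable E -> P E = (\int[P]_x (\1_E : X -> R) x)%:E.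
Proof.
move=> mE; rewrite /Rintegral integral_indic// setIT fineK// fin_num_measure//.
Qed.

Lemma Rintegral_dist_le (E : set X) (f g : X -> R) (e c d0 : R) : measurable E ->
  P.-integrable setT (EFin \o f) -> P.-integrable setT (EFin \o g) -> 0 <= c ->
  (P E <= d0%:E)%E -> (forall x, `|f x - g x| <= e + c * \1_E x) ->
  `|\int[P]_x f x - \int[P]_x g x| <= e + c * d0.
Proof.
move=> mE iF ig c0 PE fg.
have iE := prob_indic_integrable mE.
have ie : P.-integrable setT (EFin \o (fun x => e + c * \1_E x)).
  by apply: integrable_addr => //; [exact: prob_integrable_cst|exact: integrable_scaler].
have h : \int[P]_x (e + c * \1_E x) <= e + c * d0.
  rewrite RintegralD//; [|exact: prob_integrable_cst|exact: integrable_scaler].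
  rewrite Rintegral_prob_cst RintegralZl// lerD2l ler_wpM2l//.
  by rewrite -lee_fin -prob_indicE.
rewrite -RintegralB//; apply: le_trans h.
apply: (le_trans (le_normr_Rintegral _ _)) => //; first exact: integrable_subr.
by apply: le_Rintegral => //; exact/integrable_norm/integrable_subr.
Qed.

End probability_integrals.

Lemma lipschitz1_continuous {R : realType} {V : normedModType R} (f : V -> R) :
  (forall x y, f x <= f y + `|x - y|) -> continuous f.
Proof.
move=> fl x; apply/cvgrPdist_le => e e0; near=> y.
have xy : `|x - y| <= e by near: y; exact: cvgr_dist_le.
rewrite ler_distl; apply/andP; split.
  by rewrite lerBlDr (le_trans (fl y x))// lerD2l distrC.
by rewrite (le_trans (fl x y))// lerD2l.
Unshelve. all: by end_near. Qed.

Lemma cvg_le {R : realType} {I : Type} (F : set_system I) (u : I -> R) (l c : R) :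
  ProperFilter F -> u k @[k --> F] --> l -> (forall k, u k <= c) -> l <= c.
Proof. by move=> FF ul uc; exact: (@closed_cvg _ _ F FF u _ (@closed_le _ c) (nearW _ uc) l ul). Qed.

Lemma cvg_ge {R : realType} {I : Type} (F : set_system I) (u : I -> R) (l c : R) :
  ProperFilter F -> u k @[k --> F] --> l -> (forall k, c <= u k) -> c <= l.
Proof. by move=> FF ul uc; exact: (@closed_cvg _ _ F FF u _ (@closed_ge _ c) (nearW _ uc) l ul). Qed.

(** * Closed sets and bounded continuous functions *)

Section distance_to_set.
Context {R : realType} {n : nat}.
Implicit Types (A : set 'rV[R]_n) (x y : 'rV[R]_n).

(** For empty [A] the infimum is 0 by convention, as if every point belonged to [A]; hence the
    assumption [A !=set0] below and the separate case in the final theorem. *)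
Definition setdist A x : R := inf [set `|x - a| | a in A].

Lemma setdist_ge0 A x : 0 <= setdist A x.
Proof.
have [->|/set0P A0] := eqVneq A set0; first by rewrite /setdist image_set0 inf0.
by apply: lb_le_inf; [case: A0 => a Aa; exists `|x - a|, a|move=> _ [b _ <-]].
Qed.

Lemma setdist_le A x a : A a -> setdist A x <= `|x - a|.
Proof.
move=> Aa; apply: ge_inf; last by exists a.
by exists 0 => _ [b _ <-].
Qed.

Lemma setdist_in A x : A x -> setdist A x = 0.
Proof.
move=> Ax; apply/eqP; rewrite eq_le setdist_ge0 andbT.
by apply: (le_trans (setdist_le x Ax)); rewrite subrr normr0.
Qed.

Lemma setdist_gt0 A x : closed A -> A !=set0 -> ~ A x -> 0 < setdist A x.
Proof.
move=> cA A0 Ax.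
have : nbhs x (~` A) by apply: open_nbhs_nbhs; split => //; exact: closed_openC.
move=> /nbhs_ballP[e /= e0 he].
apply: (lt_le_trans e0); apply: lb_le_inf.
  by case: A0 => a Aa; exists `|x - a|, a.
move=> _ [b Ab <-]; rewrite leNgt; apply/negP => xb.
by apply: (he b) => //; rewrite -ball_normE.
Qed.

Lemma setdist_lipschitz A x y : setdist A x <= setdist A y + `|x - y|.
Proof.
have [->|/set0P A0] := eqVneq A set0.
  by rewrite /setdist !image_set0 !inf0 add0r.
rewrite -lerBlDr; apply: lb_le_inf; first by case: A0 => a Aa; exists `|y - a|, a.
move=> _ [b Ab <-]; rewrite lerBlDr addrC.
apply: (le_trans (setdist_le x Ab)).
by rewrite (_ : x - b = (x - y) + (y - b)) ?ler_normD// addrA subrK.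
Qed.

Lemma setdist_continuous A : continuous (setdist A).
Proof. exact: lipschitz1_continuous (setdist_lipschitz A). Qed.

Definition near_set A (j : nat) x : R := Num.max 0 (1 - j%:R * setdist A x).

Lemma near_set_continuous A j : continuous (near_set A j).
Proof.
apply: continuous_max_fun; first exact: cst_continuous.
apply: continuousB_fun; first exact: cst_continuous.
by apply: continuousM_fun; [exact: cst_continuous|exact: setdist_continuous].
Qed.

Lemma near_set_ge0 A j x : 0 <= near_set A j x.
Proof. by rewrite le_max lexx. Qed.

Lemma near_set_le1 A j x : near_set A j x <= 1.
Proof. by rewrite ge_max ler01 gerBl mulr_ge0// setdist_ge0. Qed.

Lemma near_set_norm A j x : `|near_set A j x| <= 1.
Proof. by rewrite ger0_norm ?near_set_ge0 ?near_set_le1. Qed.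

Lemma indic_le_near_set A j x : \1_A x <= near_set A j x.
Proof.
rewrite indicE; have [Ax|Ax] := pselect (A x).
  by rewrite mem_set// /near_set setdist_in// mulr0 subr0 le_max lexx orbT.
by rewrite memNset// near_set_ge0.
Qed.

Lemma near_set_cvg A x : closed A -> A !=set0 ->
  near_set A j x @[j --> \oo] --> (\1_A x : R).
Proof.
move=> cA A0; rewrite indicE; have [Ax|Ax] := pselect (A x).
  rewrite mem_set//; apply: cvg_near_cst; near=> j.
  by rewrite /near_set setdist_in// mulr0 subr0 max_r.
rewrite memNset//; apply: cvg_near_cst; near=> j.
have d0 := setdist_gt0 cA A0 Ax.
rewrite /near_set max_l// subr_le0 -ler_pdivrMr// mul1r.
by near: j; exact: nbhs_infty_ger.
Unshelve. all: by end_near. Qed.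

Lemma near_set_integral_cvg (P : probability (borelRn R n) R) A : closed A -> A !=set0 ->
  \int[P]_x near_set A j x @[j --> \oo] --> fine (P A).
Proof.
move=> cA A0.
have mA : measurable (A : set (borelRn R n)) by exact: closed_measurable_rV.
rewrite prob_indicE//=.
apply: (bounded_convergence (prob_lty P) (K := 1)).
- by move=> N; apply: continuous_measurable_rV; exact: near_set_continuous.
- exact: measurable_indic.
- by move=> N x; exact: near_set_norm.
- by apply: aeW => x; exact: near_set_cvg.
Qed.

(** The functions [near_set] determine the mass of closed sets, hence of open ones, and open sets
    are a pi-system that generates the Borel sets. *)
Lemma eq_probability (P Q : probability (borelRn R n) R) :
  (forall f : 'rV[R]_n -> R, continuous f -> (forall x, 0 <= f x) -> (forall x, f x <= 1) ->
    \int[P]_x f x = \int[Q]_x f x) ->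
  forall E : set (borelRn R n), measurable E -> P E = Q E.
Proof.
move=> PQ.
have PQc A : closed A -> P A = Q A.
  move=> cA; have [->|/set0P A0] := eqVneq A set0; first by rewrite !measure0.
  have h1 := @near_set_integral_cvg P A cA A0.
  have h2 := @near_set_integral_cvg Q A cA A0.
  rewrite -[P A]fineK ?fin_num_measure//; last exact: closed_measurable_rV.
  rewrite -[Q A]fineK ?fin_num_measure//; last exact: closed_measurable_rV.
  congr EFin; apply: cvg_unique h1 _ => //.
  have E j : \int[P]_x near_set A j x = \int[Q]_x near_set A j x.
    by apply: PQ; [exact: near_set_continuous|exact: near_set_ge0|exact: near_set_le1].
  by rewrite /= (eq_fun E).
have PQo (W : set (borelRn R n)) : @open 'rV[R]_n W -> P W = Q W.
  move=> oW.
  have mW : measurable (~` W) by apply: measurableC; exact: open_measurable_rV.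
  have h := PQc _ (open_closedC oW).
  by rewrite -[W]setCK (probability_setC P mW) (probability_setC Q mW) h.
move=> E mE.
apply: (@measure_unique _ R (borelRn R n) (@open 'rV[R]_n) (fun=> setT) _ _ _ _ P Q) => //.
- by move=> A B oA oB; exact: openI.
- by move=> _; exact: openT.
- by rewrite bigcup_const.
- by move=> _; exact: prob_lty.
Qed.

(** At fixed [j] the function [near_set A j] dominates the indicator of [A], and the limit along [F]
    is taken first; only then does [j] tend to infinity. A sequence [u] of lower bounds accommodates
    a maximizing sequence. *)
Lemma portmanteau_closed (F : set_system nat) (P : nat -> probability (borelRn R n) R)
    (P0 : probability (borelRn R n) R) A (s : R) (u : nat -> R) : ProperFilter F ->
  (forall (f : 'rV[R]_n -> R) (K : R), continuous f -> (forall x, `|f x| <= K) ->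
    \int[P k]_x f x @[k --> F] --> \int[P0]_x f x) ->
  closed A -> A !=set0 -> (forall k, u k <= fine (P k A)) -> u k @[k --> F] --> s ->
  s <= fine (P0 A).
Proof.
move=> FF cP cA A0 uP us.
have mA : measurable (A : set (borelRn R n)) by exact: closed_measurable_rV.
have h := @near_set_integral_cvg P0 A cA A0.
apply: cvg_ge h _ => j.
have c1 := cP _ _ (@near_set_continuous A j) (near_set_norm A j).
apply: (ler_cvg_to us c1); apply: nearW => k; apply: (le_trans (uP k)).
rewrite -lee_fin fineK ?fin_num_measure// prob_indicE// lee_fin.
apply: le_Rintegral => //; first exact: prob_indic_integrable.
  exact: probability_bounded_integrable (@near_set_continuous A j) (near_set_norm A j).
by move=> x _; exact: indic_le_near_set.
Qed.

End distance_to_set.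

Lemma eq_measure_Rintegral {R : realType} {n : nat} (P Q : probability (borelRn R n) R) (f : 'rV[R]_n -> R) :
  (forall E : set (borelRn R n), measurable E -> P E = Q E) -> \int[P]_x f x = \int[Q]_x f x.
Proof. by move=> PQ; congr fine; apply: eq_measure_integral => E mE _; exact: PQ. Qed.

(** * Compactness of equi-Lipschitz curves of measures *)

Section curve_compactness.
Context {R : realType} {n : nat}.
Variables (T c : R) (theta : probability (borelRn R n) R).
Variable mu : nat -> R -> probability (borelRn R n) R.
Hypotheses (T0 : 0 < T) (c0 : 0 < c).
Hypothesis mu_init : forall k (E : set (borelRn R n)), measurable E -> mu k 0 E = theta E.
Hypothesis mu_lip : forall (f : 'rV[R]_n -> R) (M N : R), smc f ->
  (forall x, f x != 0 -> `|x| <= M) ->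
  (forall x, c * ((1 + `|x|) * \sum_(i < n) `|grad f x ord0 i|) <= N) ->
  forall k s t, s \in `[0, T] -> t \in `[0, T] ->
  `|\int[mu k t]_x f x - \int[mu k s]_x f x| <= N * `|t - s|.

(** All curves start at [theta], for which the integral of [logcut j] is close to 1. By [mu_lip] and
    [grad_logcut_le] it drops over [[0, T]] by at most a constant times [T / j.+1%:R], uniformly in
    [k]. Mass outside the support of the cut-off is at most 1 minus this integral. *)
Lemma curve_tight (e : R) : 0 < e ->
  exists M : R, forall k t, t \in `[0, T] -> (mu k t [set x : 'rV[R]_n | (M < `|x|)%R] <= e%:E)%E.
Proof.
move=> e0; have [K K0 hK] := @derive_smoothstep_bounded R.
have cth : \int[theta]_x logcut k x @[k --> \oo] --> \int[theta]_x (1 : R).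
  apply: (bounded_convergence (prob_lty theta) (K := 1)).
  - by move=> N; apply: continuous_measurable_rV; exact/smc_continuous/smc_logcut.
  - exact: measurable_cst.
  - by move=> N x; rewrite ger0_norm ?logcut_ge0 ?logcut_le1.
  - by apply: aeW => x; exact: logcut_cvg1.
rewrite Rintegral_prob_cst in cth.
have e2 : 0 < e / 2 by rewrite divr_gt0.
have [j1 _ hj1] := (cvgrPdist_le _ _).1 cth _ e2.
pose A := c * (4 * n%:R * K) * T.
have [j2 hj2] : exists j2 : nat, A / j2.+1%:R <= e / 2.
  have A1 : 0 < e / 2 / (`|A| + 1) by rewrite divr_gt0// ltr_wpDl.
  have [j2 hj] := ltr_add_invr A1; exists j2; rewrite add0r in hj.
  apply: (@le_trans _ _ ((`|A| + 1) * j2.+1%:R^-1)).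
    by rewrite ler_wpM2r ?invr_ge0// (le_trans (ler_norm _))// lerDl.
  by rewrite mulrC -ler_pdivlMr ?ltr_wpDl// ltW.
pose j := maxn j1 j2.
have Aj : A / j.+1%:R <= e / 2.
  apply: le_trans hj2; rewrite ler_wpM2l//.
    by rewrite /A !mulr_ge0 ?(ltW c0) ?(ltW T0).
  by rewrite lef_pV2 ?posrE// ler_nat ltnS leq_maxr.
have [M hM] := @logcut_supp R n j.
exists M => k t tT.
have sl := @smc_logcut R n j.
have cl : continuous (@logcut R n j) by exact: smc_continuous.
have l1 x : `|@logcut R n j x| <= 1 by rewrite ger0_norm ?logcut_ge0 ?logcut_le1.
have h0 : 1 - e / 2 <= \int[mu k 0]_x logcut j x.
  rewrite (eq_measure_Rintegral _ (mu_init k)).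
  have := hj1 j (leq_maxl _ _); rewrite /= ler_norml => /andP[_ h]; lra.
have h1 : 1 - e <= \int[mu k t]_x logcut j x.
  have gr x : c * ((1 + `|x|) * \sum_(i < n) `|grad (@logcut R n j) x ord0 i|) <= c * (4 * n%:R * K / j.+1%:R).
    by rewrite ler_wpM2l ?(ltW c0)//; exact: grad_logcut_le.
  have z0 : 0 \in `[0, T] by rewrite in_itv/= lexx ltW.
  have := mu_lip sl hM gr k z0 tT.
  have tT' : `|t - 0| <= T by move: tT; rewrite in_itv/= subr0 => /andP[t0 tT]; rewrite ger0_norm.
  have : c * (4 * n%:R * K / j.+1%:R) * `|t - 0| <= e / 2.
    apply: le_trans Aj; rewrite /A.
    apply: (@le_trans _ _ (c * (4 * n%:R * K / j.+1%:R) * T)).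
      by apply: ler_wpM2l => //; rewrite !mulr_ge0 ?(ltW c0) ?invr_ge0.
    by rewrite le_eqVlt; apply/orP; left; apply/eqP; ring.
  rewrite ler_distl => h2 /andP[h3 _]; apply: le_trans h3.
  by apply: le_trans (lerB h0 h2); rewrite -addrA -opprD -splitr.
have mM := @measurable_norm_gt R n M.
rewrite prob_indicE// lee_fin.
apply: (@le_trans _ _ (\int[mu k t]_x (1 - logcut j x))).
  apply: le_Rintegral => //.
  - exact: prob_indic_integrable.
  - apply: integrable_subr => //; first exact: prob_integrable_cst.
    exact: probability_bounded_integrable l1.
  - move=> x _; rewrite indicE; have [xM|xM] := ltP M `|x|.
      rewrite mem_set//= (_ : logcut j x = 0) ?subr0//.
      by apply/eqP; apply: contraTT xM => /hM; rewrite -leNgt.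
    rewrite memNset/= ?subr_ge0 ?logcut_le1//.
    by rewrite ltNge xM.
rewrite RintegralB//; last 2 first.
  exact: prob_integrable_cst.
  exact: probability_bounded_integrable l1.
rewrite Rintegral_prob_cst lerBlDr addrC -lerBlDr; exact: h1.
Qed.

Definition ballcut (M : R) (x : 'rV[R]_n) : R := Num.max 0 (Num.min 1 (M + 1 - `|x|)).

Lemma ballcut_continuous M : continuous (ballcut M).
Proof.
apply: continuous_max_fun; first by exact: cst_continuous.
apply: continuous_min_fun; first by exact: cst_continuous.
apply: continuousB_fun; first by exact: cst_continuous.
exact: norm_continuous.
Qed.

Lemma ballcut_ge0 M x : 0 <= ballcut M x.
Proof. by rewrite le_max lexx. Qed.

Lemma ballcut_le1 M x : ballcut M x <= 1.
Proof. by rewrite ge_max ler01 ge_min lexx. Qed.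

Lemma ballcut_eq1 M x : `|x| <= M -> ballcut M x = 1.
Proof.
move=> xM; rewrite /ballcut min_l ?max_r//.
by rewrite addrAC lerDr subr_ge0.
Qed.

Lemma ballcut_supp M x : ballcut M x != 0 -> `|x| <= M + 1.
Proof.
apply: contraNT; rewrite -ltNge => xM; apply/eqP; rewrite /ballcut max_l//.
by rewrite ge_min subr_le0 (ltW xM) orbT.
Qed.

(* On smooth compactly supported f this is [mu_lip]; the general case follows by
   cutting f off outside a large ball (tightness) and approximating it uniformly. *)
Lemma curve_equicontinuous (f : 'rV[R]_n -> R) (K e : R) : continuous f -> (forall x, `|f x| <= K) -> 0 < e ->
  exists2 d, 0 < d & forall k s t, s \in `[0, T] -> t \in `[0, T] -> `|t - s| <= d ->
    `|\int[mu k t]_x f x - \int[mu k s]_x f x| <= e.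
Proof.
move=> cf fK e0.
have K0 : 0 <= K by apply: le_trans (fK 0); exact: normr_ge0.
pose e1 := Num.min 1 (e / 2 / (2 * K + 3)).
have K3 : 0 < 2 * K + 3 by rewrite ltr_wpDl// mulr_ge0.
have e10 : 0 < e1 by rewrite lt_min ltr01 divr_gt0// divr_gt0.
have [M hM] := curve_tight e10.
pose fg x := f x * ballcut M x.
have cfg : continuous fg by apply: continuousM_fun => //; exact: ballcut_continuous.
have fgs x : fg x != 0 -> `|x| <= M + 1.
  by rewrite mulf_eq0 negb_or => /andP[_ /ballcut_supp].
have [h [M' [sh hs fh]]] := smc_dense cfg fgs e10.
have hK x : `|h x| <= K + e1.
  rewrite (_ : h x = fg x - (fg x - h x)); last by rewrite opprB addrC subrK.
  rewrite (le_trans (ler_normB _ _))// lerD// normrM -[K]mulr1 ler_pM//.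
  by rewrite ger0_norm ?ballcut_ge0 ?ballcut_le1.
have [N hN] : exists N, forall x, c * ((1 + `|x|) * \sum_(i < n) `|grad h x ord0 i|) <= N.
  exact: growth_bound sh hs.
exists (e1 / (`|N| + 1)); first by rewrite divr_gt0// ltr_wpDl.
move=> k s t sT tT ts.
have L := mu_lip sh hs hN k sT tT.
have Le : N * `|t - s| <= e1.
  apply: (@le_trans _ _ ((`|N| + 1) * `|t - s|)).
    by rewrite ler_wpM2r// (le_trans (ler_norm _))// lerDl.
  by rewrite mulrC -ler_pdivlMr// ltr_wpDl.
have D r : r \in `[0, T] -> `|\int[mu k r]_x f x - \int[mu k r]_x h x| <= e1 + (K + K + e1) * e1.
  move=> rT.
  have fhb x : `|f x - h x| <= e1 + (K + K + e1) * \1_[set x : 'rV[R]_n | (M < `|x|)%R] x.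
    rewrite indicE; have [xM|xM] := ltP M `|x|.
      rewrite mem_set//= mulr1 (le_trans (ler_normB _ _))//.
      by apply: le_trans (lerD (fK x) (hK x)) _; rewrite addrA lerDr ltW.
    rewrite memNset/= ?mulr0 ?addr0; last by rewrite ltNge xM.
    by rewrite (_ : f x = fg x)// /fg ballcut_eq1// mulr1.
  have ih : (mu k r).-integrable setT (EFin \o h).
    by apply: probability_bounded_integrable hK; exact: smc_continuous.
  have iF : (mu k r).-integrable setT (EFin \o f) by exact: probability_bounded_integrable fK.
  apply: (Rintegral_dist_le _ iF ih _ (hM k r rT) fhb) => //.
    exact: measurable_norm_gt.
  by rewrite !addr_ge0// ltW.
have D1 := D t tT; have D2 := D s sT; rewrite distrC in D2.
have := ler_dist3 D1 (le_trans L Le) D2 => /le_trans; apply.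
apply: equicont_arith => //; first exact: ltW.
  by rewrite /e1 ge_min lexx.
by rewrite -ler_pdivlMr// /e1 ge_min lexx orbT.
Qed.

(** The ultrafilter yields a limit at every time separately, with no passage through a countable
    dense set of times. The modulus of [curve_equicontinuous] does not depend on [k] and survives
    the limit. Outside [[0, T]] the value [theta] is a filler. *)
Lemma curve_compactness (F : set_system nat) : UltraFilter F ->
  exists mu0 : R -> probability (borelRn R n) R,
  [/\ forall t (f : 'rV[R]_n -> R) (K : R), t \in `[0, T] -> continuous f ->
        (forall x, `|f x| <= K) -> \int[mu k t]_x f x @[k --> F] --> \int[mu0 t]_x f x,
      narrowly_continuous T mu0 &
      forall E : set (borelRn R n), measurable E -> mu0 0 E = theta E].
Proof.
move=> UF.
have : forall t, exists P0 : probability (borelRn R n) R, t \in `[0, T] ->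
    forall (f : 'rV[R]_n -> R) (K : R), continuous f ->
    (forall x, `|f x| <= K) -> \int[mu k t]_x f x @[k --> F] --> \int[P0]_x f x.
  move=> t; have [tT|tT] := boolP (t \in `[0, T]); last by exists theta.
  have [|P0 hP] := @prokhorov_ultra R n (fun k => mu k t) F UF.
    by move=> e /curve_tight[M hM]; exists M => k; exact: hM.
  by exists P0 => _ f K; exact: hP.
move=> /choice[mu0 hmu].
exists mu0; split => [t f K tT|f cf [K fK]|].
- exact: hmu.
- apply/within_segmentP => t tT e e0.
  have [d d0 hd] := curve_equicontinuous cf fK e0.
  exists d => // s sT st.
  have cd : `|\int[mu k s]_x f x - \int[mu k t]_x f x| @[k --> F] -->
      `|\int[mu0 s]_x f x - \int[mu0 t]_x f x|.
    by apply: cvg_norm; apply: cvgB; [exact: (hmu s sT f K)|exact: (hmu t tT f K)].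
  by apply: cvg_le cd _ => k; apply: hd => //; rewrite ltW.
- apply: eq_probability => f cf f0 f1.
  have fK x : `|f x| <= 1 by rewrite ger0_norm.
  have z0 : 0 \in `[0, T] by rewrite in_itv/= lexx ltW.
  have cm := hmu 0 z0 f 1 cf fK.
  apply: (cvg_unique _ cm) => //.
  rewrite (eq_fun (fun k => eq_measure_Rintegral f (mu_init k))).
  exact: cvg_cst.
Qed.

End curve_compactness.

(** * Limits of generalized controls *)

Lemma open_setX {X Y : topologicalType} (A : set X) (B : set Y) :
  open A -> open B -> open (A `*` B).
Proof.
move=> oA oB; rewrite (_ : A `*` B = fst @^-1` A `&` snd @^-1` B)//.
by apply: openI; apply: open_comp => // z _; [exact: cvg_fst|exact: cvg_snd].
Qed.

Section segment_measure.
Context {R : realType} (T : R).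

Definition segm : set (timeR R) -> \bar R :=
  mrestr (@lebesgue_measure R) (measurable_itv `[0%R, T]).

HB.instance Definition _ := Measure.on segm.

Let segm_fin : fin_num_fun segm.
Proof.
move=> B mB; rewrite /segm /mrestr ge0_fin_numE//.
apply: (le_lt_trans _ (lebesgue_segment_lty 0 T)).
by apply: le_measure; rewrite ?inE//=; exact: measurableI.
Qed.

HB.instance Definition _ := @Measure_isFinite.Build _ _ _ segm segm_fin.

Lemma segmE (B : set R) : segm B = lebesgue_measure (B `&` `[0, T]%classic).
Proof. by []. Qed.

Lemma segm_lty : (segm setT < +oo)%E.
Proof. by rewrite ltey_eq segm_fin. Qed.

Lemma segm_ae (P : R -> Prop) : (forall t, t \in `[0, T] -> P t) -> {ae segm, forall t, P t}.
Proof.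
move=> hP; exists (~` `[0, T]%classic); split; first exact: measurableC.
  by rewrite segmE setICl measure0.
by move=> t /= nP tT; apply: nP; exact: hP.
Qed.

Lemma segm_integral (f : timeR R -> \bar R) : measurable_fun setT f ->
  (\int[segm]_t f t = \int[lebesgue_measure]_(t in `[0%R, T]) f t)%E.
Proof.
move=> mf; transitivity (\int[segm]_(t in `[0%R, T]) f t)%E; last first.
  apply: eq_measure_integral => A mA AT.
  by rewrite [LHS]segmE setIidl.
rewrite [RHS]integral_mkcond; apply: ae_eq_integral => //.
  by apply/(measurable_restrictT _ _).1 => //; exact: measurable_funTS.
apply: segm_ae => t tT _.
by rewrite patchT// inE.
Qed.

End segment_measure.

(** * Controls carried by a measurable map *)

Section control_of_map.
Context {R : realType} {m : nat} (T : R) (X : timeR R * timeR R -> borelRn R m).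
Hypothesis mX : measurable_fun setT X.

Let mXt t : measurable_fun setT (fun x => X (t, x)).
Proof. by apply: measurableT_comp mX _; exact: measurable_pair1. Qed.

(* [map_law t] is the law of X (t, x) for x uniform in [0, 1[, and [map_control]
   the generalized control that has these laws as its disintegration. *)
Definition map_law (t : timeR R) : {measure set (borelRn R m) -> \bar R} :=
  measure_function_pushforward__canonical__measure_function_Measure (@unif01 R) (mXt t).

Let measurable_map_law (A : set (borelRn R m)) : measurable A ->
  measurable_fun setT (map_law ^~ A).
Proof.
move=> mA.
have mXA : measurable (X @^-1` A) by rewrite -[_ @^-1` _]setTI; exact: mX.
have := measurable_fun_xsection (@unif01 R) mXA.
apply: eq_measurable_fun => t _ /=.
by rewrite /xsection /pushforward; congr (unif01 _); apply/seteqP; split => x /=; rewrite inE.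
Qed.

HB.instance Definition _ := isKernel.Build _ _ _ _ R map_law measurable_map_law.

Let map_law_prob t : map_law t setT = 1%E.
Proof. by rewrite /= /pushforward preimage_setT probability_setT. Qed.

HB.instance Definition _ := Kernel_isProbability.Build _ _ _ _ R map_law map_law_prob.

Definition map_kernel : R.-pker (timeR R) ~> (borelRn R m) := map_law.

Definition map_graph (z : timeR R * timeR R) : timeR R * borelRn R m := (z.1, X z).

Lemma measurable_map_graph : measurable_fun setT map_graph.
Proof. by apply: measurable_fun_pair. Qed.

Let mg := measurable_map_graph.

Definition map_control : {measure set (timeR R * borelRn R m) -> \bar R} :=
  measure_function_pushforward__canonical__measure_function_Measure
    (segm T \x @unif01 R)%E mg.

Let G (f : timeR R * borelRn R m -> \bar R) (t : timeR R) : \bar R :=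
  (\int[map_kernel t]_w f (t, w))%E.

Let GE f t : measurable_fun setT f -> (forall z, 0 <= f z)%E ->
  G f t = fubini_F (@unif01 R) (f \o map_graph) t.
Proof.
move=> mf f0; rewrite /G /fubini_F /=.
have mft : measurable_fun setT (fun w => f (t, w)).
  by apply: measurableT_comp mf _; exact: measurable_pair1.
by rewrite (ge0_integral_pushforward (mXt t))// preimage_setT.
Qed.

Let measurable_G f : measurable_fun setT f -> (forall z, 0 <= f z)%E ->
  measurable_fun setT (G f).
Proof.
move=> mf f0; rewrite (_ : G f = fubini_F (@unif01 R) (f \o map_graph)); last first.
  by apply/funext => t; exact: GE.
by apply: measurable_fun_fubini_tonelli_F => //; [exact: measurableT_comp|move=> z; exact: f0].
Qed.

Lemma map_control_ge0_integral (f : timeR R * borelRn R m -> \bar R) :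
  measurable_fun setT f -> (forall z, 0 <= f z)%E ->
  (\int[map_control]_z f z =
   \int[lebesgue_measure]_(t in `[0%R, T]) \int[map_kernel t]_w f (t, w))%E.
Proof.
move=> mf f0; rewrite -(segm_integral T (measurable_G mf f0)).
rewrite ge0_integral_pushforward//.
have mfg : measurable_fun setT (f \o map_graph) by exact: measurableT_comp.
rewrite preimage_setT.
have /= -> := @fubini_tonelli1 _ _ _ _ R (segm T) (@unif01 R) (f \o map_graph) mfg (fun z => f0 _).
by apply: eq_integral => t _; rewrite -GE.
Qed.

Lemma map_control_disintegration : disintegration T map_control map_kernel.
Proof.
move=> f fi; have mf : measurable_fun setT f by exact: measurable_int fi.
have mp := measurable_funepos mf; have mn := measurable_funeneg mf.
have ip := integrable_funepos measurableT fi.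
have ineg := integrable_funeneg measurableT fi.
(* Each of the two parts has a finite iterated integral, so their difference may be recombined into
   one integral over [[0, T]]. *)
have iG g : measurable_fun setT g -> (forall z, 0 <= g z)%E ->
    map_control.-integrable setT g -> lebesgue_measure.-integrable `[0%R, T] (G g).
  move=> mg0 g0 /integrableP[_ gi]; apply/integrableP; split.
    by apply: measurable_funTS; exact: measurable_G.
  under eq_integral do rewrite gee0_abs ?integral_ge0//.
  rewrite -map_control_ge0_integral//.
  by under eq_integral do rewrite -[g _]gee0_abs//.
rewrite integralE !map_control_ge0_integral//.
rewrite -integralB//; [|exact: iG|exact: iG].
by apply: eq_integral => t _; rewrite [RHS](integralE (map_kernel t) setT (fun w => f (t, w))); congr (_ - _)%E; apply: eq_integral => w _; rewrite ?funeposE ?funenegE.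
Qed.

Lemma map_control_prod (B : set (timeR R)) (W : set (borelRn R m)) :
  measurable B -> measurable W ->
  map_control (B `*` W) =
  (\int[lebesgue_measure]_(t in `[0%R, T]) ((\1_B t)%:E * map_law t W))%E.
Proof.
move=> mB mW.
have mBW : measurable (B `*` W) by exact: measurableX.
transitivity (\int[map_control]_z (\1_(B `*` W) z)%:E)%E.
  by rewrite integral_indic// setIT.
rewrite map_control_ge0_integral//; last exact/measurable_EFinP/measurable_indic.
apply: eq_integral => t _.
have -> : (fun w => (\1_(B `*` W) (t, w))%:E) = (fun w => ((\1_B t)%:E * (\1_W w)%:E)%E :> \bar R).
  by apply/funext => w; rewrite -EFinM -natrM mulnb; congr ((nat_of_bool _)%:R%:E); apply/idP/andP; rewrite !inE.
rewrite ge0_integralZl//; last by apply/measurable_EFinP; exact: measurable_indic.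
by rewrite integral_indic// setIT.
Qed.

Lemma map_control_young : young_measure T map_control.
Proof.
split.
  rewrite map_control_prod//; last exact: measurableC.
  apply: integral0_eq => t tT.
  by rewrite indicE memNset ?mul0e//=; apply.
move=> B mB BT; rewrite map_control_prod//.
under eq_integral do rewrite /= /pushforward preimage_setT probability_setT mule1.
by rewrite integral_indic//; congr lebesgue_measure; exact/setIidl.
Qed.

Lemma map_control_generalized (U : set 'rV[R]_m) : closed U ->
  (forall t x, 0 <= x < 1 -> U (X (t, x))) -> generalized_control T U map_control.
Proof.
move=> cU XU; split; first exact: map_control_young.
have [y0 yT] := map_control_young.
move=> [t w] /= sz.
split=> /=.
  apply: contrapT => tT.
  have o : open ((~` `[0, T]%classic) `*` [set: 'rV[R]_m]).
    by apply: open_setX; [exact/closed_openC/itv_closed|exact: openT].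
  have := sz _ o; rewrite y0 ltxx => h.
  by have : false by apply: h; split.
apply: contrapT => wU.
have o : open ([set: R] `*` ~` U) by apply: open_setX; [exact: openT|exact: closed_openC].
have := sz _ o; rewrite map_control_prod//; last first.
  by apply: measurableC; exact: closed_measurable_rV.
rewrite integral0_eq ?ltxx; last first.
  move=> r _; rewrite indicE in_setT mul1e /= /pushforward unif01E.
  rewrite (_ : _ `&` _ = set0) ?measure0//; apply/seteqP; split => // x /= [].
  by rewrite in_itv/= => /(XU r).
move=> h.
by have : false by apply: h; split.
Qed.

End control_of_map.

(** Each point outside the support has a null open neighbourhood. Replacing these neighbourhoods by
    rational boxes leaves countably many null sets that still cover the complement. *)
Lemma generalized_control_null {R : realType} {m : nat} (T : R) (U : set 'rV[R]_m)
    (nu : {measure set (timeR R * borelRn R m) -> \bar R}) : closed U ->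
  generalized_control T U nu -> nu (~` (`[0, T]%classic `*` U)) = 0%E.
Proof.
move=> cU [_ nuU]; set W := ~` _.
have oW : open (W : set (R * 'rV[R]_m)).
  have -> : W = (~` `[0, T]%classic) `*` setT `|` setT `*` ~` U.
    apply/seteqP; split => [[t w] h|[t w] [[/= tT _]|[/= _ wU]] [//]].
    have [tT|tT] := pselect (`[0, T]%classic t); [right|left] => //=.
    by split => // Uw; apply: h.
  apply: openU; apply: open_setX; first exact/closed_openC/itv_closed.
  - exact: openT.
  - exact: openT.
  - exact: closed_openC.
pose B (k : nat) : set (timeR R * borelRn R m) :=
  if unpickle k is Some c then if nu (tbox c) == 0%E then tbox c else set0 else set0.
have mB k : measurable (B k).
  rewrite /B; case: unpickle => // c; case: ifP => // _; exact: tbox_measurable.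
have B0 k : nu (B k) = 0%E.
  by rewrite /B; case: unpickle => [c|]; rewrite ?measure0//; case: ifPn => [/eqP//|]; rewrite measure0.
apply/eqP; rewrite eq_le measure_ge0 andbT.
apply: (@le_trans _ _ (nu (\bigcup_k B k))).
  apply: le_measure; rewrite ?inE; first exact: open_prod_measurable.
    exact: bigcupT_measurable.
  move=> z Wz.
  have [N [oN Nz nN]] : exists N : set (R * 'rV[R]_m), [/\ open N, N z & nu N = 0%E].
    apply: contrapT => h; apply: Wz; apply: nuU => N oN Nz.
    rewrite lt0e measure_ge0 andbT; apply/eqP => nN; apply: h; by exists N.
  have [c cz cN] := open_tbox oN Nz.
  exists (pickle c); first exact: I.
  rewrite /B pickleK ifT; first exact: cz.
  apply/eqP/eqP; rewrite eq_le measure_ge0 andbT -nN; apply: le_measure; rewrite ?inE//.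
    exact: tbox_measurable.
  exact: open_prod_measurable.
apply: (le_trans (measure_sigma_subadditive _ _ _ _)) => //; first exact: bigcupT_measurable.
by rewrite eseries0.
Qed.

Lemma generalized_control_le {R : realType} {m : nat} (T : R) (U : set 'rV[R]_m)
    (nu : {measure set (timeR R * borelRn R m) -> \bar R}) : generalized_control T U nu ->
  forall (B : set (timeR R)) (W : set (borelRn R m)), measurable B -> measurable W ->
  (nu (B `*` W) <= segm T B)%E.
Proof.
move=> [[y0 yT] _] B W mB mW.
have mI : measurable (`[0, T]%classic : set (timeR R)) by exact: measurable_itv.
rewrite segmE -yT; [|exact: measurableI|exact: subIsetr].
apply: (@le_trans _ _ (nu ((B `&` `[0, T]%classic) `*` setT `|` (~` `[0, T]%classic) `*` setT))).
  apply: le_measure; rewrite ?inE; first exact: measurableX.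
    by apply: measurableU; apply: measurableX => //; [exact: measurableI|exact: measurableC].
  by move=> [t w] [/= Bt Ww]; have [tT|tT] := pselect (`[0, T]%classic t); [left|right].
apply: (le_trans (measureU2 _ _ _)).
- by apply: measurableX => //; exact: measurableI.
- by apply: measurableX => //; exact: measurableC.
by rewrite -[leRHS]adde0 leeD2l// le_eqVlt; apply/orP; left; apply/eqP; exact: y0.
Qed.

(** * Densities of dominated set functions *)

Section dominated_additive.
Context d (X : measurableType d) (R : realType) (mu : {finite_measure set X -> \bar R}).
Variable r : set X -> R.
Hypotheses (r_ge0 : forall A, 0 <= r A)
  (r_le : forall A, measurable A -> ((r A)%:E <= mu A)%E)
  (r_add : forall A B, measurable A -> measurable B -> A `&` B = set0 ->
    r (A `|` B) = r A + r B).

Definition emeasure (A : set X) : \bar R := (r A)%:E.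

Let r0 : r set0 = 0.
Proof.
apply/eqP; rewrite eq_le r_ge0 andbT -lee_fin.
by rewrite (le_trans (r_le _))// measure0.
Qed.

Let domr0 : emeasure set0 = 0%E. Proof. by rewrite /emeasure r0. Qed.
Let domr_ge0 A : (0 <= emeasure A)%E. Proof. by rewrite lee_fin. Qed.

(** An ultrafilter limit of measures is only finitely additive. Domination repairs this: the
    [r]-value of a tail [tl n] is at most [mu (tl n)], which tends to 0 because the tails decrease
    to the empty set and [mu] is finite. *)
Let domr_sigma : semi_sigma_additive emeasure.
Proof.
move=> F mF tF mUF.
pose tl n := \bigcup_(k in [set k | (n <= k)%N]) F k.
have mtl n : measurable (tl n) by exact: bigcup_measurable.
have E n : r (\bigcup_k F k) = \sum_(i < n) r (F i) + r (tl n).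
  elim: n => [|n ih].
    by rewrite big_ord0 add0r; congr r; apply: eq_bigcupl; split.
  rewrite ih big_ord_recr/= -addrA; congr (_ + _).
  rewrite -r_add//.
    congr r; rewrite /tl; apply/seteqP; split => x /=.
      move=> [k /= nk Fk]; have [kn|kn] := eqVneq k n; first by left; rewrite -kn.
      by right; exists k => //=; rewrite ltn_neqAle eq_sym kn.
    by move=> [Fx|[k /= nk Fk]]; [exists n => /=|exists k => //=; exact: ltnW].
  apply/seteqP; split => // x [Fx [k /= nk Fk]].
  move/trivIsetP : tF => /(_ n k I I); rewrite neq_ltn nk => /(_ isT) h.
  by have : (F n `&` F k) x; [split|rewrite h].
have ct : mu (tl n) @[n --> \oo] --> (0 : \bar R)%E.
  rewrite -(measure0 mu) (_ : set0 = \bigcap_n tl n); last first.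
    apply/seteqP; split => // x h; have [k _ Fk] := h 0%N I.
    have [k' /= kk' Fk'] := h k.+1 I.
    move/trivIsetP : tF => /(_ k k' I I); rewrite neq_ltn kk' => /(_ isT) e.
    by have : (F k `&` F k') x; [split|rewrite e].
  apply: nonincreasing_cvg_mu => //; first by rewrite ltey_eq fin_num_measure.
    exact: bigcapT_measurable.
  apply/nonincreasing_seqP => n; apply/subsetPset => x [k /= nk Fk].
  by exists k => //=; exact: ltnW.
have cr : r (tl n) @[n --> \oo] --> (0 : R).
  have /fine_cvgP[_ cf] := ct.
  apply: (squeeze_cvgr _ (cvg_cst 0) cf); apply: nearW => n /=.
  by rewrite r_ge0/= -lee_fin fineK ?r_le// fin_num_measure.
have -> : (fun n => \sum_(0 <= i < n) emeasure (F i))%E =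
    EFin \o (fun n => r (\bigcup_k F k) - r (tl n)).
  by apply/funext => n; rewrite /emeasure sumEFin big_mkord /= (E n) addrK.
apply: cvg_EFin; first exact: nearW.
by rewrite -[X in _ --> X]subr0; apply: cvgB => //; exact: cvg_cst.
Qed.

HB.instance Definition _ := isMeasure.Build _ _ _ emeasure domr0 domr_ge0 domr_sigma.

Let domr_fin : fin_num_fun emeasure. Proof. by []. Qed.

HB.instance Definition _ := @Measure_isFinite.Build _ _ _ emeasure domr_fin.

(** Radon-Nikodym gives a density [f], and the domination by [p] makes the set where it exceeds [p]
    null. Taking the minimum with [p] gives the bound at every point, as the digit process asks for
    nonnegative weights at every time. *)
Lemma dominated_density (p : X -> R) : measurable_fun setT p -> (forall x, 0 <= p x <= 1) ->
  (forall A, measurable A -> (emeasure A <= \int[mu]_(x in A) (p x)%:E)%E) ->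
  exists q : X -> R, [/\ measurable_fun setT q, forall x, 0 <= q x <= p x &
    forall A, measurable A -> emeasure A = (\int[mu]_(x in A) (q x)%:E)%E].
Proof.
move=> mp p01 pr.
have [f [f0 fi fE]] : exists f : X -> \bar R, [/\ forall x, (0 <= f x)%E,
    mu.-integrable setT f & forall E, measurable E -> emeasure E = (\int[mu]_(x in E) f x)%E].
  apply: radon_nikodym_finite; apply/null_content_dominatesP => A mA muA0.
  by apply/eqP; rewrite eq_le domr_ge0 andbT -muA0 r_le.
have mf : measurable_fun setT f by exact: measurable_int fi.
have pi : mu.-integrable setT (EFin \o p).
  apply: (bounded_integrable (M := 1)) => //; first exact: fin_num_fun_lty.
  by move=> x _; have /andP[p0 p1] := p01 x; rewrite ger0_norm.
pose N := [set x | ((p x)%:E < f x)%E].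
have mN : measurable N.
  have mep : measurable_fun setT (EFin \o p) by exact/measurable_EFinP.
  by have := measurable_lte measurableT mep mf; rewrite setTI.
have mu_N : mu N = 0%E.
  have fpi : mu.-integrable N (f \- (EFin \o p))%E.
    by apply: (integrableS measurableT) => //; exact: integrableB.
  have h : (\int[mu]_(x in N) `|(f \- (EFin \o p)) x| = 0)%E.
    under eq_integral => x xN.
      rewrite gee0_abs; last by rewrite sube_ge0 ?orbT//; move: xN; rewrite inE => /ltW.
      over.
    apply/eqP; rewrite eq_le; apply/andP; split; last first.
      by apply: integral_ge0 => x Nx; rewrite sube_ge0 ?orbT// ltW.
    rewrite integralB//; last 2 first.
    - exact: (integrableS measurableT).
    - exact: (integrableS measurableT).
    by rewrite -fE// sube_le0 pr.
  have [M [mM M0 hM]] := (ae_eq_integral_abs mu mN (measurable_int _ fpi)).1 h.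
  apply/eqP; rewrite eq_le measure_ge0 andbT -M0; apply: le_measure; rewrite ?inE//.
  move=> x Nx; apply: hM => /= /(_ Nx); move: Nx; rewrite /N /=.
  case: (f x) => [s||]//; rewrite lte_fin => ps [] /eqP.
  by rewrite subr_eq0 => /eqP sp; move: ps; rewrite sp ltxx.
exists (fun x => Num.min (fine (f x)) (p x)); split.
- apply: measurable_minr => //; apply: measurableT_comp mf.
  exact: fine_measurable.
- by move=> x; have /andP[p0 p1] := p01 x; rewrite le_min fine_ge0 ?p0//= ge_min lexx orbT.
- move=> A mA; rewrite fE//; apply: ae_eq_integral => //.
  + exact: measurable_funTS.
  + apply/measurable_EFinP; apply: measurable_funTS; apply: measurable_minr => //.
    apply: measurableT_comp mf; exact: fine_measurable.
  + exists N; split => // x /= h; rewrite /N /= ltNge; apply/negP => fp.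
    apply: h => _; have ffin : f x \is a fin_num.
      by rewrite ge0_fin_numE// (le_lt_trans fp)// ltry.
    by rewrite min_l ?fineK// -lee_fin fineK.
Qed.

End dominated_additive.

Lemma Rintegral_dist_null d (X : measurableType d) (R : realType) (P : {measure set X -> \bar R})
    (S : set X) (f g : X -> R) (e : R) :
  (P setT < +oo)%E -> measurable S -> P (~` S) = 0%E -> P.-integrable setT (EFin \o f) ->
  P.-integrable setT (EFin \o g) -> (forall x, S x -> `|f x - g x| <= e) -> 0 <= e ->
  `|\int[P]_x f x - \int[P]_x g x| <= e * fine (P setT).
Proof.
move=> Pfin mS PS iF ig fg e0.
have Sfin : (P S < +oo)%E by apply: le_lt_trans Pfin; apply: le_measure; rewrite ?inE.
have ifg : P.-integrable setT (EFin \o (fun x => f x - g x)) by exact: integrable_subr.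
rewrite -RintegralB//.
have -> : \int[P]_x (f x - g x) = \int[P]_(x in S) (f x - g x).
  rewrite /Rintegral (negligible_integral _ _ ifg PS)//; last exact: measurableC.
  by rewrite setDE setCK setTI.
have ifgS := integrableS measurableT mS (@subsetT _ S) ifg.
apply: (le_trans (le_normr_Rintegral _ _)) => //.
apply: (@le_trans _ _ (\int[P]_(x in S) cst e x)).
  apply: le_Rintegral => //; first exact/integrable_norm.
  by apply: (bounded_integrable (M := e)) => // x _ /=; rewrite ger0_norm.
rewrite Rintegral_cst// ler_wpM2l//.
by apply: fine_le; rewrite ?fin_num_measure ?ge0_fin_numE//; apply: le_measure; rewrite ?inE.
Qed.

Lemma range_estimate d (X : measurableType d) (R : realType) (P : {measure set X -> \bar R})
    (N : nat) (W : X -> seq bool) (S : set X) (f : X -> R) (g : seq bool -> R) (K e : R) :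
  (P setT < +oo)%E -> (forall x, size (W x) = N) ->
  (forall w, measurable [set x | W x = w]) -> measurable S -> P (~` S) = 0%E ->
  measurable_fun setT f -> (forall x, `|f x| <= K) ->
  (forall x, S x -> `|f x - g (W x)| <= e) -> 0 <= e ->
  `|\int[P]_x f x - \sum_(w : N.-tuple bool) g w * fine (P [set x | W x = w])|
  <= e * fine (P setT).
Proof.
move=> Pfin sW mW mS PS mf fK fg e0; rewrite -(finite_range_Rintegral Pfin sW mW).
have mWS (A : set (seq bool)) : measurable [set x | A (W x)].
  rewrite (_ : [set _ | _] = \bigcup_(w in A) [set x | W x = w]).
    by rewrite bigcup_mkcond; apply: countable_bigcupT_measurable => // w; case: ifPn.
  by apply/seteqP; split => [x Ax|x [w Aw xw]]; [exists (W x)|rewrite /= xw].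
have mg : measurable_fun setT (g \o W).
  by move=> _ Y mY; rewrite setTI; exact: (mWS (g @^-1` Y)).
pose K' := \sum_(w : N.-tuple bool) `|g w|.
have gK x : `|g (W x)| <= K'.
  have sx : size (W x) == N by rewrite sW.
  by rewrite /K' (bigD1 (Tuple sx))//= lerDl sumr_ge0.
apply: (Rintegral_dist_null Pfin mS PS) => //.
  by apply: (bounded_integrable (M := K)).
by apply: (bounded_integrable (M := K')) => // x _; exact: gK.
Qed.

Lemma generalized_control_marginal {R : realType} {m : nat} (T : R) (U : set 'rV[R]_m)
    (nu : {measure set (timeR R * borelRn R m) -> \bar R}) : generalized_control T U nu ->
  forall B : set (timeR R), measurable B -> nu (B `*` setT) = segm T B.
Proof.
move=> gc B mB; apply/eqP; rewrite eq_le (generalized_control_le gc)//=.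
have [[y0 yT] _] := gc.
have mI : measurable (`[0, T]%classic : set (timeR R)) by exact: measurable_itv.
rewrite segmE -yT; [|exact: measurableI|exact: subIsetr].
apply: le_measure; rewrite ?inE; [| |by move=> [t w] [[/= Bt _] _]].
  by apply: measurableX => //; exact: measurableI.
exact: measurableX.
Qed.

(** * Compactness of generalized controls *)

Section control_compactness.
Context {R : realType} {m : nat} (T : R) (U : set 'rV[R]_m).
Hypotheses (T0 : 0 < T) (U_compact : compact U) (U_nonempty : U !=set0).
Variable nu : nat -> {measure set (timeR R * borelRn R m) -> \bar R}.
Hypothesis nu_gc : forall k, generalized_control T U (nu k).
Variables (F : set_system nat) (UF : UltraFilter F).

Let cU : closed U. Proof. by apply: compact_closed => //; exact: norm_hausdorff. Qed.

(* The minimum is only effective on non measurable B. *)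
Let rk k w (B : set (timeR R)) : R := Num.min (fine (nu k (B `*` cell w))) T.

Let segm_tot : segm T setT = T%:E.
Proof. by rewrite segmE setTI lebesgue_measure_itv/= lte_fin T0 oppr0 adde0. Qed.

Let nu_le k w (B : set (timeR R)) : measurable B -> (nu k (B `*` cell w) <= segm T B)%E.
Proof. by move=> mB; apply: (generalized_control_le (nu_gc k)) => //; exact: measurable_cell. Qed.

Let segm_le (B : set (timeR R)) : measurable B -> (segm T B <= T%:E)%E.
Proof. by move=> mB; rewrite -segm_tot; apply: le_measure; rewrite ?inE. Qed.

Let nu_fin k w (B : set (timeR R)) : measurable B -> nu k (B `*` cell w) \is a fin_num.
Proof.
move=> mB; rewrite ge0_fin_numE//; apply: (le_lt_trans (nu_le k w mB)).
by apply: (le_lt_trans (segm_le mB)); rewrite ltry.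
Qed.

Let rkE k w (B : set (timeR R)) : measurable B -> (rk k w B)%:E = nu k (B `*` cell w).
Proof.
move=> mB; rewrite /rk min_l ?fineK ?nu_fin// -lee_fin fineK ?nu_fin//.
by apply: (le_trans (nu_le _ _ mB)); exact: segm_le.
Qed.

Let rk_bound k w B : `|rk k w B| <= T.
Proof. by rewrite ger0_norm ?le_min ?fine_ge0 ?(ltW T0)//= ge_min lexx orbT. Qed.

Let rho w (B : set (timeR R)) : R := ulim F (fun k => rk k w B).

Let rho_cvg w B : rk k w B @[k --> F] --> rho w B.
Proof. exact: (ulim_cvg (fun k => rk_bound k w B)). Qed.

Let rho_ge0 w B : 0 <= rho w B.
Proof. by apply: cvg_ge (rho_cvg (w := w) (B := B)) _ => k; rewrite le_min fine_ge0// ltW. Qed.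

Let rho_le w B : measurable B -> ((rho w B)%:E <= segm T B)%E.
Proof.
move=> mB; have sf : segm T B \is a fin_num by rewrite fin_num_measure.
rewrite -[leRHS]fineK// lee_fin; apply: cvg_le (rho_cvg (w := w) (B := B)) _ => k.
by rewrite -lee_fin fineK// rkE// nu_le.
Qed.

Let rho_add w A B : measurable A -> measurable B -> A `&` B = set0 ->
  rho w (A `|` B) = rho w A + rho w B.
Proof.
move=> mA mB AB; apply: ulimE.
rewrite (_ : (fun k => _) = (fun k => rk k w A + rk k w B)).
  by apply: cvgD; exact: rho_cvg.
apply/funext => k; apply: EFin_inj; rewrite EFinD !rkE//; last exact: measurableU.
have mc := @measurable_cell R m w.
rewrite -measureU; [|exact: measurableX|exact: measurableX|]; last first.
  apply/seteqP; split => // [[t x]] [[/= At _] [/= Bt _]].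
  by have : (A `&` B) t; [split|rewrite AB].
congr (nu k _); apply/seteqP; split => [[t x] [/= [At|Bt] cx]|[t x] [] [/= h cx]].
- by left.
- by right.
- by split => //; left.
- by split => //; right.
Qed.

Let rho_nil B : measurable B -> (rho [::] B)%:E = segm T B.
Proof.
move=> mB; have sf : segm T B \is a fin_num by rewrite fin_num_measure.
rewrite -[RHS]fineK//; congr EFin; apply: ulimE.
rewrite (_ : (fun k => _) = cst (fine (segm T B))); first exact: cvg_cst.
apply/funext => k; apply: EFin_inj; rewrite rkE// fineK//.
rewrite -(generalized_control_marginal (nu_gc k) mB); congr (nu k (_ `*` _)).
by apply/seteqP; split.
Qed.

Let rho_split w B : measurable B -> rho w B = rho (false :: w) B + rho (true :: w) B.
Proof.
move=> mB; apply: ulimE.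
rewrite (_ : (fun k => _) = (fun k => rk k (false :: w) B + rk k (true :: w) B)).
  by apply: cvgD; exact: rho_cvg.
apply/funext => k; apply: EFin_inj; rewrite EFinD !rkE//.
have mc v := @measurable_cell R m v.
rewrite -measureU; [|exact: measurableX|exact: measurableX|]; last first.
  by rewrite !cell_cons; apply/seteqP; split => // [[t x]] [[/= _ [_ ->]] [/= _ []]].
congr (nu k _); rewrite !cell_cons; apply/seteqP; split => [[t x] [/= Bt cx]|[t x] [] [/= h [cx _]]]//.
by case: (boolP (digit (size w) x)) => dx; [right|left]; split => //; split => //; exact/negbTE.
Qed.

Let rho_support w B : measurable B -> cell w `&` U = set0 -> rho w B = 0.
Proof.
move=> mB wU; apply: ulimE; rewrite (_ : (fun k => _) = cst 0); first exact: cvg_cst.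
apply/funext => k; apply: EFin_inj; rewrite rkE//.
apply/eqP; rewrite eq_le measure_ge0 andbT.
apply: (@le_trans _ _ (nu k (~` (`[0, T]%classic `*` U)))); last by rewrite (generalized_control_null cU).
apply: le_measure; rewrite ?inE.
- by apply: measurableX => //; exact: measurable_cell.
- apply: measurableC; apply: measurableX; first exact: measurable_itv.
  exact: closed_measurable_rV.
- move=> [t x] [/= _ cx] [/= _ Ux].
  by have : (cell w `&` U) x; [split|rewrite wU].
Qed.

Let rhoT w : rho w setT = 0 -> forall B, measurable B -> rho w B = 0.
Proof.
move=> h B mB; apply/eqP; rewrite eq_le rho_ge0 andbT -h.
rewrite -[setT](setUv B) rho_add ?setICr//; last exact: measurableC.
by rewrite lerDl.
Qed.

(* The last clause keeps the digit process inside the cells that meet U for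
   every t, not only for almost every t. *)
Definition good_density (w : seq bool) (p : R -> R) :=
  [/\ measurable_fun setT (p : timeR R -> R), forall x, 0 <= p x <= 1,
    forall B, measurable B -> (rho w B)%:E = (\int[segm T]_(x in B) (p x)%:E)%E &
    rho w setT = 0 -> forall x, p x = 0].

(** The [true] child gets a density dominated by [p] and the [false] child the remainder. The
    densities thus add up at every time, not only almost everywhere. *)
Lemma density_step w p : good_density w p ->
  exists q, good_density (true :: w) q /\ good_density (false :: w) (fun x => p x - q x).
Proof.
move=> [mp p01 pE p0].
have ip : (segm T).-integrable setT (EFin \o p).
  apply: (bounded_integrable (M := 1)) => //; first exact: segm_lty.
  by move=> x _; have /andP[h1 h2] := p01 x; rewrite ger0_norm.
suff [q [mq qp qE [qt qf]]] : exists q, [/\ measurable_fun setT (q : timeR R -> R),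
    forall x, 0 <= q x <= p x,
    forall B, measurable B -> (rho (true :: w) B)%:E = (\int[segm T]_(x in B) (q x)%:E)%E &
    (rho (true :: w) setT = 0 -> forall x, q x = 0) /\
    (rho (false :: w) setT = 0 -> forall x, q x = p x)].
  have iq : (segm T).-integrable setT (EFin \o q).
    apply: (bounded_integrable (M := 1)) => //; first exact: segm_lty.
    move=> x _; have /andP[h1 h2] := p01 x; have /andP[h3 h4] := qp x.
    by rewrite ger0_norm// (le_trans h4).
  exists q; split; split => //.
  - move=> x; have /andP[h1 h2] := p01 x; have /andP[h3 h4] := qp x.
    by rewrite h3 (le_trans h4).
  - exact: measurable_funB.
  - move=> x; have /andP[h1 h2] := p01 x; have /andP[h3 h4] := qp x.
    by rewrite subr_ge0 h4 lerBlDr (le_trans h2)// lerDl.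
  - move=> B mB; under eq_integral do rewrite EFinB.
    rewrite integralB//; [|exact: (integrableS measurableT)|exact: (integrableS measurableT)].
    rewrite -pE// -qE// -EFinB; congr EFin.
    by rewrite (rho_split w mB) addrK.
  - by move=> /qf h x; rewrite h subrr.
(* A child of total mass 0 must get a density that vanishes identically, so it is given 0 and its
   sibling all of [p]. When both masses are 0, [p] is itself 0 by [good_density]. *)
have [rt|rt] := eqVneq (rho (true :: w) setT) 0.
  exists (cst 0); split => //.
  - by move=> x; have /andP[h1 h2] := p01 x; rewrite lexx.
  - by move=> B mB; rewrite rhoT// integral0.
  - split => // rf x; rewrite p0//.
    by rewrite (rho_split w measurableT) rt rf addr0.
have [rf|rf] := eqVneq (rho (false :: w) setT) 0.
  exists p; split => //.
  - by move=> x; have /andP[h1 h2] := p01 x; rewrite h1 lexx.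
  - by move=> B mB; rewrite -pE// (rho_split w mB) (rhoT rf)// add0r.
  - by split => // /eqP; rewrite (negbTE rt).
have pr A : measurable A -> (emeasure (rho (true :: w)) A <= \int[segm T]_(x in A) (p x)%:E)%E.
  move=> mA; rewrite -pE// lee_fin (rho_split w mA) lerDr.
  exact: rho_ge0.
have [q [mq qp qE]] := dominated_density (@rho_ge0 (true :: w))
  (@rho_le (true :: w)) (@rho_add (true :: w)) mp p01 pr.
exists q; split => //.
by split => /eqP; rewrite ?(negbTE rt) ?(negbTE rf).
Qed.

Let good_nil : good_density [::] (cst 1).
Proof.
split => //.
- by move=> x /=; rewrite ler01 lexx.
- by move=> B mB; rewrite rho_nil//; have := @integral_cst _ _ _ (segm T) B mB 1; rewrite mul1e => <-.
- move=> h; have := rho_nil measurableT; rewrite h segm_tot => -[] /eqP.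
  by rewrite lt_eqF.
Qed.

(** The choice [q] depends on [w'] only, so both children share it and the identity [p_split]
    reduces to [subrK]. *)
Fixpoint density (w : seq bool) : {p : R -> R | good_density w p} :=
  match w with
  | [::] => exist _ _ good_nil
  | b :: w' =>
    let q := cid (density_step (svalP (density w'))) in
    if b as b return {p : R -> R | good_density (b :: w') p}
    then exist _ _ (svalP q).1 else exist _ _ (svalP q).2
  end.

Let p w := sval (density w).

Let pP w : good_density w (p w). Proof. exact: svalP. Qed.

Let p_ge0 w t : 0 <= p w t.
Proof. by have [_ /(_ t)/andP[]] := pP w. Qed.

Let p_nil t : p [::] t = 1. Proof. by []. Qed.

Let p_split w t : p w t = p (false :: w) t + p (true :: w) t.
Proof. by rewrite /p /= subrK. Qed.

Let p_meas w : measurable_fun setT (p w : timeR R -> R).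
Proof. by have [] := pP w. Qed.

Let D N (z : timeR R * timeR R) := dproc (p : seq bool -> timeR R -> R) N z.

Let rep := cell_rep U.

(** A cell that misses [U] has limit mass 0, so its density vanishes identically by the last clause
    of [good_density] and its interval is empty at every time. *)
Let D_nonempty N z : 0 <= z.2 < 1 -> cell (D N z) `&` U !=set0.
Proof.
move=> x01; apply/set0P/eqP => h.
have := @dprocP _ _ _ (p : seq bool -> timeR R -> R) p_ge0 p_nil p_split (D N z) z x01.
rewrite {1}/D size_dproc eqxx => /esym/andP[/= h1 h2].
have [_ _ _ /(_ (rho_support measurableT h) z.1) p0] := pP (D N z).
by move: (le_lt_trans h1 h2); rewrite p0 addr0 ltxx.
Qed.

Let D_step z N : exists b, D N.+1 z = b :: D N z.
Proof. by rewrite /D /=; eexists. Qed.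

Let D_drop z N N' : (N <= N')%N -> drop (N' - N) (D N' z) = D N z.
Proof.
elim: N' => [|N' ih]; first by rewrite leqn0 => /eqP ->; rewrite drop0.
rewrite leq_eqVlt => /predU1P[->|]; first by rewrite subnn drop0.
by rewrite ltnS => NN'; have [b ->] := D_step z N'; rewrite subSn//= ih.
Qed.

Let repP N z : 0 <= z.2 < 1 -> cell (D N z) (rep (D N z)) /\ U (rep (D N z)).
Proof. by move=> /(D_nonempty N)/cell_repP[]. Qed.

Let U_bounded : exists M : R, forall u, U u -> `|u| <= M.
Proof.
have [M [_ hM]] := compact_bounded U_compact.
by exists (M + 1) => u Uu; apply: (hM (M + 1)) => //; rewrite ltrDl.
Qed.

Let X : timeR R * timeR R -> borelRn R m := dpoint (p : seq bool -> timeR R -> R) rep.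

Let mX : measurable_fun setT X. Proof. exact: measurable_dpoint. Qed.

Let X_cvg z : 0 <= z.2 < 1 -> rep (D N z) @[N --> \oo] --> (X z : 'rV[R]_m).
Proof.
move=> x01; have [M hM] := U_bounded.
have : cvg (rep (D N z) @[N --> \oo]).
  apply: (@rep_cvg _ _ U (fun N => D N z) M 0).
  - by move=> N; rewrite size_dproc.
  - exact: D_step.
  - by move=> N; exact: D_nonempty.
  - by move=> N _; apply: hM; have [] := repP N x01.
by move=> /cvg_ex[l hl]; rewrite /X (dpointE hl).
Qed.

Let XU t x : 0 <= x < 1 -> U (X (t, x)).
Proof.
move=> x01; apply: (closed_cvg U cU _ _ (@X_cvg (t, x) x01)).
by apply: nearW => N; have [] := @repP N (t, x) x01.
Qed.

Let D_fine e : 0 < e -> exists N0, forall N z, (N0 <= N)%N -> 0 <= z.2 < 1 ->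
  `|(X z : 'rV[R]_m) - rep (D N z)| <= e.
Proof.
move=> e0; have [M hM] := U_bounded; have [N0 hN] := @word_fine R m M _ e0.
exists N0 => N z NN x01.
have cd : `|rep (D N' z) - rep (D N z)| @[N' --> \oo] --> `|(X z : 'rV[R]_m) - rep (D N z)|.
  by apply: cvg_norm; apply: cvgB; [exact: X_cvg|exact: cvg_cst].
apply: (closed_cvg [set r : R | r <= e] (@closed_le _ e) _ _ cd).
exists N => // N' /= NN'.
have [c1 _] := repP N x01; have [c2 u2] := repP N' x01.
apply: hN; first exact: hM.
apply: (word_le NN); have s1 := size_dproc (p : seq bool -> timeR R -> R) N z.
have s2 := size_dproc (p : seq bool -> timeR R -> R) N' z.
rewrite (word_of_cell _ c1) ?s1// (word_of_cell _ c2) ?s2//.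
by rewrite subnn drop0 -/(D N' z) -/(D N z) D_drop.
Qed.

(** Times are coded by the same digits, as row vectors of length 1: a time word together with a word
    in space singles out a piece of the product of [[0, T]] and [U] on which [psi] oscillates
    little. *)
Let tw N (t : timeR R) := word N (const_mx t : 'rV[R]_1).

Let mtw N u : measurable [set t | tw N t = u].
Proof.
have mc : measurable_fun setT (fun t : timeR R => (const_mx t : borelRn R 1)).
  by apply: measurable_fun_rV => j; under eq_fun do rewrite mxE; exact: measurable_id.
rewrite -[[set t | _]]setTI.
exact: (mc measurableT _ (@measurable_word R 1 N [set u])).
Qed.

Let P := (segm T \x @unif01 R)%E.

Let law_word N u v : size v = N ->
  P ([set z | tw N z.1 = u /\ D N z = v]) = (rho v [set t | tw N t = u])%:E.
Proof.
move=> sv; have [_ _ pE _] := pP v; rewrite pE//.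
rewrite /P /product_measure1 [RHS]integral_mkcond.
apply: eq_integral => t _.
rewrite /= patchE; case: ifPn => [|]; rewrite ?inE ?notin_setE/= => tu.
  rewrite -(dproc_law p_ge0 p_nil p_split) -unif01E; congr (unif01 _).
  by apply/seteqP; split => x; rewrite /xsection /= inE /= sv; [case|].
rewrite (_ : xsection _ _ = set0) ?measure0//.
by apply/seteqP; split => // x; rewrite /xsection /= inE /= => -[].
Qed.

(** Concatenation lets the estimates for a single word, of length [N + N], apply to pairs of words;
    [take] and [drop] recover the components. *)
Let wrd N (z : timeR R * borelRn R m) := tw N z.1 ++ word N z.2.

Let dwrd N (z : timeR R * timeR R) := tw N z.1 ++ D N z.

Let cat_eq N (a b h : seq bool) : size a = N -> size h = (N + N)%N ->
  (a ++ b = h) <-> (a = take N h /\ b = drop N h).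
Proof.
move=> sa sh; have th : size a = size (take N h) by rewrite sa size_takel// sh leq_addr.
rewrite -{1}[h](cat_take_drop N); split.
  by move=> /eqP; rewrite eqseq_cat// => /andP[/eqP -> /eqP ->].
by move=> [-> ->].
Qed.

Let wrd_set N h : size h = (N + N)%N ->
  [set z | wrd N z = h] = [set t | tw N t = take N h] `*` cell (drop N h).
Proof.
move=> sh; apply/seteqP; split => [[t x] /= /cat_eq|[t x] [/= e1 e2]].
  by rewrite size_word => /(_ N erefl sh)[-> e]; split => //=; rewrite /cell /= size_drop sh addnK.
by apply/cat_eq => //; rewrite ?size_word//; split => //; move: e2; rewrite /cell /= size_drop sh addnK.
Qed.

Let dwrd_set N h : size h = (N + N)%N ->
  [set z | dwrd N z = h] = [set z | tw N z.1 = take N h /\ D N z = drop N h].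
Proof.
move=> sh; apply/seteqP; split => z /=.
  by move=> /cat_eq; rewrite size_word => /(_ N erefl sh).
by move=> h'; apply/cat_eq => //; rewrite size_word.
Qed.

Let mwrd N h : measurable [set z | wrd N z = h].
Proof.
have [sh|sh] := eqVneq (size h) (N + N)%N; last first.
  rewrite (_ : [set _ | _] = set0)//; apply/seteqP; split => // z /= zh.
  by move/eqP : sh; apply; rewrite -zh size_cat !size_word.
by rewrite wrd_set//; apply: measurableX => //; exact: measurable_cell.
Qed.

Let mdwrd N h : measurable [set z | dwrd N z = h].
Proof.
have [sh|sh] := eqVneq (size h) (N + N)%N; last first.
  rewrite (_ : [set _ | _] = set0)//; apply/seteqP; split => // z /= zh.
  by move/eqP : sh; apply; rewrite -zh size_cat size_word size_dproc.
rewrite dwrd_set// (_ : [set _ | _] = fst @^-1` [set t | tw N t = take N h] `&`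
    [set z | dproc (p : seq bool -> timeR R -> R) (size (drop N h)) z = drop N h]).
  apply: measurableI; last exact: measurable_dproc_eq.
  by rewrite -[_ @^-1` _]setTI; exact: (@measurable_fst _ _ (timeR R) (timeR R)).
by rewrite size_drop sh addnK.
Qed.

Let law_cvg N h : size h = (N + N)%N ->
  fine (nu k [set z | wrd N z = h]) @[k --> F] --> fine (P [set z | dwrd N z = h]).
Proof.
move=> sh; rewrite dwrd_set// law_word; last by rewrite size_drop sh addnK.
rewrite (_ : (fun k => _) = (fun k => rk k (drop N h) [set t | tw N t = take N h])).
  exact: rho_cvg.
by apply/funext => k; rewrite wrd_set// -rkE.
Qed.

Let PE A B : measurable A -> measurable B -> P (A `*` B) = (segm T A * unif01 B)%E.
Proof. exact: product_measure1E. Qed.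

Let PT : P setT = T%:E.
Proof. by rewrite -setXTT PE// segm_tot probability_setT mule1. Qed.

Let nuT k : nu k setT = T%:E.
Proof. by rewrite -setXTT (generalized_control_marginal (nu_gc k)). Qed.

Let P_null : P (~` (`[0, T]%classic `*` `[0, 1[%classic)) = 0%E.
Proof.
have mI : measurable (`[0, T]%classic : set (timeR R)) by exact: measurable_itv.
have mJ : measurable (`[0, 1[%classic : set (timeR R)) by exact: measurable_itv.
apply/eqP; rewrite eq_le measure_ge0 andbT.
apply: (@le_trans _ _ (P ((~` `[0, T]%classic) `*` setT `|` setT `*` (~` `[0, 1[%classic)))).
  apply: le_measure; rewrite ?inE.
  - by apply: measurableC; exact: measurableX.
  - by apply: measurableU; apply: measurableX => //; exact: measurableC.
  - move=> [t x] h; have [tT|tT] := pselect (`[0, T]%classic t); [right|left] => //=.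
    by split => // x1; apply: h.
apply: (le_trans (measureU2 _ _ _)).
- by apply: measurableX => //; exact: measurableC.
- by apply: measurableX => //; exact: measurableC.
rewrite -[leRHS]adde0; apply: leeD; rewrite le_eqVlt; apply/orP; left; apply/eqP.
  apply: etrans (PE _ _) _ => //; first exact: measurableC.
  by rewrite segmE setICl measure0 mul0e.
apply: etrans (PE _ _) _ => //; first exact: measurableC.
by rewrite unif01E setICr measure0 mule0.
Qed.

(** Replace [psi] by its values at representatives of the product cells. Up to [e1 * T], both
    integrals become the same finite sum with different weights, and the weights converge by
    [law_cvg]. Uniform continuity is asked for only on the product of [[0, T]] and [U], which
    carries all the measures involved. *)
Lemma control_compactness : exists (nu0 : {measure set (timeR R * borelRn R m) -> \bar R})
    (nuk : R.-pker (timeR R) ~> (borelRn R m)),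
  [/\ generalized_control T U nu0, disintegration T nu0 nuk, forall t, nuk t (~` U) = 0%E &
    forall (psi : timeR R * borelRn R m -> R) (K : R), measurable_fun setT psi ->
      (forall z, `|psi z| <= K) ->
      (forall e, 0 < e -> exists2 dl, 0 < dl & forall t t' (w w' : 'rV[R]_m),
        t \in `[0, T] -> t' \in `[0, T] -> U w -> U w' -> `|t - t'| <= dl -> `|w - w'| <= dl ->
        `|psi (t, w) - psi (t', w')| <= e) ->
      \int[nu k]_z psi z @[k --> F] --> \int[nu0]_z psi z].
Proof.
exists (map_control T mX), (map_kernel mX); split.
- by apply: map_control_generalized => // t x; exact: XU.
- exact: map_control_disintegration.
- move=> t; rewrite /= /pushforward unif01E (_ : _ `&` _ = set0) ?measure0//.
  by apply/seteqP; split => // x /= []; rewrite in_itv/= => /(XU t).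
move=> psi K mpsi psiK uc.
have mS : measurable (`[0, T]%classic `*` `[0, 1[%classic : set (timeR R * timeR R)).
  by apply: measurableX; exact: measurable_itv.
have mS' : measurable (`[0, T]%classic `*` U : set (timeR R * borelRn R m)).
  by apply: measurableX; [exact: measurable_itv|exact: closed_measurable_rV].
have mg := measurable_map_graph mX.
have P_lty : (P setT < +oo)%E by rewrite PT ltry.
have -> : \int[map_control T mX]_z psi z = \int[P]_z psi (map_graph X z).
  rewrite /Rintegral integral_pushforward//.
  - exact/measurable_EFinP.
  - apply: (@bounded_integrable _ _ _ _ _ _ K) => //.
    + by rewrite preimage_setT.
    + by rewrite preimage_setT; exact: measurableT_comp.
apply/cvgrPdist_le => e e0.
have T3 : 0 < 3 * T by rewrite mulr_gt0.
(* All measures have total mass [T], so each of the two replacements costs at most [e / 3]. *)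
pose e1 := e / (3 * T).
have e10 : 0 < e1 by rewrite divr_gt0.
have e1T : e1 * T + e / 3 + e1 * T = e by rewrite /e1; field; rewrite gt_eqF.
have [dl dl0 hdl] := uc _ e10.
have [N1 hN1] := @word_fine R 1 T _ dl0.
have [M hM] := U_bounded.
have [N2 hN2] := @word_fine R m M _ dl0.
have [N3 hN3] := D_fine dl0.
pose N := maxn N1 (maxn N2 N3).
have NN1 : (N1 <= N)%N by exact: leq_maxl.
have NN2 : (N2 <= N)%N by rewrite /N leq_max leq_maxl orbT.
have NN3 : (N3 <= N)%N by rewrite /N leq_max leq_maxr orbT.
(* The representative time is sought among points of [[0, T]], since [psi] is controlled only
   there. *)
pose rt u : R := cell_rep [set x : 'rV[R]_1 | exists2 t, t \in `[0, T] & x = const_mx t] u ord0 ord0.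
have rtP t : t \in `[0, T] -> rt (tw N t) \in `[0, T] /\ `|t - rt (tw N t)| <= dl.
  move=> tT; have [|c1 [t' t'T et]] := @cell_repP _ _
    [set x : 'rV[R]_1 | exists2 t, t \in `[0, T] & x = const_mx t] (tw N t).
    by exists (const_mx t); split; [exact: cell_word|exists t].
  rewrite /rt et mxE; split => //.
  have -> : t - t' = (const_mx t - const_mx t' : 'rV[R]_1) ord0 ord0 by rewrite !mxE.
  apply: (le_trans (coord_le_norm _ _)); apply: hN1.
    apply: norm_le_coord; first exact: ltW.
    by move=> j; rewrite mxE ger0_norm; move: tT; rewrite in_itv/= => /andP[].
  apply: (word_le NN1); rewrite et in c1.
  by move: c1; rewrite /cell /= size_word.
pose g h := psi (rt (take N h), rep (drop N h)).
have nu_lty k : (nu k setT < +oo)%E by rewrite nuT ltry.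
have E1 k : `|\int[nu k]_z psi z -
    \sum_(h : (N + N).-tuple bool) g h * fine (nu k [set z | wrd N z = h])| <= e1 * T.
  have := @range_estimate _ _ R (nu k) (N + N) (wrd N) _ psi g K e1 (nu_lty k) _ (mwrd N) mS'
    (generalized_control_null cU (nu_gc k)) mpsi psiK _ (ltW e10).
  rewrite nuT /=; apply; first by move=> z; rewrite size_cat !size_word.
  move=> [t w] [/= tT Uw]; rewrite /g /wrd /= take_size_cat ?size_word// drop_size_cat ?size_word//.
  have [rT rd] := rtP t tT.
  have [c1 u1] : (cell (word N w) `&` U) (rep (word N w)).
    by apply: cell_repP; exists w; split => //; exact: cell_word.
  apply: hdl => //; apply: hN2; first exact: hM.
  by apply: (word_le NN2); move: c1; rewrite /cell /= size_word.
have E2 : `|\int[P]_z psi (map_graph X z) -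
    \sum_(h : (N + N).-tuple bool) g h * fine (P [set z | dwrd N z = h])| <= e1 * T.
  apply: (le_trans (@range_estimate _ _ R P (N + N) (dwrd N) _ (psi \o map_graph X) g K e1 P_lty _
    (mdwrd N) mS P_null _ _ _ (ltW e10))).
  - by move=> z; rewrite size_cat size_word size_dproc.
  - exact: measurableT_comp.
  - by move=> z; exact: psiK.
  - move=> [t x] [/= tT x01]; rewrite /g /dwrd /= take_size_cat ?size_word// drop_size_cat ?size_word//.
    have [rT rd] := rtP t tT.
    have [_ u1] := @repP N (t, x) x01.
    apply: hdl => //; first exact: XU.
    exact: (hN3 N (t, x)).
  - by rewrite le_eqVlt; apply/orP; left; apply/eqP; congr (_ * _); exact: (congr1 fine PT).
have cS : \sum_(h : (N + N).-tuple bool) g h * fine (nu k [set z | wrd N z = h]) @[k --> F] -->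
    \sum_(h : (N + N).-tuple bool) g h * fine (P [set z | dwrd N z = h]).
  apply: cvg_sumr => h; apply: cvgM; first exact: cvg_cst.
  by apply: law_cvg; rewrite size_tuple.
have e3 : 0 < e / 3 by rewrite divr_gt0.
have /cvgrPdist_le/(_ _ e3) := cS.
apply: filterS => k hk.
have E1' := E1 k; rewrite distrC in E1'.
by rewrite -e1T; exact: (ler_dist3 E2 hk E1').
Qed.

End control_compactness.

(** * Passing to the limit in the continuity equation *)

(** Because the local condition covers all smaller [d], it holds eventually as [d] tends to 0 from
    the right, which is the form to which near-covering compactness applies. *)
Lemma compact_delta {R : realType} {X : topologicalType} (K : set X) (P : R -> X -> Prop) :
  compact K ->
  (forall x, K x -> exists2 dl, 0 < dl & \forall y \near x, forall d, 0 < d -> d <= dl -> P d y) ->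
  exists2 d, 0 < d & forall x, K x -> P d x.
Proof.
move=> /compact_near_coveringP nc h.
have : \forall d \near (0 : R)^'+, K `<=` P d.
  apply: nc => x /h[dl dl0 hdl].
  exists ([set y | forall d, 0 < d -> d <= dl -> P d y], [set d | 0 < d /\ d < dl]).
    split => //=; near=> d; split; first by near: d; exact: nbhs_right_gt.
    by near: d; exact: nbhs_right_lt.
  by move=> [y d] /= [hy [d0 ddl]]; apply: hy => //; exact: ltW.
move=> [d /= d0 hd]; exists (d / 2); first by rewrite divr_gt0.
apply: hd => /=; rewrite ?divr_gt0//.
by rewrite sub0r normrN gtr0_norm ?divr_gt0// ltr_pdivrMr// ltr_pMr// ltr1n.
Unshelve. all: by end_near. Qed.

Lemma eps_continuous {R : realType} {V W : normedModType R} (f : V -> W) :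
  (forall x e, 0 < e -> exists2 d, 0 < d & forall y, `|y - x| <= d -> `|f y - f x| <= e) ->
  continuous f.
Proof.
move=> h x; apply/cvgrPdist_le => e e0; have [d d0 hd] := h x e e0.
near=> y; rewrite distrC; apply: hd; rewrite distrC.
by near: y; exact: cvgr_dist_le.
Unshelve. all: by end_near. Qed.

Lemma within_continuous_open {X : topologicalType} {R : realType} (S : set X) (f : X -> R)
    (V : set R) : {within S, continuous f} -> open V ->
  exists2 W, open W & S `&` f @^-1` V = S `&` W.
Proof.
move=> /subspace_continuousP cf oV.
exists ([set z | S z -> V (f z)]^°); first exact: open_interior.
apply/seteqP; split => z [Sz].
  move=> Vz; split => //; rewrite /interior /=.
  by apply: (cf z Sz); exact: open_nbhs_nbhs.
by move=> /nbhs_singleton /(_ Sz).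
Qed.

Section pair_continuity.
Context {R : realType} {V1 V2 : normedModType R}.
Implicit Types (S : set (V1 * V2)) (f : V1 -> V2 -> R).

Definition pcont S f := forall t0 w0, S (t0, w0) -> forall e, 0 < e -> exists2 d, 0 < d &
  forall t w, S (t, w) -> `|t - t0| <= d -> `|w - w0| <= d -> `|f t w - f t0 w0| <= e.

Lemma pcont_within S f : pcont S f -> {within S, continuous (fun z => f z.1 z.2)}.
Proof.
move=> pc; apply/subspace_continuousP => -[t0 w0] S0.
apply/cvgrPdist_le => e e0; have [d d0 hd] := pc t0 w0 S0 e e0.
rewrite near_withinE; exists (ball t0 d, ball w0 d); first by split; exact: nbhsx_ballx.
move=> [t w] /= [bt bw] Sz; rewrite distrC; apply: hd => //.
  by move: bt; rewrite -ball_normE /= distrC => /ltW.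
by move: bw; rewrite -ball_normE /= distrC => /ltW.
Qed.

Lemma pcont_unif S f : compact S -> pcont S f -> forall e, 0 < e -> exists2 d, 0 < d &
  forall t t' w w', S (t, w) -> S (t', w') -> `|t - t'| <= d -> `|w - w'| <= d ->
  `|f t w - f t' w'| <= e.
Proof.
move=> cS pc e e0.
have [||d d0 hd] := @compact_delta R _ S (fun d z => forall z', S z -> S z' ->
  `|z.1 - z'.1| <= d -> `|z.2 - z'.2| <= d -> `|f z.1 z.2 - f z'.1 z'.2| <= e).
- exact: cS.
- move=> [t0 w0] S0; have e2 : 0 < e / 2 by rewrite divr_gt0.
  have [d d0 hd] := pc t0 w0 S0 _ e2; have d2 : 0 < d / 2 by rewrite divr_gt0.
  exists (d / 2) => //.
  exists (ball t0 (d / 2), ball w0 (d / 2)); first by split; exact: nbhsx_ballx.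
  move=> [t w] /= []; rewrite -!ball_normE /= => bt bw d' d'0 d'd [t' w'] St St' /= tt ww.
  rewrite distrC in bt; rewrite distrC in bw.
  have d2d : d / 2 <= d by rewrite ler_pdivrMr// ler_pMr// ler1n.
  have h1 := hd t w St (le_trans (ltW bt) d2d) (le_trans (ltW bw) d2d).
  have tri (V : normedModType R) (a b c : V) : `|a - b| < d / 2 -> `|a - c| <= d' -> `|c - b| <= d.
    move=> ab ac; rewrite (_ : c - b = (a - b) - (a - c)); last by rewrite opprB [RHS]addrC addrA subrK.
    by rewrite (le_trans (ler_normB _ _))// [d]splitr lerD// ?(le_trans ac)// ltW.
  have h2 := hd t' w' St' (tri _ _ _ _ bt tt) (tri _ _ _ _ bw ww).
  rewrite (_ : _ - _ = (f t w - f t0 w0) - (f t' w' - f t0 w0)); last by ring.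
  by rewrite (le_trans (ler_normB _ _))// [e]splitr lerD.
- by exists d => // t t' w w' St St'; exact: (hd (t, w) St (t', w')).
Qed.

End pair_continuity.

Definition narrow_equicontinuous {R : realType} {n : nat} {I : Type} (T : R)
    (mu : I -> R -> probability (borelRn R n) R) :=
  forall (f : 'rV[R]_n -> R) (K e t0 : R), continuous f ->
  (forall x, `|f x| <= K) -> 0 < e -> t0 \in `[0, T] ->
  exists2 d, 0 < d & forall k t, t \in `[0, T] -> `|t - t0| <= d ->
    `|\int[mu k t]_x f x - \int[mu k t0]_x f x| <= e.

Lemma closed_setX {X Y : topologicalType} (A : set X) (B : set Y) :
  closed A -> closed B -> closed (A `*` B).
Proof.
move=> cA cB; rewrite (_ : A `*` B = ~` ((~` A) `*` setT `|` setT `*` (~` B))).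
  apply: open_closedC; apply: openU; apply: open_setX; rewrite ?openT//.
  - exact: closed_openC.
  - exact: openT.
  - exact: openT.
  - exact: closed_openC.
apply/seteqP; split => [[x y] [/= Ax By] [[/= nA _]|[/= _ nB]]//|[x y] /= h].
by split => /=; apply: contrapT => nh; apply: h; [left|right].
Qed.

(** * Integrals depending on time and control *)

Section parametric_integral.
Context {R : realType} {n m : nat} (T : R) (U : set 'rV[R]_m).
Hypotheses (U_compact : compact U).
Variables (Psi : R -> 'rV[R]_n -> 'rV[R]_m -> R) (M : R).

Definition jcont := forall t0 x0 w0, t0 \in `[0, T] -> U w0 -> forall e, 0 < e ->
  exists2 d, 0 < d & forall t x w, t \in `[0, T] -> U w ->
    `|t - t0| <= d -> `|x - x0| <= d -> `|w - w0| <= d -> `|Psi t x w - Psi t0 x0 w0| <= e.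

Hypotheses (jc : jcont) (supp : forall t x w, M < `|x| -> Psi t x w = 0).

Let S := `[0, T]%classic `*` U.

Let cS : compact S.
Proof. by apply: compact_setX => //; exact: segment_compact. Qed.

(** Compactness of the ball of radius [M] makes the estimate uniform in [x] there, and outside the
    ball both values are 0. *)
Lemma tube t0 w0 e : t0 \in `[0, T] -> U w0 -> 0 < e -> exists2 d, 0 < d &
  forall t x w, t \in `[0, T] -> U w -> `|t - t0| <= d -> `|w - w0| <= d ->
    `|Psi t x w - Psi t0 x w0| <= e.
Proof.
move=> t0T U0 e0.
have [|d d0 hd] := @compact_delta R _ _ (fun d x => forall t w, t \in `[0, T] -> U w ->
  `|t - t0| <= d -> `|w - w0| <= d -> `|Psi t x w - Psi t0 x w0| <= e) (@compact_ball R n M).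
- move=> x0 _; have e2 : 0 < e / 2 by rewrite divr_gt0.
  have [d d0 hd] := jc x0 t0T U0 e2; exists d => //.
  apply/nbhs_ballP; exists d => //= x; rewrite -ball_normE /= distrC => xx0 d' d'0 d'd t w tT Uw tt ww.
  have h1 := hd t x w tT Uw (le_trans tt d'd) (ltW xx0) (le_trans ww d'd).
  have h2 : `|Psi t0 x w0 - Psi t0 x0 w0| <= e / 2.
    by apply: hd => //; rewrite ?subrr ?normr0 ?ltW.
  rewrite (_ : _ - _ = (Psi t x w - Psi t0 x0 w0) - (Psi t0 x w0 - Psi t0 x0 w0)); last by ring.
  by rewrite (le_trans (ler_normB _ _))// [e]splitr lerD.
- exists d => // t x w tT Uw tt ww; have [xM|xM] := leP `|x| M.
    by apply: hd => //; rewrite /closed_ball_/= sub0r normrN.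
  by rewrite !supp// subrr normr0 ltW.
Qed.

Lemma param_continuous t w : t \in `[0, T] -> U w -> continuous (fun x => Psi t x w).
Proof.
move=> tT Uw; apply: eps_continuous => x0 e e0.
have [d d0 hd] := jc x0 tT Uw e0; exists d => // x xx0.
by apply: hd => //; rewrite subrr normr0 ltW.
Qed.

Lemma param_bounded : exists K, forall t x w, t \in `[0, T] -> U w -> `|Psi t x w| <= K.
Proof.
(* [compact_delta] yields a small number whereas a large bound is wanted; the bound is therefore
   written as an inverse. *)
have [||d d0 hd] := @compact_delta R _ S (fun d z => z.1 \in `[0, T] -> U z.2 ->
  forall x, `|Psi z.1 x z.2| <= d^-1).
- exact: cS.
- move=> [t0 w0] [/= t0T U0].
  have sx x : Psi t0 x w0 != 0 -> `|x| <= M.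
    by apply: contra_neqT; rewrite -ltNge; exact: supp.
  have [K hK] := compact_supp_bounded (param_continuous t0T U0) sx.
  have K0 : 0 <= K by apply: le_trans (hK 0); exact: normr_ge0.
  have [d d0 hd] := tube t0T U0 ltr01.
  have K1 : 0 < K + 1 by rewrite ltr_wpDl.
  exists (K + 1)^-1; first by rewrite invr_gt0.
  exists (ball t0 d, ball w0 d); first by split; exact: nbhsx_ballx.
  move=> [t w] /= []; rewrite -!ball_normE /= => bt bw d' d'0 d'd tT Uw x.
  rewrite distrC in bt; rewrite distrC in bw.
  have h := hd t x w tT Uw (ltW bt) (ltW bw).
  apply: (@le_trans _ _ (K + 1)); last by rewrite -[K + 1]invrK lef_pV2// posrE invr_gt0.
  rewrite (_ : Psi t x w = Psi t0 x w0 + (Psi t x w - Psi t0 x w0)); last by rewrite addrC subrK.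
  by rewrite (le_trans (ler_normD _ _))// lerD.
- by exists d^-1 => t x w tT Uw; exact: (hd (t, w)).
Qed.

Lemma narrow_equicontinuous_cst (mu0 : R -> probability (borelRn R n) R) : narrowly_continuous T mu0 ->
  narrow_equicontinuous T (fun _ : unit => mu0).
Proof.
move=> nc f K e t0 cf fK e0 t0T.
have /within_segmentP/(_ t0 t0T e e0)[d d0 hd] := nc f cf (ex_intro _ K fK).
exists (d / 2); first by rewrite divr_gt0.
move=> _ t tT tt; apply: hd => //; apply: (le_lt_trans tt).
by rewrite ltr_pdivrMr// ltr_pMr// ltr1n.
Qed.

Definition pint (P : R -> probability (borelRn R n) R) (t : R) (w : 'rV[R]_m) : R :=
  \int[P t]_x Psi t x w.

(** The integrand is first moved to [t0], [w0] uniformly in [x] by [tube]; then only the measure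
    varies, against a fixed bounded continuous function, and narrow equicontinuity applies. *)
Lemma pint_equicont {I : Type} (mu : I -> R -> probability (borelRn R n) R) t0 w0 e :
  narrow_equicontinuous T mu -> t0 \in `[0, T] -> U w0 -> 0 < e -> exists2 d, 0 < d &
  forall k t w, t \in `[0, T] -> U w -> `|t - t0| <= d -> `|w - w0| <= d ->
  `|pint (mu k) t w - pint (mu k) t0 w0| <= e.
Proof.
move=> mu_eq t0T U0 e0; have e2 : 0 < e / 2 by rewrite divr_gt0.
have [d1 d10 hd1] := tube t0T U0 e2.
have [K hK] := param_bounded.
have cP := param_continuous t0T U0.
have [d2 d20 hd2] := mu_eq _ K _ _ cP (fun x => hK t0 x w0 t0T U0) e2 t0T.
exists (Num.min d1 d2); first by rewrite lt_min d10.
move=> k t w tT Uw; rewrite !le_min => /andP[t1 t2] /andP[w1 w2].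
have h2 := hd2 k t tT t2.
have iF := probability_bounded_integrable (mu k t) (param_continuous tT Uw) (fun x => hK t x w tT Uw).
have ig := probability_bounded_integrable (mu k t) cP (fun x => hK t0 x w0 t0T U0).
have h1 : `|\int[mu k t]_x Psi t x w - \int[mu k t]_x Psi t0 x w0| <= e / 2.
  have := @Rintegral_dist_le _ _ _ (mu k t) set0 _ _ (e / 2) 0 0 measurable0 iF ig (lexx _).
  rewrite measure0 mul0r addr0; apply => // x; rewrite mul0r addr0; exact: hd1.
rewrite (_ : _ - _ = (\int[mu k t]_x Psi t x w - \int[mu k t]_x Psi t0 x w0) +
  (\int[mu k t]_x Psi t0 x w0 - \int[mu k t0]_x Psi t0 x w0)); last by rewrite /pint; ring.
by rewrite (le_trans (ler_normD _ _))// [e]splitr lerD.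
Qed.

Section family.
Context {I : Type} (mu : I -> R -> probability (borelRn R n) R).
Hypothesis mu_eq : narrow_equicontinuous T mu.

(** As in Ascoli's theorem, pointwise convergence together with equicontinuity in [t] and [w],
    uniform in [k], becomes uniform on the compact set [S]. *)
Lemma pint_unif_cvg (F : set_system I) (mu0 : R -> probability (borelRn R n) R) :
  ProperFilter F -> narrowly_continuous T mu0 ->
  (forall t (f : 'rV[R]_n -> R) (K : R), t \in `[0, T] -> continuous f ->
    (forall x, `|f x| <= K) -> \int[mu k t]_x f x @[k --> F] --> \int[mu0 t]_x f x) ->
  forall e, 0 < e -> \forall k \near F, forall t w, t \in `[0, T] -> U w ->
    `|pint (mu k) t w - pint mu0 t w| <= e.
Proof.
move=> FF nc cv e e0; have e3 : 0 < e / 3 by rewrite divr_gt0.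
have [K hK] := param_bounded.
have H : \forall k \near F, S `<=` (fun z => z.1 \in `[0, T] -> U z.2 ->
    `|pint (mu k) z.1 z.2 - pint mu0 z.1 z.2| <= e).
  apply: (compact_near_coveringP _).1 cS _ _ _ _ _ => -[t0 w0] [/= t0T U0].
  have [d1 d10 hd1] := pint_equicont mu_eq t0T U0 e3.
  have [d2 d20 hd2] := pint_equicont (narrow_equicontinuous_cst nc) t0T U0 e3.
  have cP := cv t0 _ K t0T (param_continuous t0T U0) (fun x => hK t0 x w0 t0T U0).
  have /cvgrPdist_le/(_ _ e3) c0 := cP.
  exists ((ball t0 d1 `&` ball t0 d2) `*` (ball w0 d1 `&` ball w0 d2),
    [set k | `|\int[mu0 t0]_x Psi t0 x w0 - \int[mu k t0]_x Psi t0 x w0| <= e / 3]).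
    split => //=; exists (ball t0 d1 `&` ball t0 d2, ball w0 d1 `&` ball w0 d2) => //=.
    by split; apply: filterI; exact: nbhsx_ballx.
  move=> [[t w] k] /= [[[]]]; rewrite -!ball_normE /= => t1 t2 [w1 w2] kk tT Uw.
  rewrite distrC in t1; rewrite distrC in t2; rewrite distrC in w1; rewrite distrC in w2.
  have h1 := hd1 k t w tT Uw (ltW t1) (ltW w1).
  have h2 := hd2 tt t w tT Uw (ltW t2) (ltW w2); rewrite distrC in h2.
  rewrite distrC in kk.
  by have := ler_dist3 h1 kk h2 => /le_trans; apply; rewrite le_eqVlt; apply/orP; left; apply/eqP; field.
by apply: filterS H => k hk t w tT Uw; exact: (hk (t, w)).
Qed.

End family.

Lemma pint_pcont (mu0 : R -> probability (borelRn R n) R) : narrowly_continuous T mu0 ->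
  pcont S (pint mu0).
Proof.
move=> nc t0 w0 [/= t0T U0] e e0.
have [d d0 hd] := pint_equicont (narrow_equicontinuous_cst nc) t0T U0 e0.
by exists d => // t w [/= tT Uw]; exact: (hd tt).
Qed.

Lemma pint_bounded : exists K, forall mu0 t w, t \in `[0, T] -> U w -> `|pint mu0 t w| <= K.
Proof.
have [K hK] := param_bounded; exists K => mu0 t w tT Uw.
have iF := probability_bounded_integrable (mu0 t) (param_continuous tT Uw) (fun x => hK t x w tT Uw).
have := @Rintegral_dist_le _ _ _ (mu0 t) set0 _ (cst 0) K 0 0 measurable0 iF _ (lexx _).
rewrite measure0 mul0r addr0 Rintegral_prob_cst subr0; apply => //.
  exact: prob_integrable_cst.
by move=> x; rewrite mul0r addr0 subr0; exact: hK.
Qed.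

End parametric_integral.

Lemma open_rV_prod_measurable {R : realType} {n m : nat} (W : set ('rV[R]_n * 'rV[R]_m)) :
  open W -> measurable (W : set (borelRn R n * borelRn R m)).
Proof.
move=> oW.
have -> : W = \bigcup_(c in [set c | qbox c.1 `*` qbox c.2 `<=` W]) (qbox c.1 `*` qbox c.2).
  apply/seteqP; split => [[x y] Wxy|z [c cW /cW]//].
  have : nbhs (x, y) W by exact: open_nbhs_nbhs.
  move=> [[A B] /= [xA yB] AB].
  have qb k (z : 'rV[R]_k) (V : set 'rV[R]_k) : nbhs z V -> exists2 c, qbox c z & qbox c `<=` V.
    rewrite nbhsE => -[V' [oV' V'z] V'V]; move: V'z; rewrite [V' in V' z](open_qbox oV').
    by move=> [c /= cV' cz]; exists c => // u /cV' /V'V.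
  have [c1 c1x c1A] := qb _ _ _ xA; have [c2 c2y c2B] := qb _ _ _ yB.
  exists (c1, c2) => //= -[x' y'] [/= /c1A Ax' /c2B By']; exact: AB.
rewrite bigcup_mkcond.
apply: countable_bigcupT_measurable => // c; case: ifPn => _ //.
by apply: measurableX; exact: qbox_measurable.
Qed.

Lemma RintegralE {d} {X : measurableType d} {R : realType} (mu : {measure set X -> \bar R})
    (D : set X) (f : X -> R) : measurable D -> mu.-integrable D (EFin \o f) ->
  (\int[mu]_(x in D) (f x)%:E)%E = (\int[mu]_(x in D) f x)%:E.
Proof. by move=> mD iF; rewrite /Rintegral fineK//; exact: integrable_fin_num. Qed.

Lemma pcont_measurable_time {R : realType} {m : nat} (S : set (R * 'rV[R]_m)) (f : R -> 'rV[R]_m -> R) :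
  closed S -> pcont S f -> measurable_fun (S : set (timeR R * borelRn R m)) (fun z => f z.1 z.2).
Proof.
move=> cS /pcont_within cf; have mS : measurable (S : set (timeR R * borelRn R m)).
  by rewrite -[S]setCK; apply: measurableC; apply: open_prod_measurable; exact: closed_openC.
apply: open_preimage_measurable_fun => V oV.
have [W oW ->] := within_continuous_open cf oV.
by apply: measurableI => //; exact: open_prod_measurable.
Qed.

Lemma pcont_measurable_space {R : realType} {n m : nat} (S : set ('rV[R]_n * 'rV[R]_m))
    (f : 'rV[R]_n -> 'rV[R]_m -> R) :
  closed S -> pcont S f -> measurable_fun (S : set (borelRn R n * borelRn R m)) (fun z => f z.1 z.2).
Proof.
move=> cS /pcont_within cf; have mS : measurable (S : set (borelRn R n * borelRn R m)).
  by rewrite -[S]setCK; apply: measurableC; apply: open_rV_prod_measurable; exact: closed_openC.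
apply: open_preimage_measurable_fun => V oV.
have [W oW ->] := within_continuous_open cf oV.
by apply: measurableI => //; exact: open_rV_prod_measurable.
Qed.

Section fubini_continuous.
Context {R : realType} {n m : nat} (U : set 'rV[R]_m) (f : 'rV[R]_n -> 'rV[R]_m -> R) (K : R).
Variables (P : probability (borelRn R n) R) (Q : probability (borelRn R m) R).
Hypotheses (cU : closed U) (cf : pcont (setT `*` U) f)
  (fK : forall x w, U w -> `|f x w| <= K).

Let g : borelRn R n * borelRn R m -> R := (fun z => f z.1 z.2) \_ (setT `*` U).

Let mU : measurable (U : set (borelRn R m)). Proof. exact: closed_measurable_rV. Qed.

Let gE x w : g (x, w) = \1_U w * f x w.
Proof.
rewrite /g patchE indicE; case: ifPn; rewrite ?inE ?notin_setE /=.
  by move=> [_ Uw]; rewrite mem_set// mul1r.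
by move=> h; rewrite memNset ?mul0r// => Uw; apply: h.
Qed.

Let mg : measurable_fun setT g.
Proof.
apply/(measurable_restrictT _ _).1; first exact: measurableX.
apply: pcont_measurable_space cf; apply: closed_setX => //; exact: closedT.
Qed.

Let gK z : `|g z| <= `|K|.
Proof.
case: z => x w; rewrite gE indicE; have [h|h] := boolP (w \in U); last by rewrite mul0r normr0.
by rewrite mul1r (le_trans (fK x _)) ?ler_norm//; move: h; rewrite inE.
Qed.

Let ig : (P \x Q)%E.-integrable setT (EFin \o g).
Proof.
have PQ : (P \x Q)%E (setT `*` setT) = (P setT * Q setT)%E by exact: product_measure1E.
apply: (bounded_integrable (M := `|K|)) => //.
apply: (@le_lt_trans _ _ 1%E); last by rewrite ltry.
rewrite -setXTT le_eqVlt; apply/orP; left; apply/eqP; apply: etrans PQ _.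
by rewrite !probability_setT mule1.
Qed.

Lemma measurable_pcont_section (x : 'rV[R]_n) :
  measurable_fun (U : set (borelRn R m)) (f x).
Proof.
have mgx : measurable_fun setT (fun w => g (x, w)).
  by apply: measurableT_comp mg _; exact: measurable_pair1.
apply: (eq_measurable_fun (fun w => g (x, w))); last exact: measurable_funTS.
by move=> w Uw; rewrite gE indicE Uw mul1r.
Qed.

Let E1 x : (\int[Q]_w (g (x, w))%:E)%E = (\int[Q]_(w in U) f x w)%:E.
Proof.
rewrite -RintegralE//; last first.
  apply: (bounded_integrable (M := K)) => //; last by move=> w; exact: fK.
    by apply: (le_lt_trans (probability_le1 _ _)) => //; rewrite ltry.
  exact: measurable_pcont_section.
rewrite [RHS]integral_mkcond; apply: eq_integral => w _.
by rewrite gE indicE patchE; case: ifP => _; rewrite ?mul1r ?mul0r.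
Qed.

Let E2 w : (\int[P]_x (g (x, w))%:E)%E = (\1_U w * \int[P]_x f x w)%:E.
Proof.
rewrite indicE; have [Uw|Uw] := boolP (w \in U); last first.
  by rewrite mul0r integral0_eq// => x _; rewrite gE indicE (negbTE Uw) mul0r.
rewrite mul1r -RintegralE//.
  by apply: eq_integral => x _; rewrite gE indicE Uw mul1r.
have mgw : measurable_fun setT (fun x => g (x, w)).
  by apply: measurableT_comp mg _; exact: measurable_pair2.
apply: (bounded_integrable (M := K)) => //.
- exact: prob_lty.
- by apply: eq_measurable_fun mgw => x _; rewrite gE indicE Uw mul1r.
- by move=> x _; apply: fK; rewrite inE in Uw.
Qed.

Lemma measurable_inner_integral :
  measurable_fun setT (fun x : borelRn R n => \int[Q]_(w in U) f x w).
Proof.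
apply/measurable_EFinP; rewrite (_ : _ \o _ = fubini_F Q (EFin \o g)).
  exact: measurable_fubini_F ig.
by apply/funext => x; rewrite /fubini_F /= E1.
Qed.

Lemma fubini_continuous :
  \int[P]_x \int[Q]_(w in U) f x w = \int[Q]_w (\1_U w * \int[P]_x f x w).
Proof.
rewrite /Rintegral -(eq_integral _ _ (fun x _ => E1 x)) -(eq_integral _ _ (fun w _ => E2 w)).
by congr fine; exact: (Fubini ig).
Qed.

End fubini_continuous.

Lemma bounded_Rintegral {d} {X : measurableType d} {R : realType} (P : probability X R)
    (D : set X) (f : X -> R) (K : R) : measurable D -> measurable_fun D f ->
  (forall x, D x -> `|f x| <= K) -> 0 <= K -> `|\int[P]_(x in D) f x| <= K.
Proof.
move=> mD mf fK K0.
have PD : (P D < +oo)%E by apply: (le_lt_trans (probability_le1 _ _)) => //; rewrite ltry.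
have iF : P.-integrable D (EFin \o f) by apply: (bounded_integrable (M := K)).
apply: (le_trans (le_normr_Rintegral _ _)) => //.
apply: (@le_trans _ _ (\int[P]_(x in D) cst K x)).
  apply: le_Rintegral => //; first exact/integrable_norm.
  by apply: (bounded_integrable (M := K)) => // x _ /=; rewrite ger0_norm.
rewrite Rintegral_cst// ler_piMr// -lee_fin fineK ?probability_le1//.
by rewrite ge0_fin_numE.
Qed.

Section kernel_probability.
Context {d d'} {X : measurableType d} {Y : measurableType d'} {R : realType}.

Variables (k : R.-pker X ~> Y) (x : X).

Definition kernel_at : set Y -> \bar R := k x.

HB.instance Definition _ := Measure.on kernel_at.

Let kernel_atT : kernel_at setT = 1%E. Proof. exact: prob_kernel. Qed.

HB.instance Definition _ := Measure_isProbability.Build _ _ _ kernel_at kernel_atT.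

Definition kernel_prob : probability Y R := kernel_at.

End kernel_probability.

(** * The weak equation as an integral against the control *)

Section lifted.
Context {R : realType} {n m : nat} (T : R) (U : set 'rV[R]_m).
Hypotheses (T0 : 0 < T) (U_compact : compact U) (U_nonempty : U !=set0).
Variables (a : R -> 'rV[R]_n -> R) (b : R -> 'rV[R]_n -> 'rV[R]_m -> R) (M : R).
Hypotheses (ca : jcont T U (fun t x _ => a t x)) (cb : jcont T U b)
  (sa : forall t x, M < `|x| -> a t x = 0) (sb : forall t x w, M < `|x| -> b t x w = 0).

Let S := `[0, T]%classic `*` U.

Let cU : closed U. Proof. by apply: compact_closed => //; exact: norm_hausdorff. Qed.

Let cS : closed S. Proof. by apply: closed_setX => //; exact: itv_closed. Qed.

Let kS : compact S.
Proof. by apply: compact_setX => //; exact: segment_compact. Qed.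

Let mS : measurable (S : set (timeR R * borelRn R m)).
Proof. by apply: measurableX; [exact: measurable_itv|exact: closed_measurable_rV]. Qed.

Let u0 : {u : 'rV[R]_m | U u}. Proof. exact: cid. Qed.

(* Integrating in x first turns the weak form of the continuity equation into
   the integral against nu of a function that is continuous on [0, T] x U. *)
Definition lifted (mu : R -> probability (borelRn R n) R) (z : timeR R * borelRn R m) : R :=
  if z.1 \in `[0, T] then \int[mu z.1]_x a z.1 x + \1_U z.2 * pint b mu z.1 z.2 else 0.

Lemma lifted_bounded : exists K, forall mu z, `|lifted mu z| <= K.
Proof.
have [Ka hKa] := pint_bounded U_compact ca (fun t x _ => @sa t x).
have [Kb hKb] := pint_bounded U_compact cb sb.
have [u Uu] := u0.
exists (`|Ka| + `|Kb|) => mu [t w]; rewrite /lifted /=; case: ifPn => tT; last by rewrite normr0 addr_ge0.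
apply: (le_trans (ler_normD _ _)); apply: lerD.
  by apply: le_trans (ler_norm _); exact: (hKa mu t u tT Uu).
rewrite indicE; have [Uw|Uw] := boolP (w \in U); last by rewrite mul0r normr0.
by rewrite mul1r; apply: le_trans (ler_norm _); apply: hKb => //; rewrite inE in Uw.
Qed.

Section one_solution.
Variable mu : R -> probability (borelRn R n) R.
Hypothesis nc : narrowly_continuous T mu.

Let pa : pcont S (pint (fun t x _ => a t x) mu).
Proof. exact: (pint_pcont U_compact ca (fun t x _ => @sa t x)). Qed.

Let pb : pcont S (pint b mu).
Proof. exact: (pint_pcont U_compact cb sb). Qed.

Let A t := \int[mu t]_x a t x.

Let mA : measurable_fun setT (A \_ `[0, T] : timeR R -> R).
Proof.
have [u Uu] := u0.
apply/(measurable_restrictT _ _).1; first exact: measurable_itv.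
apply: open_preimage_measurable_fun => V oV.
have cA : {within `[0, T]%classic, continuous A}.
  apply/within_segmentP => t0 t0T e e0.
  have [d d0 hd] := pa (t0 := t0) (w0 := u) (conj t0T Uu) e0.
  by exists d => // t tT tt; apply: (hd t u) => //; rewrite ?subrr ?normr0 ?ltW.
have [W oW ->] := within_continuous_open cA oV.
by apply: measurableI; [exact: measurable_itv|exact: open_measurable].
Qed.

Lemma measurable_lifted : measurable_fun setT (lifted mu).
Proof.
rewrite (_ : lifted mu = fun z => (A \_ `[0, T]) z.1 + ((fun z => pint b mu z.1 z.2) \_ S) z).
  apply: measurable_funD; first exact: measurableT_comp.
  apply/(measurable_restrictT _ _).1 => //.
  exact: pcont_measurable_time.
apply/funext => -[t w]; rewrite /lifted !patchE /=.
have [tT|tT] := boolP (t \in `[0, T]).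
  rewrite mem_set//; congr (_ + _); rewrite indicE; case: (boolP (w \in U)) => Uw.
    by rewrite mul1r mem_set//; split => //; rewrite inE in Uw.
  by rewrite mul0r memNset// => -[_ /= h]; move/negP : Uw; rewrite inE.
rewrite memNset; last exact/negP.
by rewrite memNset ?addr0// => -[/= h]; rewrite h in tT.
Qed.

Lemma lifted_unif e : 0 < e -> exists2 dl, 0 < dl & forall t t' (w w' : 'rV[R]_m),
  t \in `[0, T] -> t' \in `[0, T] -> U w -> U w' -> `|t - t'| <= dl -> `|w - w'| <= dl ->
  `|lifted mu (t, w) - lifted mu (t', w')| <= e.
Proof.
move=> e0; have e2 : 0 < e / 2 by rewrite divr_gt0.
have [d1 d10 hd1] := pcont_unif kS pa e2; have [d2 d20 hd2] := pcont_unif kS pb e2.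
exists (Num.min d1 d2); first by rewrite lt_min d10.
move=> t t' w w' tT tT' Uw Uw'; rewrite !le_min => /andP[t1 t2] /andP[w1 w2].
rewrite /lifted /= tT tT' !indicE !mem_set// !mul1r opprD addrACA.
rewrite (le_trans (ler_normD _ _))// [e]splitr lerD//.
  exact: (hd1 t t' w w').
exact: (hd2 t t' w w').
Qed.

(** For each [t], Fubini exchanges [mu t] and [nu_ t]; the term [a] is unchanged because [nu_ t] has
    mass 1. What remains is the disintegration formula for [lifted mu], which is bounded and
    measurable on the whole product. *)
Lemma lift_identity (nu : {measure set (timeR R * borelRn R m) -> \bar R})
    (nu_ : R.-pker (timeR R) ~> (borelRn R m)) :
  generalized_control T U nu -> disintegration T nu nu_ ->
  \int[lebesgue_measure]_(t in `[0, T])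
    \int[mu t]_x (a t x + \int[nu_ t]_(w in U) b t x w) = \int[nu]_z lifted mu z.
Proof.
move=> gc dis; have [K hK] := lifted_bounded.
have K0 : 0 <= K by apply: le_trans (hK mu (0, 0)); exact: normr_ge0.
have ml := measurable_lifted.
have nuT : (nu setT < +oo)%E by rewrite -setXTT (generalized_control_marginal gc)// segm_lty.
have il : nu.-integrable setT (EFin \o lifted mu) by apply: (bounded_integrable (M := K)).
rewrite {1}/Rintegral [RHS]/Rintegral (dis _ il); congr fine.
apply: eq_integral => t; rewrite inE => tT.
have [Ka hKa] := param_bounded U_compact ca (fun t x _ => @sa t x).
have [Kb hKb] := param_bounded U_compact cb sb.
have [u Uu] := u0.
have Kb0 : 0 <= Kb by apply: le_trans (hKb t 0 u tT Uu); exact: normr_ge0.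
have mlt : measurable_fun setT (fun w => lifted mu (t, w)).
  by apply: measurableT_comp ml _; exact: measurable_pair1.
have cbt : pcont (setT `*` U) (b t).
  move=> x0 w0 [_ /= Uw0] e e0; have [d d0 hd] := cb x0 tT Uw0 e0.
  by exists d => // x w [_ Uw] xx ww; apply: hd => //; rewrite subrr normr0 ltW.
have fub := fubini_continuous (mu t) (kernel_prob nu_ t) cU cbt (fun x w Uw => hKb t x w tT Uw).
have mi := measurable_inner_integral (mu t) (kernel_prob nu_ t) cU cbt (fun x w Uw => hKb t x w tT Uw).
have iA : (mu t).-integrable setT (EFin \o a t).
  apply: (@probability_bounded_integrable _ _ _ _ Ka); first exact: (param_continuous ca tT Uu).
  by move=> x; exact: (hKa t x u).
have iB : (mu t).-integrable setT (EFin \o (fun x => \int[nu_ t]_(w in U) b t x w)).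
  apply: (bounded_integrable (M := Kb)) => //; first exact: prob_lty.
  move=> x _; apply: (bounded_Rintegral (kernel_prob nu_ t)) => //.
  - exact: closed_measurable_rV.
  - exact: measurable_pcont_section cU cbt x.
  - by move=> w Uw; exact: hKb.
rewrite RintegralD// [in LHS]fub.
have itv w : lifted mu (t, w) = A t + \1_U w * pint b mu t w by rewrite /lifted /= tT.
have iw : (kernel_prob nu_ t).-integrable setT (EFin \o (fun w => lifted mu (t, w))).
  by apply: (bounded_integrable (M := K)) => //; exact: prob_lty.
rewrite [RHS](RintegralE measurableT iw); congr EFin.
have iL : (kernel_prob nu_ t).-integrable setT (EFin \o (fun w => \1_U w * pint b mu t w)).
  rewrite (_ : (fun w => _) = (fun w => lifted mu (t, w) - A t)).
    by apply: integrable_subr => //; exact: prob_integrable_cst.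
  by apply/funext => w; rewrite itv addrC addKr.
under [RHS]eq_Rintegral do rewrite itv.
rewrite RintegralD//; last exact: prob_integrable_cst.
by rewrite Rintegral_prob_cst.
Qed.

End one_solution.

(** Measure and integrand both vary with [k]. The integrand converges uniformly on [S], which the
    total mass [T] of [nu k] turns into convergence of integrals; the measure is then tested on the
    fixed function [lifted mu0]. *)
Lemma lifted_limit (mu : nat -> R -> probability (borelRn R n) R)
    (mu0 : R -> probability (borelRn R n) R)
    (nu : nat -> {measure set (timeR R * borelRn R m) -> \bar R})
    (nu0 : {measure set (timeR R * borelRn R m) -> \bar R}) (F : set_system nat) :
  ProperFilter F ->
  narrow_equicontinuous T mu -> (forall k, narrowly_continuous T (mu k)) ->
  narrowly_continuous T mu0 ->
  (forall t (f : 'rV[R]_n -> R) (K : R), t \in `[0, T] -> continuous f ->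
    (forall x, `|f x| <= K) -> \int[mu k t]_x f x @[k --> F] --> \int[mu0 t]_x f x) ->
  (forall k, generalized_control T U (nu k)) ->
  (forall (psi : timeR R * borelRn R m -> R) (K : R), measurable_fun setT psi ->
    (forall z, `|psi z| <= K) ->
    (forall e, 0 < e -> exists2 dl, 0 < dl & forall t t' (w w' : 'rV[R]_m),
      t \in `[0, T] -> t' \in `[0, T] -> U w -> U w' -> `|t - t'| <= dl -> `|w - w'| <= dl ->
      `|psi (t, w) - psi (t', w')| <= e) ->
    \int[nu k]_z psi z @[k --> F] --> \int[nu0]_z psi z) ->
  (forall k, \int[nu k]_z lifted (mu k) z = 0) -> \int[nu0]_z lifted mu0 z = 0.
Proof.
move=> FF eqc ncmu nc cv gc cnu zero.
have [K hK] := lifted_bounded.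
have c0 := cnu _ K (measurable_lifted nc) (hK mu0) (lifted_unif nc).
have nuT k : nu k setT = T%:E.
  by rewrite -setXTT (generalized_control_marginal (gc k))// segmE setTI lebesgue_measure_itv/= lte_fin T0 oppr0 adde0.
suff h e : 0 < e -> `|\int[nu0]_z lifted mu0 z| <= e.
  by apply/eqP; rewrite -normr_le0; apply/ler_addgt0Pr => e e0; rewrite add0r; exact: h.
move=> e0; have e2 : 0 < e / 2 by rewrite divr_gt0.
(* The terms in [a] and in [b] each vary by at most [d], so integrating [d + d] against mass [T]
   gives [e / 2]. *)
pose d := e / 2 / T / 2; have d0 : 0 < d by rewrite !divr_gt0.
have ua := pint_unif_cvg U_compact ca (fun t x _ => @sa t x) eqc FF nc cv d0.
have ub := pint_unif_cvg U_compact cb sb eqc FF nc cv d0.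
have /cvgrPdist_le/(_ _ e2) uc := c0.
have [k [hk1 hk2]] : exists k, `|\int[nu0]_z lifted mu0 z - \int[nu k]_z lifted mu0 z| <= e / 2 /\
    forall z, S z -> `|lifted (mu k) z - lifted mu0 z| <= d + d.
  apply: (@filter_ex _ F); near=> k; split; first by near: k.
  have h1 : forall t w, t \in `[0, T] -> U w ->
    `|pint (fun t x _ => a t x) (mu k) t w - pint (fun t x _ => a t x) mu0 t w| <= d by near: k.
  have h2 : forall t w, t \in `[0, T] -> U w -> `|pint b (mu k) t w - pint b mu0 t w| <= d by near: k.
  move=> [t w] [/= tT Uw]; rewrite /lifted /= tT indicE mem_set// !mul1r opprD addrACA.
  by rewrite (le_trans (ler_normD _ _))// lerD// ?h2//; exact: (h1 t w).
have il (nm : R -> probability (borelRn R n) R) : narrowly_continuous T nm ->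
    (nu k).-integrable setT (EFin \o lifted nm).
  move=> ncn; apply: (bounded_integrable (M := K)) => //; first by rewrite nuT ltry.
  exact: measurable_lifted.
have := @Rintegral_dist_null _ _ R (nu k) S (lifted (mu k)) (lifted mu0) (d + d)
  _ mS (generalized_control_null cU (gc k)) (il _ (ncmu k)) (il _ nc) hk2 (ltW (addr_gt0 d0 d0)).
rewrite nuT ltry zero sub0r normrN /= => /(_ isT) h.
rewrite (_ : \int[nu0]_z lifted mu0 z = (\int[nu0]_z lifted mu0 z - \int[nu k]_z lifted mu0 z) +
  \int[nu k]_z lifted mu0 z); last by rewrite subrK.
rewrite (le_trans (ler_normD _ _))// [leRHS]splitr lerD// (le_trans h)//.
by rewrite /d le_eqVlt; apply/orP; left; apply/eqP; field; rewrite gt_eqF.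
Unshelve. all: by end_near. Qed.

End lifted.

Lemma within_eps {R : realType} {n m : nat} {W : normedModType R} (T : R) (U : set 'rV[R]_m)
    (Psi : R -> 'rV[R]_n -> 'rV[R]_m -> W) :
  {within `[0, T] `*` setT `*` U, continuous (fun z : R * 'rV[R]_n * 'rV[R]_m => Psi z.1.1 z.1.2 z.2)} ->
  forall t0 x0 w0, t0 \in `[0, T] -> U w0 -> forall e, 0 < e ->
  exists2 d, 0 < d & forall t x w, t \in `[0, T] -> U w ->
    `|t - t0| <= d -> `|x - x0| <= d -> `|w - w0| <= d -> `|Psi t x w - Psi t0 x0 w0| <= e.
Proof.
move=> /subspace_continuousP cP t0 x0 w0 t0T U0 e e0.
have := cP (t0, x0, w0) (conj (conj t0T I) U0) => /cvgrPdist_le/(_ _ e0).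
rewrite near_withinE => /nbhs_ballP[d /= d0 hd].
exists (d / 2); first by rewrite divr_gt0.
have d2 : d / 2 < d by rewrite ltr_pdivrMr// ltr_pMr// ltr1n.
move=> t x w tT Uw tt xx ww; rewrite distrC; apply: (hd (t, x, w)) => //.
split; first split; rewrite -ball_normE /= distrC.
- exact: le_lt_trans tt d2.
- exact: le_lt_trans xx d2.
- exact: le_lt_trans ww d2.
Qed.

Section jcont_operations.
Context {R : realType} {n m : nat} (T : R) (U : set 'rV[R]_m).
Implicit Types f g : R -> 'rV[R]_n -> 'rV[R]_m -> R.

Lemma jcont_cst c : jcont T U (fun (t : R) (x : 'rV[R]_n) w => c).
Proof. by move=> t0 x0 w0 _ _ e e0; exists 1 => // *; rewrite subrr normr0 ltW. Qed.

Lemma jcontD f g : jcont T U f -> jcont T U g -> jcont T U (fun t x w => f t x w + g t x w).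
Proof.
move=> cf cg t0 x0 w0 t0T U0 e e0; have e2 : 0 < e / 2 by rewrite divr_gt0.
have [d1 d10 h1] := cf t0 x0 w0 t0T U0 _ e2; have [d2 d20 h2] := cg t0 x0 w0 t0T U0 _ e2.
exists (Num.min d1 d2); first by rewrite lt_min d10.
move=> t x w tT Uw; rewrite !le_min => /andP[t1 t2] /andP[x1 x2] /andP[w1 w2].
rewrite opprD addrACA (le_trans (ler_normD _ _))// [e]splitr lerD//.
  exact: h1.
exact: h2.
Qed.

Lemma jcontM f g : jcont T U f -> jcont T U g -> jcont T U (fun t x w => f t x w * g t x w).
Proof.
move=> cf cg t0 x0 w0 t0T U0 e e0; have e2 : 0 < e / 2 by rewrite divr_gt0.
set f0 := f t0 x0 w0; set g0 := g t0 x0 w0.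
have ef : 0 < Num.min 1 (e / 2 / (`|g0| + 1)) by rewrite lt_min ltr01 divr_gt0// ltr_wpDl.
have eg : 0 < e / 2 / (`|f0| + 1) by rewrite divr_gt0// ltr_wpDl.
have [d1 d10 h1] := cf t0 x0 w0 t0T U0 _ ef; have [d2 d20 h2] := cg t0 x0 w0 t0T U0 _ eg.
exists (Num.min d1 d2); first by rewrite lt_min d10.
move=> t x w tT Uw; rewrite !le_min => /andP[t1 t2] /andP[x1 x2] /andP[w1 w2].
have {h1} := h1 t x w tT Uw t1 x1 w1; rewrite le_min => /andP[hf1 hf].
have hg := h2 t x w tT Uw t2 x2 w2; rewrite -/f0 -/g0 in hf1 hf hg *.
set f1 := f t x w in hf1 hf *; set g1 := g t x w in hg *.
have f1b : `|f1| <= `|f0| + 1.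
  by rewrite (_ : f1 = f0 + (f1 - f0)) ?(le_trans (ler_normD _ _)) ?lerD2l// addrC subrK.
rewrite (_ : _ - _ = f1 * (g1 - g0) + (f1 - f0) * g0); last by ring.
rewrite (le_trans (ler_normD _ _))// [e]splitr lerD// normrM.
  apply: (le_trans (ler_pM _ _ f1b hg)) => //.
  by rewrite mulrC divfK// gt_eqF// ltr_wpDl.
apply: (@le_trans _ _ (`|f1 - f0| * (`|g0| + 1))); first by rewrite ler_wpM2l// lerDl.
by rewrite -ler_pdivlMr// ltr_wpDl.
Qed.

Lemma jcont_sum (I : Type) (r : seq I) (f : I -> R -> 'rV[R]_n -> 'rV[R]_m -> R) :
  (forall i, jcont T U (f i)) -> jcont T U (fun t x w => \sum_(i <- r) f i t x w).
Proof.
move=> cf; elim: r => [|i r ih].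
  rewrite (_ : (fun t x w => _) = (fun _ _ _ => 0)); first exact: jcont_cst.
  by apply/funext => t; apply/funext => x; apply/funext => w; rewrite big_nil.
rewrite (_ : (fun t x w => _) = (fun t x w => f i t x w + \sum_(j <- r) f j t x w)).
  exact: jcontD.
by apply/funext => t; apply/funext => x; apply/funext => w; rewrite big_cons.
Qed.

Lemma jcont_continuous (f : R * 'rV[R]_n -> R) : continuous f ->
  jcont T U (fun t x _ => f (t, x)).
Proof.
move=> cf t0 x0 w0 _ _ e e0.
have /cvgrPdist_le/(_ _ e0) /nbhs_ballP[d /= d0 hd] := cf (t0, x0).
exists (d / 2); first by rewrite divr_gt0.
have d2 : d / 2 < d by rewrite ltr_pdivrMr// ltr_pMr// ltr1n.
move=> t x w _ _ tt xx _; rewrite distrC; apply: (hd (t, x)).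
split; rewrite -ball_normE /= distrC.
- exact: le_lt_trans tt d2.
- exact: le_lt_trans xx d2.
Qed.

End jcont_operations.

Section test_function_facts.
Context {R : realType} {n : nat} (T : R) (phi : R * 'rV[R]_n -> R).
Hypothesis tphi : test_function T phi.

Lemma test_function_supp : exists M, forall t x, phi (t, x) != 0 -> `|x| <= M.
Proof.
have [_ /compact_bounded[M [_ hM]] _] := tphi.
exists (M + 1) => t x ptx.
have := hM (M + 1); rewrite ltrDl ltr01 => /(_ isT (t, x)) h.
have : `|(t, x)| <= M + 1 by apply: h; exact: subset_closure.
by apply: le_trans; rewrite [leRHS]prod_normE /= le_max lexx orbT.
Qed.

Lemma test_function_deriv0 : exists M, forall t x e, M < `|x| -> 'D_e phi (t, x) = 0.
Proof.
have [M hM] := test_function_supp; exists M => t x e Mx.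
apply: derive_near0.
have oM : open ([set: R] `*` [set y : 'rV[R]_n | M < `|y|]).
  apply: open_setX; first exact: openT.
  rewrite (_ : [set _ | _] = (fun y : 'rV[R]_n => `|y|) @^-1` [set r : R | M < r])//.
  by apply: open_comp; [move=> y _; exact: norm_continuous|exact: open_gt].
have : nbhs (t, x) ([set: R] `*` [set y : 'rV[R]_n | M < `|y|]) by exact: open_nbhs_nbhs.
by apply: filterS => -[s y] [_ /= yM]; apply/eqP; apply: contraTT yM => /hM; rewrite -leNgt.
Qed.

Lemma test_function_deriv_continuous e : continuous ('D_e phi).
Proof. by have [/(_ [:: e])[]] := tphi. Qed.

End test_function_facts.

Lemma Rintegral_sum {d} {X : measurableType d} {R : realType} (mu : {measure set X -> \bar R})
    (D : set X) (I : Type) (r : seq I) (f : I -> X -> R) : measurable D ->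
  (forall i, mu.-integrable D (EFin \o f i)) ->
  mu.-integrable D (EFin \o (fun x => \sum_(i <- r) f i x)) /\
  \int[mu]_(x in D) (\sum_(i <- r) f i x) = \sum_(i <- r) \int[mu]_(x in D) f i x.
Proof.
move=> mD iF; elim: r => [|i r [ir ih]].
  rewrite big_nil; under eq_fun do rewrite big_nil.
  split; first exact: integrable0.
  by rewrite Rintegral_cst// mul0r.
have E : (fun x => \sum_(j <- i :: r) f j x) = (fun x => f i x + \sum_(j <- r) f j x).
  by apply/funext => x; rewrite big_cons.
rewrite E; split; first exact: integrable_addr.
by rewrite RintegralD// ih big_cons.
Qed.

(** * Trajectories of controlled fields *)

Section controlled_field.
Context {R : realType} {n m : nat} (T : R) (U : set 'rV[R]_m)
  (v : R -> 'rV[R]_n -> 'rV[R]_m -> 'rV[R]_n) (C : R).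
Hypotheses (T0 : 0 < T) (U_compact : compact U) (U_nonempty : U !=set0) (C0 : 0 < C).
Hypothesis v_continuous : {within `[0, T] `*` setT `*` U,
  continuous (fun z : R * 'rV[R]_n * 'rV[R]_m => v z.1.1 z.1.2 z.2)}.
Hypothesis v_growth : forall t u x, t \in `[0, T] -> U u ->
  enorm (v t x u) <= C * (1 + enorm x).

Let cU : closed U. Proof. by apply: compact_closed => //; exact: norm_hausdorff. Qed.

(** Expresses the growth bound in the sup norm: [enorm x] is at most [n%:R * |x|], and
    [1 + n%:R * |x|] is at most [n.+1%:R * (1 + |x|)]. *)
Let growth : R := C * n.+1%:R.

Lemma growth_gt0 : 0 < growth. Proof. by rewrite mulr_gt0. Qed.

Lemma v_coord_le t x w i : t \in `[0, T] -> U w -> `|v t x w ord0 i| <= growth * (1 + `|x|).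
Proof.
move=> tT Uw; apply: (le_trans (coord_le_enorm _ _)); apply: (le_trans (v_growth _ tT Uw)).
rewrite /growth -mulrA ler_wpM2l ?(ltW C0)//.
apply: (@le_trans _ _ (1 + n%:R * `|x|)); first by rewrite lerD2l enorm_le_norm.
by rewrite mulrDr mulr1 lerD// ?ler1n// ler_wpM2r// ler_nat.
Qed.

Lemma v_coord_jcont i : jcont T U (fun t x w => v t x w ord0 i).
Proof.
move=> t0 x0 w0 t0T U0 e e0; have [d d0 hd] := within_eps v_continuous x0 t0T U0 e0.
exists d => // t x w tT Uw tt xx ww.
have -> : v t x w ord0 i - v t0 x0 w0 ord0 i = (v t x w - v t0 x0 w0) ord0 i by rewrite !mxE.
by apply: (le_trans (coord_le_norm _ _)); exact: hd.
Qed.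

Lemma measurable_v_section t x i : t \in `[0, T] ->
  measurable_fun (U : set (borelRn R m)) (fun w => v t x w ord0 i).
Proof.
move=> tT.
apply: (measurable_pcont_section (f := fun y w => v t y w ord0 i) cU).
move=> x0 w0 [_ /= U0] e e0.
have [d d0 hd] := @v_coord_jcont i t x0 w0 tT U0 e e0.
by exists d => // y w [_ Uw] xx ww; apply: hd => //; rewrite subrr normr0 ltW.
Qed.

Lemma averaged_field_le (nu_ : R.-pker (timeR R) ~> (borelRn R m)) t x i : t \in `[0, T] ->
  `|averaged_field U v nu_ t x ord0 i| <= growth * (1 + `|x|).
Proof.
move=> tT; rewrite mxE; apply: (bounded_Rintegral (kernel_prob nu_ t)).
- exact: closed_measurable_rV.
- exact: measurable_v_section.
- by move=> w Uw; exact: v_coord_le.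
- by rewrite mulr_ge0 ?addr_ge0// ltW// growth_gt0.
Qed.

Lemma dotv_averaged (nu_ : R.-pker (timeR R) ~> (borelRn R m)) t x y : t \in `[0, T] ->
  \int[nu_ t]_(w in U) dotv (v t x w) y = dotv (averaged_field U v nu_ t x) y.
Proof.
move=> tT; rewrite /dotv.
have mU : measurable (U : set (borelRn R m)) by exact: closed_measurable_rV.
have PU : (kernel_prob nu_ t U < +oo)%E.
  by apply: (le_lt_trans (probability_le1 _ _)) => //; rewrite ltry.
have iv i : (kernel_prob nu_ t).-integrable U (EFin \o (fun w => v t x w ord0 i)).
  apply: (bounded_integrable (M := growth * (1 + `|x|))) => //; first exact: measurable_v_section.
  by move=> w Uw; exact: v_coord_le.
have ivy i : (kernel_prob nu_ t).-integrable U (EFin \o (fun w => y ord0 i * v t x w ord0 i)).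
  exact: integrable_scaler.
have [_ E] := Rintegral_sum (index_enum 'I_n) mU ivy.
under eq_Rintegral do under eq_bigr do rewrite mulrC.
rewrite [LHS]E; apply: eq_bigr => i _.
by rewrite RintegralZl// mxE mulrC.
Qed.

Section test.
Variables (phi : R * 'rV[R]_n -> R).
Hypothesis tphi : test_function T phi.

Let a := time_deriv phi.
Let b t x w := dotv (v t x w) (space_grad phi t x).

Lemma jcont_time_deriv : jcont T U (fun t x _ => a t x).
Proof.
apply: (@jcont_continuous _ _ _ _ _ ('D_(1, 0) phi)).
exact: (@test_function_deriv_continuous _ _ _ _ tphi).
Qed.

Lemma jcont_transport : jcont T U b.
Proof.
apply: jcont_sum => i; apply: jcontM; first exact: v_coord_jcont.
rewrite (_ : (fun t x w => _) = (fun t x _ => 'D_(0, delta_mx ord0 i) phi (t, x))).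
  apply: (@jcont_continuous _ _ _ _ _ ('D_(0, delta_mx ord0 i) phi)).
  exact: (@test_function_deriv_continuous _ _ _ _ tphi).
by apply/funext => t; apply/funext => x; apply/funext => w; rewrite mxE.
Qed.

Lemma transport_supp : exists M, (forall t x, M < `|x| -> a t x = 0) /\
  (forall t x w, M < `|x| -> b t x w = 0).
Proof.
have [M hM] := test_function_deriv0 tphi; exists M; split => t x; first exact: hM.
by move=> w Mx; apply: big1 => i _; rewrite mxE hM// mulr0.
Qed.

Lemma continuity_equation_lifted (mu : R -> probability (borelRn R n) R)
    (nu : {measure set (timeR R * borelRn R m) -> \bar R})
    (nu_ : R.-pker (timeR R) ~> (borelRn R m)) :
  narrowly_continuous T mu -> generalized_control T U nu -> disintegration T nu nu_ ->
  \int[lebesgue_measure]_(t in `[0, T])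
    \int[mu t]_x (time_deriv phi t x + dotv (averaged_field U v nu_ t x) (space_grad phi t x)) =
  \int[nu]_z lifted T U a b mu z.
Proof.
move=> nc gc dis; have [M [sa sb]] := transport_supp.
rewrite -(lift_identity U_compact U_nonempty jcont_time_deriv jcont_transport sa sb nc gc dis).
apply: eq_Rintegral => t; rewrite inE => tT; apply: eq_Rintegral => x _.
by congr (_ + _); rewrite /b dotv_averaged.
Qed.

End test.

Theorem continuity_equation_limit (mu : nat -> R -> probability (borelRn R n) R)
    (mu0 : R -> probability (borelRn R n) R)
    (nu : nat -> {measure set (timeR R * borelRn R m) -> \bar R})
    (nuk : nat -> R.-pker (timeR R) ~> (borelRn R m))
    (nu0 : {measure set (timeR R * borelRn R m) -> \bar R})
    (nuk0 : R.-pker (timeR R) ~> (borelRn R m)) (F : set_system nat) :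
  ProperFilter F ->
  narrow_equicontinuous T mu -> (forall k, narrowly_continuous T (mu k)) ->
  narrowly_continuous T mu0 ->
  (forall t (f : 'rV[R]_n -> R) (K : R), t \in `[0, T] -> continuous f ->
    (forall x, `|f x| <= K) -> \int[mu k t]_x f x @[k --> F] --> \int[mu0 t]_x f x) ->
  (forall k, generalized_control T U (nu k)) -> (forall k, disintegration T (nu k) (nuk k)) ->
  generalized_control T U nu0 -> disintegration T nu0 nuk0 ->
  (forall (psi : timeR R * borelRn R m -> R) (K : R), measurable_fun setT psi ->
    (forall z, `|psi z| <= K) ->
    (forall e, 0 < e -> exists2 dl, 0 < dl & forall t t' (w w' : 'rV[R]_m),
      t \in `[0, T] -> t' \in `[0, T] -> U w -> U w' -> `|t - t'| <= dl -> `|w - w'| <= dl ->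
      `|psi (t, w) - psi (t', w')| <= e) ->
    \int[nu k]_z psi z @[k --> F] --> \int[nu0]_z psi z) ->
  (forall k, continuity_equation T (averaged_field U v (nuk k)) (mu k)) ->
  continuity_equation T (averaged_field U v nuk0) mu0.
Proof.
move=> FF eqc ncmu nc cv gc dis gc0 dis0 cnu ce phi tphi.
have [M [sa sb]] := transport_supp tphi.
rewrite (continuity_equation_lifted tphi nc gc0 dis0).
apply: (lifted_limit T0 U_compact U_nonempty (jcont_time_deriv tphi) (jcont_transport tphi)
  sa sb FF eqc ncmu nc cv gc cnu) => k.
by rewrite -(continuity_equation_lifted tphi (ncmu k) (gc k) (dis k)) ce.
Qed.

(** The bound [averaged_field_le] is the same for all kernels, so [N] depends on [f] but not on the
    control. This is the source of all compactness for trajectories. *)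
Lemma trajectory_lip (mu : R -> probability (borelRn R n) R)
    (nu_ : R.-pker (timeR R) ~> (borelRn R m)) :
  narrowly_continuous T mu -> continuity_equation T (averaged_field U v nu_) mu ->
  forall (f : 'rV[R]_n -> R) (M N : R), smc f ->
  (forall x, f x != 0 -> `|x| <= M) ->
  (forall x, growth * ((1 + `|x|) * \sum_(i < n) `|grad f x ord0 i|) <= N) ->
  forall s t, s \in `[0, T] -> t \in `[0, T] ->
  `|\int[mu t]_x f x - \int[mu s]_x f x| <= N * `|t - s|.
Proof.
move=> nc ce f M N sf fM fN.
apply: (a_priori T0 nc ce sf fM) => r x rT; apply: le_trans (fN x).
rewrite mulrA mulr_sumr; apply: (le_trans (ler_norm_sum _ _ _)); apply: ler_sum => i _.
by rewrite normrM ler_wpM2r// averaged_field_le.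
Qed.

End controlled_field.

(** * Existence of a trajectory *)

Section directional_derivatives.
Context {R : realType} {V : normedModType R}.
Implicit Types (f : V -> R) (p d u v : V).

Lemma line_derive f p d (s : R) : derivable f (p + s *: d) d ->
  is_derive s (1 : R) (fun r : R => f (p + r *: d)) ('D_d f (p + s *: d)).
Proof.
move=> df; have E : (fun h : R => h^-1 *: (((fun r : R => f (p + r *: d)) \o shift s) (h *: (1 : R)) - f (p + s *: d))) =
    (fun h : R => h^-1 *: ((f \o shift (p + s *: d)) (h *: d) - f (p + s *: d))).
  apply/funext => h; congr (_ *: (f _ - _)).
  by rewrite /= [h *: 1]mulr1 scalerDl addrCA.
by split; rewrite /derivable/= /derive/= E.
Qed.

Lemma line_estimate f p d (s s' c eta : R) : s <= s' -> (forall z, derivable f z d) ->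
  (forall r, s <= r <= s' -> `|'D_d f (p + r *: d) - c| <= eta) ->
  `|f (p + s' *: d) - f (p + s *: d) - (s' - s) * c| <= eta * (s' - s).
Proof.
rewrite le_eqVlt => /predU1P[->|ss'] df hd; first by rewrite !subrr mul0r subrr mulr0 normr0.
have dq r : is_derive r (1 : R) (fun r : R => f (p + r *: d)) ('D_d f (p + r *: d)) by exact: line_derive.
have cq : {within `[s, s'], continuous (fun r : R => f (p + r *: d))}.
  apply: continuous_subspaceT => r; apply: differentiable_continuous.
  by apply/derivable1_diffP; have [] := dq r.
have [r /andP[sr rs'] ->] := MVT ss' (fun r _ => dq r) cq.
rewrite mulrC -mulrBr normrM [leRHS]mulrC (ger0_norm (ltW _)) ?subr_gt0//.
rewrite ler_wpM2l ?subr_ge0 ?(ltW ss')//.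
by apply: hd; rewrite !ltW.
Qed.

Lemma line_estimate0 f p d (s c eta : R) : (forall z, derivable f z d) ->
  (forall r, `|r| <= `|s| -> `|'D_d f (p + r *: d) - c| <= eta) ->
  `|f (p + s *: d) - f p - s * c| <= eta * `|s|.
Proof.
move=> df hd; have [s0|s0] := leP 0 s.
  have := @line_estimate f p d 0 s c eta s0 df; rewrite scale0r addr0 subr0 (ger0_norm s0); apply.
  by move=> r /andP[r0 rs]; apply: hd; rewrite !ger0_norm// (le_trans r0).
have := @line_estimate f p d s 0 c eta (ltW s0) df; rewrite scale0r addr0 sub0r (ltr0_norm s0) => h.
have -> : f (p + s *: d) - f p - s * c = - (f p - f (p + s *: d) - - s * c) by ring.
rewrite normrN.
apply: h => r /andP[sr r0]; apply: hd.
by rewrite (ler0_norm r0) (ltr0_norm s0) lerN2.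
Qed.

(** [smooth] speaks of each direction separately, so linearity in the direction has to be derived:
    move by [h *: u] first, then along [v], where the mean value theorem and the continuity of
    ['D_v f] apply. *)
Lemma derive_lin f u v c x : (forall z e, derivable f z e) -> continuous ('D_v f) ->
  'D_(u + c *: v) f x = 'D_u f x + c * 'D_v f x.
Proof.
move=> df cv.
have h1 : h^-1 *: ((f \o shift x) (h *: (u + c *: v)) - f x) @[h --> 0^'] --> 'D_(u + c *: v) f x.
  exact: df.
have h2 : h^-1 *: ((f \o shift x) (h *: u) - f x) @[h --> 0^'] --> 'D_u f x by exact: df.
have h3 : h^-1 *: ((f \o shift x) (h *: (u + c *: v)) - (f \o shift x) (h *: u)) @[h --> 0^']
    --> c * 'D_v f x.
  apply/cvgrPdist_le => e e0.
  have eta0 : 0 < e / (`|c| + 1) by rewrite divr_gt0// ltr_wpDl.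
  have /cvgrPdist_le/(_ _ eta0) /nbhs_ballP[r /= r0 hr] := cv x.
  have B0 : 0 < `|u| + `|c| * `|v| + 1 by rewrite ltr_wpDl// addr_ge0// mulr_ge0.
  exists (r / (`|u| + `|c| * `|v| + 1)) => /=; first by rewrite divr_gt0.
  move=> h /=; rewrite sub0r normrN => hr' h0.
  have hh : `|h| * (`|u| + `|c| * `|v|) < r.
    apply: (le_lt_trans (_ : _ <= `|h| * (`|u| + `|c| * `|v| + 1))); first by rewrite ler_wpM2l// lerDl.
    by rewrite -ltr_pdivlMr.
  have := @line_estimate0 f (x + h *: u) v (h * c) ('D_v f x) (e / (`|c| + 1)) (df ^~ v) _.
  set lhs := f _ - f _ - _ => hl.
  have E : c * 'D_v f x - h^-1 *: (f (h *: (u + c *: v) + x) - f (h *: u + x)) = - (h^-1 * lhs).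
    have -> : h *: (u + c *: v) + x = x + h *: u + (h * c) *: v by rewrite scalerDr scalerA addrC addrA.
    rewrite [h *: u + x]addrC /lhs; set A := f _; set B := f _.
    have -> : h^-1 *: (A - B) = h^-1 * (A - B) by [].
    by field.
  rewrite /= E normrN normrM normfV.
  have {}hl : `|lhs| <= e / (`|c| + 1) * `|h * c|.
    apply: hl => k kh; rewrite distrC; apply: hr; rewrite -ball_normE /=.
    rewrite opprD addrA opprD addrA subrr sub0r -opprD normrN; apply: le_lt_trans hh.
    rewrite (le_trans (ler_normD _ _))// !normrZ mulrDr lerD// mulrA ler_wpM2r//.
    by rewrite -normrM.
  rewrite ler_pdivrMl ?normr_gt0// (le_trans hl)// normrM mulrCA ler_wpM2l//.
  by rewrite -mulrA ler_piMr ?(ltW e0)// mulrC ler_pdivrMr ?ltr_wpDl// mul1r lerDl.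
apply: (cvg_unique _ h1) => //.
rewrite (_ : (fun h => _) = (fun h => h^-1 *: ((f \o shift x) (h *: u) - f x) +
  h^-1 *: ((f \o shift x) (h *: (u + c *: v)) - (f \o shift x) (h *: u)))).
  exact: cvgD h2 h3.
by apply/funext => h /=; rewrite -scalerDr; congr (_ *: _); rewrite [RHS]addrC addrA subrK.
Qed.

Lemma derive_lin_sum f u (I : Type) (r : seq I) (c : I -> R) (e : I -> V) x :
  (forall z d, derivable f z d) -> (forall d, continuous ('D_d f)) ->
  'D_(u + \sum_(i <- r) c i *: e i) f x = 'D_u f x + \sum_(i <- r) c i * 'D_(e i) f x.
Proof.
move=> df cf; elim: r u => [|i r ih] u; first by rewrite !big_nil !addr0.
by rewrite !big_cons addrA ih derive_lin// addrA.
Qed.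

End directional_derivatives.

(** Both the quantity inside the norm and the bound are additive over adjacent intervals, so an
    estimate within each grid interval extends to all intervals. *)
Lemma chain_estimate {R : realType} (J : R -> R) (h c eta : R) (K : nat) (a b : R) : 0 <= a ->
  b <= K%:R * h ->
  (forall (j : nat) s s', (j < K)%N -> a <= s -> s' <= b -> j%:R * h <= s -> s <= s' -> s' <= j.+1%:R * h ->
    `|J s' - J s - (s' - s) * c| <= eta * (s' - s)) ->
  forall t t', a <= t -> t <= t' -> t' <= b -> `|J t' - J t - (t' - t) * c| <= eta * (t' - t).
Proof.
move=> a0 bK hJ.
have H (j : nat) : (j <= K)%N -> forall t t', a <= t -> t <= t' -> t' <= b -> t' <= j%:R * h ->
    `|J t' - J t - (t' - t) * c| <= eta * (t' - t).
  elim: j => [|j ih] jK t t' at_ tt' t'b.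
    rewrite mul0r => t'0; have -> : t' = t.
      by apply/eqP; rewrite eq_le tt' andbT (le_trans t'0)// (le_trans a0).
    by rewrite !subrr mul0r subrr mulr0 normr0.
  move=> t'j; have [t'j'|jt'] := leP t' (j%:R * h); first by apply: ih => //; exact: ltnW.
  have [jt|tj] := leP (j%:R * h) t; first exact: (hJ j).
  have aj : a <= j%:R * h by rewrite (le_trans at_)// ltW.
  have jb : j%:R * h <= b by rewrite (le_trans _ t'b)// ltW.
  have e1 := ih (ltnW jK) t (j%:R * h) at_ (ltW tj) jb (lexx _).
  have e2 := hJ j (j%:R * h) t' jK aj t'b (lexx _) (ltW jt') t'j.
  rewrite (_ : J t' - J t - (t' - t) * c = (J t' - J (j%:R * h) - (t' - j%:R * h) * c) +
    (J (j%:R * h) - J t - (j%:R * h - t) * c)); last by ring.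
  by rewrite (le_trans (ler_normD _ _))// (le_trans (lerD e2 e1))// -mulrDr addrA subrK.
by move=> t t' at_ tt' t'b; apply: (H K) => //; exact: le_trans t'b bK.
Qed.

Lemma pair_addE {R : realType} {V : normedModType R} (a b : R) (x y : V) :
  (a, x) + (b, y) = (a + b, x + y).
Proof. by []. Qed.

Lemma pair_scaleE {R : realType} {V : normedModType R} (c a : R) (x : V) :
  c *: (a, x) = (c * a, c *: x).
Proof. by []. Qed.

Lemma continuous_axpy {R : realType} {X : topologicalType} {V : normedModType R} (f g : X -> V) (c : R) :
  continuous f -> continuous g -> continuous (fun x => f x + c *: g x).
Proof. by move=> cf cg x; apply: cvgD; [exact: cf|apply: cvgZl_tmp; exact: cg]. Qed.

Lemma continuous_comp_fun {X Y Z : topologicalType} (f : X -> Y) (g : Y -> Z) :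
  continuous f -> continuous g -> continuous (fun x => g (f x)).
Proof. by move=> cf cg x; apply: (@continuous_comp _ _ _ f g); [exact: cf|exact: cg]. Qed.

(** * Euler polygons *)

Section euler_polygon.
Context {R : realType} {n : nat} (w : R -> 'rV[R]_n -> 'rV[R]_n) (h : R).
Hypothesis h0 : 0 <= h.

(* The Euler scheme of step h, frozen after time j h. *)
Fixpoint polygon (j : nat) (t : R) (x : 'rV[R]_n) : 'rV[R]_n :=
  if j is i.+1 then
    polygon i t x +
      Num.max 0 (Num.min t (i.+1%:R * h) - i%:R * h) *: w (i%:R * h) (polygon i (i%:R * h) x)
  else x.

Let grid_le i j : (i <= j)%N -> i%:R * h <= j%:R * h.
Proof. by move=> ij; rewrite ler_wpM2r// ler_nat. Qed.

Lemma polygon_cst j t t' x : j%:R * h <= t -> j%:R * h <= t' -> polygon j t x = polygon j t' x.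
Proof.
elim: j t t' => [//|j ih] t t' jt jt' /=.
have jj : j%:R * h <= j.+1%:R * h by exact: grid_le.
by rewrite (ih t t') ?(le_trans jj)// !min_r.
Qed.

Lemma polygon_stable i j t x : (i <= j)%N -> t <= i%:R * h -> polygon j t x = polygon i t x.
Proof.
elim: j => [|j ih]; first by rewrite leqn0 => /eqP ->.
rewrite leq_eqVlt => /predU1P[-> //|]; rewrite ltnS => ij ti /=.
rewrite ih// max_l ?scale0r ?addr0// subr_le0 ge_min (le_trans ti)//.
exact: grid_le.
Qed.

Lemma polygon_piece K j t x : (j < K)%N -> j%:R * h <= t -> t <= j.+1%:R * h ->
  polygon K t x = polygon j (j%:R * h) x + (t - j%:R * h) *: w (j%:R * h) (polygon j (j%:R * h) x).
Proof.
move=> jK jt tj; rewrite (polygon_stable x jK tj) /= (polygon_cst x jt (lexx _)).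
by rewrite min_l// max_r// subr_ge0.
Qed.

Lemma polygon_grid K j x : (j <= K)%N -> polygon K (j%:R * h) x = polygon j (j%:R * h) x.
Proof. by move=> jK; exact: polygon_stable. Qed.

Lemma polygon_continuous j t : (forall i, (i < j)%N -> continuous (w (i%:R * h))) ->
  continuous (polygon j t).
Proof.
elim: j t => [|j ih] t cw; first by move=> x; exact: cvg_id.
have cj s : continuous (polygon j s) by apply: ih => i ij; apply: cw; exact: ltnW.
apply: continuous_axpy => //.
exact: (continuous_comp_fun (cj (j%:R * h)) (cw j (ltnSn j))).
Qed.

End euler_polygon.

Lemma derive_dir0 {R : realType} {V : normedModType R} (f : V -> R) x : 'D_0 f x = 0.
Proof.
rewrite /derive; apply: cvg_lim => //.
rewrite (_ : (fun h => _) = cst 0); first exact: cvg_cst.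
by apply/funext => h /=; rewrite scaler0 add0r subrr scaler0.
Qed.

Lemma derive_grad {R : realType} {n : nat} (f : 'rV[R]_n -> R) (y d : 'rV[R]_n) :
  (forall z e, derivable f z e) -> (forall e, continuous ('D_e f)) ->
  'D_d f y = \sum_(i < n) d ord0 i * grad f y ord0 i.
Proof.
move=> df cf; rewrite {1}(row_sum_delta d) -[X in 'D_X _ _]add0r derive_lin_sum// derive_dir0 add0r.
by apply: eq_bigr => i _; rewrite !mxE.
Qed.

Lemma derive_time_space {R : realType} {n : nat} (phi : R * 'rV[R]_n -> R) t (y d : 'rV[R]_n) :
  (forall z e, derivable phi z e) -> (forall e, continuous ('D_e phi)) ->
  'D_(1, d) phi (t, y) = time_deriv phi t y + dotv d (space_grad phi t y).
Proof.
move=> df cf; rewrite (_ : (1, d) = (1, 0) + \sum_(i < n) d ord0 i *: ((0, delta_mx ord0 i) : R * 'rV[R]_n)).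
  rewrite derive_lin_sum//; congr (_ + _).
  by rewrite /dotv; apply: eq_bigr => i _; rewrite mxE.
have -> : \sum_(i < n) d ord0 i *: ((0, delta_mx ord0 i) : R * 'rV[R]_n) = (0, d).
  rewrite {2}(row_sum_delta d); elim/big_ind2: _ => // [x1 x2 y1 y2 -> ->|i _].
    by rewrite pair_addE addr0.
  by rewrite pair_scaleE mulr0.
by rewrite pair_addE addr0 add0r.
Qed.

Section euler_estimates.
Context {R : realType} {n : nat} (T c h : R) (w : R -> 'rV[R]_n -> 'rV[R]_n).
Hypotheses (h0 : 0 < h) (c0 : 0 < c) (hc : h * c <= 1 / 2).
Hypothesis w_le : forall t x, t \in `[0, T] -> `|w t x| <= c * (1 + `|x|).

(** As [h * c <= 1 / 2], a step moves [x] by at most half of [1 + |x|]. The growth factor at the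
    start is therefore controlled by that at any point of the step. *)
Lemma euler_growth t x r : t \in `[0, T] -> 0 <= r -> r <= h ->
  1 + `|x| <= 2 * (1 + `|x + r *: w t x|).
Proof.
move=> tT r0 rh; set y := x + r *: w t x.
have h1 : `|r *: w t x| <= (1 + `|x|) / 2.
  rewrite normrZ ger0_norm//; apply: (le_trans (ler_pM _ _ rh (w_le x tT))) => //.
  by rewrite mulrA mulrC ler_wpM2l ?addr_ge0// -[leRHS]div1r.
have : `|x| <= `|y| + (1 + `|x|) / 2.
  rewrite (_ : x = y - r *: w t x); last by rewrite addrK.
  by rewrite (le_trans (ler_normB _ _))// lerD2l -/y addrK.
by move: (`|x|) (`|y|) => a b; lra.
Qed.

(** The velocity is frozen at [x] while the gradient is taken at a later point; passing from one to
    the other by [euler_growth] costs the factor 2 in front of [c]. *)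
Lemma euler_test (f : 'rV[R]_n -> R) (N : R) t x s s' : smc f ->
  (forall x, 2 * c * ((1 + `|x|) * \sum_(i < n) `|grad f x ord0 i|) <= N) ->
  t \in `[0, T] -> 0 <= s -> s <= s' -> s' <= h ->
  `|f (x + s' *: w t x) - f (x + s *: w t x)| <= N * (s' - s).
Proof.
move=> sf fN tT s0 ss' sh.
have [df cf] : (forall z e, derivable f z e) /\ (forall e, continuous ('D_e f)).
  have sm := smc_smooth sf; split => [z e|e]; first by have [_] := sm [::]; exact.
  by have [] := sm [:: e].
have := @line_estimate _ _ f x (w t x) s s' 0 N ss' (df ^~ _).
rewrite mulr0 subr0; apply => r /andP[sr rs]; rewrite subr0.
set y := x + r *: w t x.
rewrite derive_grad//; apply: le_trans (fN y).
apply: (le_trans (ler_norm_sum _ _ _)); rewrite mulrA mulr_sumr; apply: ler_sum => i _.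
rewrite normrM ler_wpM2r// (le_trans (coord_le_norm _ _))// (le_trans (w_le x tT))//.
rewrite [2 * c]mulrC -mulrA ler_wpM2l ?(ltW c0)//.
apply: euler_growth => //; first exact: le_trans s0 sr.
exact: le_trans rs sh.
Qed.

End euler_estimates.

Lemma min_delta {R : realType} {I : finType} (P : I -> R -> Prop) :
  (forall i d d', d' <= d -> P i d -> P i d') -> (forall i, exists2 d, 0 < d & P i d) ->
  exists2 d, 0 < d & forall i, P i d.
Proof.
move=> anti hP; have /choice[d hd] : forall i, exists d, 0 < d /\ P i d.
  by move=> i; have [d d0 Pd] := hP i; exists d.
exists (\big[Num.min/1]_i d i).
  by apply: lt_bigmin => // i _; have [] := hd i.
by move=> i; apply: anti (hd i).2; exact: bigmin_le_cond.
Qed.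

(** [None] stands for the time direction and [Some i] for the i-th space direction; the index type
    is finite, so [min_delta] gives one [dl] for all. *)
Lemma test_function_unif {R : realType} {n : nat} (T : R) (phi : R * 'rV[R]_n -> R) (rho e : R) :
  test_function T phi -> 0 < e -> exists2 dl, 0 < dl &
  forall (d : option 'I_n) t t' (x x' : 'rV[R]_n), t \in `[0, T] -> t' \in `[0, T] ->
    `|x| <= rho -> `|x'| <= rho -> `|t - t'| <= dl -> `|x - x'| <= dl ->
    let u := if d is Some i then (0, delta_mx ord0 i) else (1, 0) in
    `|'D_u phi (t, x) - 'D_u phi (t', x')| <= e.
Proof.
move=> tphi e0.
apply: min_delta => [d dl dl' le H t t' x x' tT tT' xr xr' tt xx|d].
  by apply: H => //; [exact: le_trans tt le|exact: le_trans xx le].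
set u := if d is Some i then _ else _.
have cS : compact (`[0, T]%classic `*` closed_ball_ (fun x : 'rV[R]_n => `|x|) 0 rho).
  by apply: compact_setX; [exact: segment_compact|exact: compact_ball].
have pc : pcont (`[0, T]%classic `*` closed_ball_ (fun x : 'rV[R]_n => `|x|) 0 rho)
    (fun t x => 'D_u phi (t, x)).
  move=> t0 x0 [/= t0T _] e' e'0.
  have cu := @test_function_deriv_continuous _ _ _ _ tphi u.
  have [d1 d10 hd] := @jcont_continuous R n n T setT ('D_u phi) cu t0 x0 0 t0T I e' e'0.
  exists d1 => // t x [/= tT _] tt xx; apply: (hd t x 0) => //.
  by rewrite subrr normr0 ltW.
have [dl dl0 hdl] := pcont_unif cS pc e0.
exists dl => // t t' x x' tT tT' xr xr' tt xx.
by apply: hdl => //; split => //=; rewrite /closed_ball_/= sub0r normrN.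
Qed.

(** The derivative of [phi] along the step is compared with its value at the start by uniform
    continuity of the partial derivatives. The estimate is uniform in [x] because a step that starts
    far away cannot reach the region where they are nonzero. *)
Lemma euler_transport {R : realType} {n : nat} (T c : R) (w : R -> 'rV[R]_n -> 'rV[R]_n)
    (phi : R * 'rV[R]_n -> R) (e : R) : 0 < c ->
  (forall t x, t \in `[0, T] -> `|w t x| <= c * (1 + `|x|)) -> test_function T phi -> 0 < e ->
  exists2 h0, 0 < h0 & forall h, 0 < h -> h <= h0 -> forall t x s s', t \in `[0, T] -> t + s' <= T ->
    0 <= s -> s <= s' -> s' <= h ->
    `|phi (t + s', x + s' *: w t x) - phi (t + s, x + s *: w t x) -
      (s' - s) * (time_deriv phi t x + dotv (w t x) (space_grad phi t x))| <= e * (s' - s).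
Proof.
move=> c0 w_le tphi e0; have [M0 hM0] := test_function_deriv0 tphi.
pose M := `|M0|.
have hM t x d : M < `|x| -> 'D_d phi (t, x) = 0.
  by move=> Mx; apply: hM0; exact: le_lt_trans (ler_norm _) Mx.
(* A relevant starting point has norm at most [2 * M + 1], where the velocity is at most [B]; a
   displacement of at most half of [1 + |x|] then stays within [rho]. *)
pose rho := 3 * M + 3; pose B := c * (2 * M + 2).
have M_ge0 : 0 <= M by exact: normr_ge0.
have B0 : 0 < B by rewrite mulr_gt0// ltr_wpDl// mulr_ge0.
have n0 : 0 < 1 + n%:R * B by rewrite ltr_pwDl// mulr_ge0// ltW.
have e1 : 0 < e / (1 + n%:R * B) by rewrite divr_gt0.
have [dl dl0 hdl] := @test_function_unif _ _ _ _ rho _ tphi e1.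
exists (Num.min (1 / 2 / c) (Num.min dl (dl / B))).
  by rewrite !lt_min dl0 (divr_gt0 dl0 B0) !divr_gt0.
move=> h h0; rewrite !le_min => /andP[hc /andP[hdl1 hdl2]] t x s s' tT tsT s0 ss' s'h.
have {}hc : h * c <= 1 / 2 by rewrite -ler_pdivlMr.
have [df cf] : (forall z e, derivable phi z e) /\ (forall e, continuous ('D_e phi)).
  have [sm _ _] := tphi; split => [z d|d]; first by have [_] := sm [::]; exact.
  by have [] := sm [:: d].
have := @line_estimate _ _ phi (t, x) (1, w t x) s s'
  (time_deriv phi t x + dotv (w t x) (space_grad phi t x)) e ss' (df ^~ _).
have lin r : (t, x) + r *: (1, w t x) = (t + r, x + r *: w t x).
  by rewrite pair_scaleE pair_addE mulr1.
rewrite !lin; apply => r /andP[sr rs']; rewrite lin derive_time_space//.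
have r0 : 0 <= r by exact: le_trans s0 sr.
have rh : r <= h by exact: le_trans rs' s'h.
have trT : t + r \in `[0, T].
  move: tT; rewrite !in_itv/= => /andP[t0 _]; rewrite addr_ge0//=.
  by rewrite (le_trans _ tsT)// lerD2l.
set y := x + r *: w t x.
have yx : 1 + `|x| <= 2 * (1 + `|y|) by apply: (@euler_growth _ _ T c h w).
(* By [yx], a start beyond [2 * M + 1] forces [y] beyond [M], so all derivatives vanish at both
   points. *)
have [xM|xM] := leP `|x| (2 * M + 1); last first.
  have yM : M < `|y| by move: xM yx; clear; lra.
  have xM' : M < `|x| by move: xM M_ge0; clear; lra.
  rewrite /time_deriv /dotv !hM// !big1 ?addr0 ?subr0 ?normr0 ?(ltW e0)// => i _.
    by rewrite mxE hM// mulr0.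
  by rewrite mxE hM// mulr0.
have wB : `|w t x| <= B.
  apply: (le_trans (w_le t x tT)); rewrite ler_wpM2l ?(ltW c0)//.
  by move: xM; clear; lra.
have xy : `|y - x| <= dl.
  rewrite /y addrC addKr normrZ ger0_norm//.
  apply: (le_trans (ler_pM _ _ rh wB)) => //.
  by rewrite -ler_pdivlMr.
have xr : `|x| <= rho by move: xM M_ge0; rewrite /rho; clear; lra.
have yr : `|y| <= rho.
  have : `|y| <= `|x| + 1 / 2 / c * (c * (1 + `|x|)).
    rewrite (le_trans (ler_normD _ _))// lerD2l normrZ ger0_norm// ler_pM// ?w_le//.
    by rewrite (le_trans rh)// ler_pdivlMr.
  rewrite mulrA divfK ?gt_eqF// /rho => /le_trans; apply.
  by move: xM M_ge0; clear; lra.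
have tr : `|t + r - t| <= dl by rewrite addrC addKr ger0_norm// (le_trans rh).
have h1 := hdl None (t + r) t y x trT tT yr xr tr xy.
have h2 i := hdl (Some i) (t + r) t y x trT tT yr xr tr xy.
rewrite /= in h1 h2.
rewrite opprD addrACA (le_trans (ler_normD _ _))//.
apply: (@le_trans _ _ (e / (1 + n%:R * B) + \sum_(i < n) B * (e / (1 + n%:R * B)))).
  rewrite lerD// /dotv -sumrB (le_trans (ler_norm_sum _ _ _))//; apply: ler_sum => i _.
  rewrite -mulrBr normrM ler_pM// ?(le_trans (coord_le_norm _ _))//.
  by rewrite !mxE; exact: h2.
rewrite sumr_const card_ord -[X in _ + X]mulr_natl le_eqVlt; apply/orP; left; apply/eqP.
by field; rewrite gt_eqF.
Qed.

Lemma FTC_eps {R : realType} (I G : R -> R) (a b : R) : a < b ->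
  {within `[a, b], continuous I} -> {within `[a, b], continuous G} ->
  (forall t e, a < t < b -> 0 < e -> exists2 d, 0 < d & forall t', t' \in `[a, b] ->
    `|t' - t| <= d -> `|I t' - I t - (t' - t) * G t| <= e * `|t' - t|) ->
  \int[lebesgue_measure]_(t in `[a, b]) G t = I b - I a.
Proof.
move=> ab cI cG hI.
have dI t : a < t < b -> is_derive t (1 : R) I (G t).
  move=> tab.
  have cv : h^-1 *: ((I \o shift t) (h *: (1 : R)) - I t) @[h --> 0^'] --> G t.
    apply/cvgrPdist_le => e e0; have [d d0 hd] := hI t e tab e0.
    have /andP[at_ tb] := tab.
    have m0 : 0 < Num.min d (Num.min (t - a) (b - t)) by rewrite !lt_min d0 !subr_gt0 at_.
    exists (Num.min d (Num.min (t - a) (b - t))) => //= h /=.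
    rewrite sub0r normrN !lt_min => /andP[hd' /andP[ha hb]] h0.
    have hab : h + t \in `[a, b].
      rewrite in_itv/=; move: ha hb; rewrite !ltr_norml => /andP[h1 h2] /andP[h3 h4].
      by move: h1 h2 h3 h4; clear; move=> *; apply/andP; split; lra.
    have := hd (h + t) hab; rewrite addrK => /(_ (ltW hd')) hh.
    have -> : G t - h^-1 *: (I (h *: (1 : R) + t) - I t) = - (h^-1 * (I (h + t) - I t - h * G t)).
      rewrite (_ : h *: (1 : R) = h); last by rewrite [LHS]mulr1.
      have -> : h^-1 *: (I (h + t) - I t) = h^-1 * (I (h + t) - I t) by [].
      by field.
    by rewrite normrN normrM normfV ler_pdivrMl ?normr_gt0// [leRHS]mulrC.
  by split; [apply/cvg_ex; exists (G t)|exact: cvg_lim cv].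
have [cI1 cI2 cI3] := (continuous_within_itvP _ ab).1 cI.
rewrite /Rintegral (@continuous_FTC2 _ _ I)//.
- by split => // t; rewrite in_itv/= => /dI[].
- by move=> t; rewrite in_itv/= => /dI h; rewrite derive1E; exact: derive_val.
Qed.

Lemma Rintegral_combination {d} {X : measurableType d} {R : realType} (P : probability X R)
    (f1 f2 g : X -> R) (K r e : R) :
  measurable_fun setT f1 -> measurable_fun setT f2 -> measurable_fun setT g ->
  (forall x, `|f1 x| <= K) -> (forall x, `|f2 x| <= K) -> (forall x, `|g x| <= K) ->
  (forall x, `|f1 x - f2 x - r * g x| <= e) ->
  `|\int[P]_x f1 x - \int[P]_x f2 x - r * \int[P]_x g x| <= e.
Proof.
move=> m1 m2 m3 b1 b2 b3 be.
have PT : (P setT < +oo)%E by exact: prob_lty.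
have i1 := bounded_integrable measurableT PT m1 (fun x _ => b1 x).
have i2 := bounded_integrable measurableT PT m2 (fun x _ => b2 x).
have i3 := bounded_integrable measurableT PT m3 (fun x _ => b3 x).
rewrite -RintegralZl// -RintegralB// -RintegralB//.
- have mf : measurable_fun setT (fun x => f1 x - f2 x - r * g x).
    by apply: measurable_funB; [exact: measurable_funB|exact: measurable_funM].
  have [x _] : exists x : X, True.
    apply/not_existsP => X0; have := probability_setT P.
    rewrite (_ : setT = set0) ?measure0; last by apply/seteqP; split => x // _; exact: (X0 x).
    by move=> /eqP; rewrite eq_sym onee_eq0.
  by apply: bounded_Rintegral => //; apply: le_trans (be x).
- apply: (@bounded_integrable _ _ _ _ _ _ (K + K)) => // [|x _]; first exact: measurable_funB.
  by rewrite (le_trans (ler_normB _ _))// lerD.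
- apply: (@bounded_integrable _ _ _ _ _ _ (`|r| * K)) => // [|x _]; first exact: measurable_funM.
  by rewrite normrM ler_wpM2l.
Qed.

(** * Laws of the Euler scheme *)

Section euler_law.
Context {R : realType} {n : nat} (T : R) (w : R -> 'rV[R]_n -> 'rV[R]_n) (c : R).
Variable theta : probability (borelRn R n) R.
Hypotheses (T0 : 0 < T) (c0 : 0 < c).
Hypothesis w_le : forall t x, t \in `[0, T] -> `|w t x| <= c * (1 + `|x|).
Hypothesis w_continuous : forall t, t \in `[0, T] -> continuous (w t).

Definition mesh (k : nat) : R := T / k.+1%:R.

Lemma mesh_gt0 k : 0 < mesh k. Proof. by rewrite divr_gt0. Qed.

Lemma mesh_end k : k.+1%:R * mesh k = T.
Proof. by rewrite mulrC divfK. Qed.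

Lemma mesh_grid k j : (j <= k.+1)%N -> j%:R * mesh k \in `[0, T].
Proof.
move=> jk; rewrite in_itv/= mulr_ge0 ?(ltW (mesh_gt0 k))//= -[leRHS](mesh_end k).
by rewrite ler_wpM2r ?(ltW (mesh_gt0 k))// ler_nat.
Qed.

Definition euler (k : nat) (t : R) : borelRn R n -> borelRn R n := polygon w (mesh k) k.+1 t.

Lemma euler_continuous k t : continuous (euler k t : 'rV[R]_n -> 'rV[R]_n).
Proof.
by apply: polygon_continuous => i ik; apply: w_continuous; apply: mesh_grid; exact: ltnW.
Qed.

Lemma measurable_euler k t : measurable_fun setT (euler k t).
Proof.
apply: measurable_fun_rV => j; apply: continuous_measurable_rV.
apply: (@continuous_comp_fun _ _ _ (euler k t : 'rV[R]_n -> 'rV[R]_n) (fun y => y ord0 j)).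
  exact: euler_continuous.
exact: smc_continuous (smc_coord j).
Qed.

HB.instance Definition _ k t := isMeasurableFun.Build _ _ _ _ (euler k t) (measurable_euler k t).

Definition euler_law (k : nat) (t : R) : probability (borelRn R n) R := distribution theta (euler k t).

Lemma euler_law_integral k t (f : 'rV[R]_n -> R) (K : R) : continuous f -> (forall x, `|f x| <= K) ->
  \int[euler_law k t]_x f x = \int[theta]_x f (euler k t x).
Proof.
move=> cf fK; have mf := continuous_measurable_rV cf.
rewrite /Rintegral integral_pushforward//.
- exact/measurable_EFinP.
- apply: (@bounded_integrable _ _ _ _ _ _ K) => //.
  + by rewrite preimage_setT.
  + by rewrite preimage_setT; exact: prob_lty.
  + by rewrite preimage_setT; exact: measurableT_comp.
Qed.

Lemma euler_observable k t (f : 'rV[R]_n -> R) : continuous f ->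
  measurable_fun setT (fun x : borelRn R n => f (euler k t x)).
Proof.
move=> cf; apply: continuous_measurable_rV.
exact: (@continuous_comp_fun _ _ _ (euler k t : 'rV[R]_n -> 'rV[R]_n) f (@euler_continuous k t) cf).
Qed.

Lemma euler_law_init k (E : set (borelRn R n)) : measurable E -> euler_law k 0 E = theta E.
Proof.
move=> mE; rewrite /euler_law /distribution /pushforward; congr (theta _).
have e0 x : euler k 0 x = x.
  by have := polygon_grid w (ltW (mesh_gt0 k)) x (leq0n k.+1); rewrite mul0r.
by apply/seteqP; split => x /=; rewrite e0.
Qed.

Lemma euler_law_lip k (f : 'rV[R]_n -> R) (M N : R) : mesh k * c <= 1 / 2 -> smc f ->
  (forall x, f x != 0 -> `|x| <= M) ->
  (forall x, 2 * c * ((1 + `|x|) * \sum_(i < n) `|grad f x ord0 i|) <= N) ->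
  forall s t, s \in `[0, T] -> t \in `[0, T] ->
  `|\int[euler_law k t]_x f x - \int[euler_law k s]_x f x| <= N * `|t - s|.
Proof.
move=> hc sf fM fN.
have cf := smc_continuous sf; have [K fK] := compact_supp_bounded cf fM.
have m0 := mesh_gt0 k.
have H s t : s \in `[0, T] -> t \in `[0, T] -> s <= t ->
    `|\int[euler_law k t]_x f x - \int[euler_law k s]_x f x| <= N * (t - s).
  rewrite !in_itv/= => /andP[s0 sT] /andP[t0 tT] st.
  (* With slope 0, [chain_estimate] reduces the Lipschitz bound to one grid interval, where the
     polygon is a single Euler step. *)
  have := @chain_estimate _ (fun t => \int[euler_law k t]_x f x) (mesh k) 0 N k.+1 0 T (lexx _) _ _ s t s0 st tT.
  rewrite mesh_end lexx mulr0 subr0; apply => // j r r' jk r0 r'T jr rr' r'j.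
  rewrite mulr0 subr0 !(euler_law_integral _ _ cf fK).
  rewrite -[X in `|X|]subr0 -(mul0r (\int[theta]_x 0)).
  apply: (@Rintegral_combination _ _ _ _ _ _ _ (`|K|)) => [|||x|x|x|x].
  - exact: euler_observable.
  - exact: euler_observable.
  - exact: continuous_measurable_rV (@cst_continuous _ _ 0).
  - by rewrite (le_trans (fK _))// ler_norm.
  - by rewrite (le_trans (fK _))// ler_norm.
  - by rewrite normr0.
  rewrite mul0r subr0 /euler (polygon_piece _ (ltW m0) _ jk (le_trans jr rr') r'j).
  rewrite (polygon_piece _ (ltW m0) _ jk jr (le_trans rr' r'j)).
  rewrite (_ : r' - r = (r' - j%:R * mesh k) - (r - j%:R * mesh k)); last by ring.
  set z := polygon _ _ _ _ _.
  have jT : j%:R * mesh k \in `[0, T] by exact/mesh_grid/ltnW.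
  have := @euler_test _ _ _ _ _ _ c0 hc w_le f N _ z (r - j%:R * mesh k) (r' - j%:R * mesh k) sf fN jT.
  apply.
  + by rewrite subr_ge0.
  + by rewrite lerD2r.
  + by rewrite lerBlDr -[X in X + _]mul1r -mulrDl -natr1 addrC in r'j *.
move=> s t sT tT; have [st|ts] := leP s t.
  by rewrite (ger0_norm (_ : 0 <= t - s)) ?subr_ge0//; exact: H.
have st := ltW ts; rewrite distrC [`|t - s|]distrC (ger0_norm (_ : 0 <= s - t)) ?subr_ge0//.
exact: H.
Qed.

Lemma euler_law_transport (phi : R * 'rV[R]_n -> R) (K e : R) (g := fun t x =>
    time_deriv phi t x + dotv (w t x) (space_grad phi t x)) :
  test_function T phi -> (forall t, t \in `[0, T] -> continuous (g t)) ->
  (forall z, `|phi z| <= K) -> (forall t x, t \in `[0, T] -> `|g t x| <= K) -> 0 < e ->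
  exists2 h0, 0 < h0 & forall k, mesh k <= h0 -> forall j s s', (j < k.+1)%N ->
    j%:R * mesh k <= s -> s <= s' -> s' <= j.+1%:R * mesh k ->
    `|\int[euler_law k s']_x phi (s', x) - \int[euler_law k s]_x phi (s, x) -
      (s' - s) * \int[euler_law k (j%:R * mesh k)]_x g (j%:R * mesh k) x| <= e * (s' - s).
Proof.
move=> tphi gc phiK gK e0.
have cphi t : t \in `[0, T] -> continuous (fun x => phi (t, x)).
  have [sphi _ _] := tphi; have [cp _] := sphi [::] => tT.
  have U0 : [set: 'rV[R]_1] 0 by [].
  have jc := @jcont_continuous R n 1 T setT phi cp.
  exact: (param_continuous jc tT U0).
have [h0 h00 hh0] := euler_transport c0 w_le tphi e0.
exists h0 => // k kh j s s' jk js ss' s'j; have m0 := mesh_gt0 k.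
have jT : j%:R * mesh k \in `[0, T] by exact/mesh_grid/ltnW.
have s'T : s' <= T.
  by apply: (le_trans s'j); have := mesh_grid jk; rewrite in_itv/= => /andP[].
have sT : s \in `[0, T].
  by rewrite in_itv/= (le_trans ss' s'T) (le_trans _ js)// mulr_ge0// ltW.
have s'T' : s' \in `[0, T].
  by rewrite in_itv/= s'T andbT (le_trans _ ss')//; move: sT; rewrite in_itv/= => /andP[].
rewrite (euler_law_integral _ _ (cphi _ s'T') (fun x => phiK _)).
rewrite (euler_law_integral _ _ (cphi _ sT) (fun x => phiK _)).
rewrite (euler_law_integral _ _ (gc _ jT) (fun x => gK _ x jT)).
apply: (@Rintegral_combination _ _ _ _ _ _ _ K) => [|||x|x|x|x] //.
- exact: (@euler_observable k s' (fun x => phi (s', x)) (cphi _ s'T')).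
- exact: (@euler_observable k s (fun x => phi (s, x)) (cphi _ sT)).
- exact: (@euler_observable k _ (g (j%:R * mesh k)) (gc _ jT)).
- exact: gK.
rewrite /euler (polygon_piece _ (ltW m0) _ jk (le_trans js ss') s'j).
rewrite (polygon_piece _ (ltW m0) _ jk js (le_trans ss' s'j)) (polygon_grid _ (ltW m0) _ (ltnW jk)).
set z := polygon _ _ _ _ _.
have := hh0 (mesh k) m0 kh (j%:R * mesh k) z (s - j%:R * mesh k) (s' - j%:R * mesh k) jT.
have E r : j%:R * mesh k + (r - j%:R * mesh k) = r by rewrite addrC subrK.
rewrite !E (_ : s' - j%:R * mesh k - (s - j%:R * mesh k) = s' - s); last by ring.
apply => //; rewrite ?subr_ge0 ?lerD2r//.
by rewrite lerBlDr -[X in X + _]mul1r -mulrDl -natr1 addrC in s'j *.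
Qed.

End euler_law.

Lemma difference_quotient_perturb {R : realType} (A r x g g0 e : R) : 0 <= r ->
  `|A - r * x| <= e / 3 * r -> `|g - g0| <= e / 3 -> `|x - g| <= e / 3 -> `|A - r * g0| <= e * r.
Proof.
move=> r0 h1 h2 h3.
rewrite (_ : A - r * g0 = (A - r * x) + r * ((x - g) + (g - g0))); last by ring.
rewrite (le_trans (ler_normD _ _))// normrM (ger0_norm r0).
have h4 : `|x - g + (g - g0)| <= e / 3 + e / 3 by rewrite (le_trans (ler_normD _ _))// lerD.
have := ler_wpM2l r0 h4; move: h1; clear.
set u := r * `|_|; set w := `|_| => h1 h2.
rewrite (_ : e * r = e / 3 * r + r * (e / 3 + e / 3)); first exact: lerD.
by field.
Qed.

Lemma grid_point_near {R : realType} (h t d a b s s' tj : R) : h <= d / 2 -> a <= s -> s <= s' ->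
  s' <= b -> tj <= s -> s' <= tj + h -> `|a - t| <= d / 2 -> `|b - t| <= d / 2 -> `|tj - t| <= d.
Proof.
move=> hd as_ ss' s'b js s'j; rewrite !ler_norml => /andP[a1 a2] /andP[b1 b2].
by apply/andP; split; lra.
Qed.

(** * A trajectory for a constant control *)

Section constant_control.
Context {R : realType} {n m : nat} (T : R) (U : set 'rV[R]_m)
  (v : R -> 'rV[R]_n -> 'rV[R]_m -> 'rV[R]_n) (C : R).
Variable theta : probability (borelRn R n) R.
Hypotheses (T0 : 0 < T) (U_compact : compact U) (C0 : 0 < C).
Hypothesis v_continuous : {within `[0, T] `*` setT `*` U,
  continuous (fun z : R * 'rV[R]_n * 'rV[R]_m => v z.1.1 z.1.2 z.2)}.
Hypothesis v_growth : forall t u x, t \in `[0, T] -> U u ->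
  enorm (v t x u) <= C * (1 + enorm x).
Variable u0 : 'rV[R]_m.
Hypothesis Uu0 : U u0.

Let c : R := C * n.+1%:R.
Let w t x := v t x u0.

Let c0 : 0 < c. Proof. by rewrite mulr_gt0. Qed.

Let w_le t x : t \in `[0, T] -> `|w t x| <= c * (1 + `|x|).
Proof.
move=> tT; apply: norm_le_coord => [|i]; first by rewrite mulr_ge0 ?ltW// addr_ge0.
exact: (v_coord_le C0 v_growth).
Qed.

Let w_continuous t : t \in `[0, T] -> continuous (w t).
Proof.
move=> tT; apply: (@eps_continuous R 'rV[R]_n 'rV[R]_n (w t)) => x e e0.
have [d d0 hd] := within_eps v_continuous x tT Uu0 e0; exists d => // y yx.
by apply: hd => //; rewrite subrr normr0 ltW.
Qed.

Let mesh_small e : 0 < e -> exists k0, forall k, (k0 <= k)%N -> mesh T k <= e.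
Proof.
move=> e0; exists (Num.bound (T / e)) => k kk.
rewrite /mesh ler_pdivrMr// mulrC -ler_pdivrMr//.
have Te : 0 <= T / e by rewrite ltW// divr_gt0.
by apply: (le_trans (ltW (archi_boundP Te))); rewrite ler_nat (leq_trans kk).
Qed.

(** The integral [I t] of [phi (t, x)] against the limit measure is shown to be differentiable with
    derivative [G t]. As [phi] vanishes at times 0 and [T], the weak equation becomes the
    fundamental theorem of calculus for [I]. *)
Lemma constant_control_solution : exists mu : R -> probability (borelRn R n) R,
  [/\ narrowly_continuous T mu,
    forall E : set (borelRn R n), measurable E -> mu 0 E = theta E &
    continuity_equation T (fun t x => v t x u0) mu].
Proof.
(* Dropping the first [k0] polygons ensures [mesh T k * c <= 1 / 2], the step condition of
   [euler_law_lip], for every remaining index. *)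
have [k0 hk0] := mesh_small (divr_gt0 ltr01 (mulr_gt0 (ltr0n R 2) c0)).
pose mu k := euler_law theta T0 w_continuous (k + k0).
have mu_init k (E : set (borelRn R n)) : measurable E -> mu k 0 E = theta E by exact: euler_law_init.
have mu_lip (f : 'rV[R]_n -> R) (M N : R) : smc f -> (forall x, f x != 0 -> `|x| <= M) ->
    (forall x, 2 * c * ((1 + `|x|) * \sum_(i < n) `|grad f x ord0 i|) <= N) ->
    forall k s t, s \in `[0, T] -> t \in `[0, T] ->
    `|\int[mu k t]_x f x - \int[mu k s]_x f x| <= N * `|t - s|.
  move=> sf fM fN k s t; apply: (@euler_law_lip _ _ _ _ _ theta T0 c0 w_le w_continuous _ _ _ _ _ sf fM fN).
  rewrite -ler_pdivlMr// (le_trans (hk0 _ (leq_addl _ _)))//.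
  by rewrite invfM mulrA.
have c2 : 0 < 2 * c by rewrite mulr_gt0.
have mu_eq : narrow_equicontinuous T mu.
  move=> f K e t0 cf fK e0 t0T.
  have [d d0 hd] := curve_equicontinuous T0 c2 mu_init mu_lip cf fK e0.
  by exists d => // k t tT; exact: hd.
have [F [UF oF]] := ultraFilterLemma eventually_filter.
have [mu0 [cv nc init]] := curve_compactness T0 c2 mu_init mu_lip UF.
have FF : ProperFilter F by exact: ultra_proper.
exists mu0; split => // phi tphi.
have [M [aM bM]] := transport_supp v tphi.
pose Psi t x w := time_deriv phi t x + dotv (v t x w) (space_grad phi t x).
have Psi_jc : jcont T U Psi by apply: jcontD; [exact: jcont_time_deriv|exact: jcont_transport].
have Psi_supp t x u : M < `|x| -> Psi t x u = 0 by move=> Mx; rewrite /Psi aM// bM// addr0.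
have cphi : continuous phi by have [sphi _ _] := tphi; have [] := sphi [::].
have phi_jc := @jcont_continuous R n m T U phi cphi.
have [M' hM'] := test_function_supp tphi.
have phi_supp t x (u : 'rV[R]_m) : M' < `|x| -> phi (t, x) = 0.
  by rewrite ltNge; apply: contraNeq; exact: hM'.
have phi_out t x : ~~ (0 < t < T) -> phi (t, x) = 0.
  apply: contraNeq => px; have [_ _ sub] := tphi.
  have [] : (`]0, T[ `*` setT) (t, x) by apply: sub; exact: subset_closure.
  by rewrite /= in_itv.
have [K1 hK1] := param_bounded U_compact phi_jc phi_supp.
have [K2 hK2] := param_bounded U_compact Psi_jc Psi_supp.
have phiK z : `|phi z| <= `|K1| + `|K2|.
  case: z => t x; have [tT|tT] := boolP (0 < t < T); last by rewrite phi_out// normr0.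
  rewrite (le_trans (hK1 t x u0 _ Uu0))//; last by rewrite (le_trans (ler_norm _))// lerDl.
  by rewrite in_itv/=; case/andP: tT => /ltW -> /ltW ->.
have PsiK t x : t \in `[0, T] -> `|Psi t x u0| <= `|K1| + `|K2|.
  by move=> tT; rewrite (le_trans (hK2 t x u0 tT Uu0))// (le_trans (ler_norm _))// lerDr.
have Psi_cont t : t \in `[0, T] -> continuous (fun x => Psi t x u0).
  by move=> tT; exact: (param_continuous Psi_jc tT Uu0).
pose I t := pint (fun t x (_ : 'rV[R]_m) => phi (t, x)) mu0 t u0.
pose G t := pint Psi mu0 t u0.
(* For a polygon the increment is compared with the integral of [Psi] at the grid time [tj]. As [tj]
   is close to [t] and these integrals converge uniformly in time, [G t] may replace it. Intervals
   near [t] with [a <= b] are used because [chain_estimate] is stated for ordered end points. *)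
have key t e : t \in `[0, T] -> 0 < e -> exists2 d, 0 < d & forall a b,
    a \in `[0, T] -> b \in `[0, T] -> a <= b -> `|a - t| <= d -> `|b - t| <= d ->
    `|I b - I a - (b - a) * G t| <= e * (b - a).
  move=> tT e0; have e3 : 0 < e / 3 by rewrite divr_gt0.
  have [d d0 hd] := pint_pcont U_compact Psi_jc Psi_supp nc (conj tT Uu0) e3.
  have d2 : 0 < d / 2 by rewrite divr_gt0.
  exists (d / 2) => // a b aT bT ab ta tb.
  have cvp s : s \in `[0, T] -> \int[mu k s]_x phi (s, x) @[k --> F] --> I s.
    move=> sT; apply: (cv s (fun x => phi (s, x)) (`|K1| + `|K2|) sT) => //.
    exact: (param_continuous phi_jc sT Uu0).
  have cvJ : `|\int[mu k b]_x phi (b, x) - \int[mu k a]_x phi (a, x) - (b - a) * G t| @[k --> F]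
      --> `|I b - I a - (b - a) * G t|.
    by apply: cvg_norm; apply: cvgB; [apply: cvgB; exact: cvp|exact: cvg_cst].
  apply: (@closed_cvg _ _ F _ _ _ (@closed_le _ (e * (b - a))) _ _ cvJ).
  have [h0 h00 hh0] := euler_law_transport theta T0 c0 w_le w_continuous tphi Psi_cont phiK PsiK e3.
  have [k1 hk1] : exists k0, forall k, (k0 <= k)%N -> mesh T k <= Num.min h0 (d / 2).
    by apply: mesh_small; rewrite lt_min h00.
  have N1 := pint_unif_cvg U_compact Psi_jc Psi_supp mu_eq FF nc cv e3.
  have N2 : F [set k | (k1 <= k)%N] by apply: oF; exact: nbhs_infty_ge.
  apply: filterS2 N1 N2 => k uk kk /=.
  have := hk1 (k + k0)%N (leq_trans kk (leq_addr _ _)); rewrite le_min => /andP[mh md].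
  have [a0 aTT] : 0 <= a /\ a <= T by move: aT; rewrite in_itv/= => /andP[].
  have [b0 bTT] : 0 <= b /\ b <= T by move: bT; rewrite in_itv/= => /andP[].
  apply: (@chain_estimate _ (fun s => \int[mu k s]_x phi (s, x)) (mesh T (k + k0)) (G t) e
    (k + k0).+1 a b) => //.
    by rewrite mesh_end.
  move=> j s s' jk as_ s'b js ss' s'j.
  have := hh0 _ mh j s s' jk js ss' s'j.
  set tj := j%:R * _ => Hj.
  have tjT : tj \in `[0, T] by apply: mesh_grid => //; exact: ltnW.
  have ttj : `|tj - t| <= d.
    apply: (grid_point_near md as_ ss' s'b js _ ta tb).
    by rewrite /tj -[X in _ + X]mul1r -mulrDl natr1.
  have := uk _ _ tjT Uu0; have := hd tj u0 (conj tjT Uu0) ttj; rewrite subrr normr0 => /(_ (ltW d0)).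
  move=> h1 h2; apply: (difference_quotient_perturb _ Hj h1 h2).
  by rewrite subr_ge0.
have tT0 : 0 \in `[0, T] by rewrite in_itv/= lexx ltW.
have tTT : T \in `[0, T] by rewrite in_itv/= lexx ltW.
have within Phi M1 : jcont T U Phi -> (forall t x w, M1 < `|x| -> Phi t x w = 0) ->
    {within `[0, T], continuous (fun t => pint Phi mu0 t u0)}.
  move=> jc sp; apply/within_segmentP => s sT e e0.
  have [d d0 hd] := pint_pcont U_compact jc sp nc (conj sT Uu0) e0.
  exists d => // r rT rs; apply: hd => //; first exact: ltW.
  by rewrite subrr normr0 ltW.
rewrite [LHS](@FTC_eps _ I G 0 T T0).
- have I0 t : ~~ (0 < t < T) -> I t = 0.
    move=> tT; rewrite /I /pint.
    have -> : (fun x => phi (t, x)) = (fun=> 0) by apply/funext => x; exact: phi_out.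
    exact: Rintegral_prob_cst.
  by rewrite !I0 ?subrr// ?ltxx ?andbF.
- exact: within phi_jc phi_supp.
- exact: within Psi_jc Psi_supp.
move=> t e tT e0; have [||d d0 hd] := key t e => //.
  by rewrite in_itv/=; case/andP: tT => /ltW -> /ltW ->.
have tT' : t \in `[0, T] by rewrite in_itv/=; case/andP: tT => /ltW -> /ltW ->.
exists d => // t' t'T tt'; have tt0 : `|t - t| <= d by rewrite subrr normr0 ltW.
have [le|le] := leP t t'; first by rewrite (ger0_norm (_ : 0 <= t' - t)) ?subr_ge0//; exact: hd.
have le' := ltW le; have := hd t' t t'T tT' le' tt' tt0.
rewrite (ler0_norm (_ : t' - t <= 0)) ?subr_le0// opprB -normrN.
by rewrite (_ : - (_ - _ - _) = I t' - I t - (t' - t) * G t)//; ring.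
Qed.

(** For the constant map [u0] every law of the disintegration is the Dirac mass at [u0], so that the
    averaged field is [v] at [u0]. *)
Lemma generalized_control_trajectory : exists (nu : {measure set (timeR R * borelRn R m) -> \bar R})
    (mu : R -> probability (borelRn R n) R),
  generalized_control T U nu /\ trajectory T U theta v nu mu.
Proof.
have mX : measurable_fun setT (cst u0 : timeR R * timeR R -> borelRn R m) by exact: measurable_cst.
have cU : closed U by apply: compact_closed => //; exact: norm_hausdorff.
have [mu [nc init ce]] := constant_control_solution.
exists (map_control T mX), mu; split; first by apply: map_control_generalized.
exists (map_kernel mX); split => //; first exact: map_control_disintegration.
move=> phi tphi; rewrite -[RHS](ce phi tphi); apply: eq_Rintegral => t; rewrite inE/= => tT.
congr Rintegral; apply/funext => x; congr (_ + dotv _ _); apply/rowP => i; rewrite mxE.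
rewrite /Rintegral (@eq_measure_integral _ _ _ _ (\d_(u0 : borelRn R m))).
  rewrite integral_dirac//.
  - by rewrite diracE mem_set// mul1e.
  - exact: closed_measurable_rV.
  - apply/measurable_EFinP.
    exact: (@measurable_v_section _ _ _ T U v U_compact v_continuous t x i tT).
move=> A mA _; rewrite /= /pushforward diracE.
have [uA|uA] := boolP (u0 \in A).
  by rewrite (_ : _ @^-1` _ = setT) ?probability_setT//; apply/seteqP; split => // y _; rewrite inE in uA.
rewrite (_ : _ @^-1` _ = set0) ?measure0//; apply/seteqP; split => // y /= Ay.
by move: uA; rewrite mem_set.
Qed.

End constant_control.

Theorem theorem1 (R : realType) (n m : nat) (T : R) (U : set 'rV[R]_m)
    (theta : probability (borelRn R n) R)
    (v : R -> 'rV[R]_n -> 'rV[R]_m -> 'rV[R]_n) (L C : R) (A : set 'rV[R]_n)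
    (T_gt0 : 0 < T)
    (U_compact : compact U) (U_nonempty : U !=set0)
    (v_continuous : {within `[0, T] `*` setT `*` U,
       continuous (fun z : R * 'rV[R]_n * 'rV[R]_m => v z.1.1 z.1.2 z.2)})
    (L_gt0 : 0 < L) (C_gt0 : 0 < C)
    (v_lipschitz : forall t u x x', t \in `[0, T] -> U u ->
       enorm (v t x u - v t x' u) <= L * enorm (x - x'))
    (v_growth : forall t u x, t \in `[0, T] -> U u ->
       enorm (v t x u) <= C * (1 + enorm x))
    (A_closed : closed A) :
  exists (nu0 : {measure set (timeR R * borelRn R m) -> \bar R})
         (mu0 : R -> probability (borelRn R n) R),
    [/\ generalized_control T U nu0,
        trajectory T U theta v nu0 mu0 &
        forall (nu : {measure set (timeR R * borelRn R m) -> \bar R})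
               (mu : R -> probability (borelRn R n) R),
          generalized_control T U nu -> trajectory T U theta v nu mu ->
          (mu T A <= mu0 T A)%E].
Proof.
have [u0 Uu0] := U_nonempty.
(* Supplies a competitor, so that the set of attained values below is nonempty; when [A] is empty it
   is itself optimal. *)
have [nu1 [mu1 [gc1 tr1]]] :=
  generalized_control_trajectory theta T_gt0 U_compact C_gt0 v_continuous v_growth Uu0.
have mA : measurable (A : set (borelRn R n)) by exact: closed_measurable_rV.
have [/set0P A0|/negPn/eqP A0] := boolP (A != set0); last first.
  by exists nu1, mu1; split=> // nu mu _ _; rewrite A0 !measure0.
(* Values are collected over pairs of a control and a trajectory, since [trajectory] is a relation
   and not a function of the control. *)
pose S : set R := [set r | exists (nu : {measure set (timeR R * borelRn R m) -> \bar R})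
  (mu : R -> probability (borelRn R n) R),
  [/\ generalized_control T U nu, trajectory T U theta v nu mu & r = fine (mu T A)]].
have supS : has_sup S.
  split; first by exists (fine (mu1 T A)), nu1, mu1.
  exists 1 => r [nu [mu [_ _ ->]]].
  by rewrite -lee_fin (fineK (fin_num_measure (mu T) _ mA)) probability_le1.
have /choice[p hp] (k : nat) : exists p : {measure set (timeR R * borelRn R m) -> \bar R} *
    (R -> probability (borelRn R n) R) * (R.-pker (timeR R) ~> (borelRn R m)),
    [/\ generalized_control T U p.1.1, disintegration T p.1.1 p.2,
      narrowly_continuous T p.1.2,
      forall E : set (borelRn R n), measurable E -> p.1.2 0 E = theta E &
      continuity_equation T (averaged_field U v p.2) p.1.2 /\
      sup S - k.+1%:R^-1 <= fine (p.1.2 T A)].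
  have k0 : 0 < k.+1%:R^-1 :> R by rewrite invr_gt0.
  have [r [nu [mu [gc [nu_ [dis nc init ce]] ->]]] /ltW sr] := sup_adherent k0 supS.
  by exists (nu, mu, nu_).
pose nu k := (p k).1.1; pose mu k := (p k).1.2; pose nu_ k := (p k).2.
have c0 : 0 < C * n.+1%:R by rewrite mulr_gt0.
have gc k : generalized_control T U (nu k) by have [] := hp k.
have dis k : disintegration T (nu k) (nu_ k) by have [] := hp k.
have nc k : narrowly_continuous T (mu k) by have [] := hp k.
have init k (E : set (borelRn R n)) : measurable E -> mu k 0 E = theta E.
  by move=> mE; have [_ _ _ h _] := hp k; exact: h.
have ce k : continuity_equation T (averaged_field U v (nu_ k)) (mu k) by have [_ _ _ _ []] := hp k.
have near_sup k : sup S - k.+1%:R^-1 <= fine (mu k T A) by have [_ _ _ _ []] := hp k.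
have mu_lip (f : 'rV[R]_n -> R) (M N : R) : smc f -> (forall x, f x != 0 -> `|x| <= M) ->
    (forall x, C * n.+1%:R * ((1 + `|x|) * \sum_(i < n) `|grad f x ord0 i|) <= N) ->
    forall k s t, s \in `[0, T] -> t \in `[0, T] ->
    `|\int[mu k t]_x f x - \int[mu k s]_x f x| <= N * `|t - s|.
  move=> sf fM fN k s t.
  exact: (trajectory_lip T_gt0 U_compact C_gt0 v_continuous v_growth (nc k) (ce k) sf fM fN).
have mu_eq : narrow_equicontinuous T mu.
  move=> f K e t0 cf fK e0 t0T; have [d d0 hd] := curve_equicontinuous T_gt0 c0 init mu_lip cf fK e0.
  by exists d => // k t tT; exact: hd.
(* [F] contains all eventual sets, so ordinary limits, such as that of the gap to the supremum, also
   hold along it. *)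
have [F [UF oF]] := ultraFilterLemma eventually_filter.
have FF : ProperFilter F by exact: ultra_proper.
have [mu0 [cv_mu nc0 init0]] := curve_compactness T_gt0 c0 init mu_lip UF.
have [nu0 [nu_0 [gc0 dis0 _ cv_nu]]] := control_compactness T_gt0 U_compact gc UF.
have ce0 := continuity_equation_limit T_gt0 U_compact U_nonempty C_gt0 v_continuous v_growth
  FF mu_eq nc nc0 cv_mu gc dis gc0 dis0 cv_nu ce.
have sup_le : sup S <= fine (mu0 T A).
  have TT : T \in `[0, T] by rewrite in_itv/= lexx ltW.
  apply: (portmanteau_closed FF (fun f K cf fK => cv_mu T f K TT cf fK) A_closed A0 near_sup).
  have cv : sup S - k.+1%:R^-1 @[k --> \oo] --> sup S - 0.
    by apply: cvgB; [exact: cvg_cst|exact: cvg_harmonic].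
  by rewrite subr0 in cv; apply: cvg_trans cv; exact: cvg_app.
exists nu0, mu0; split => //; first by exists nu_0.
move=> nu' mu' gc' tr'; rewrite -(fineK (fin_num_measure (mu' T) _ mA)) -(fineK (fin_num_measure (mu0 T) _ mA)) lee_fin.
by apply: le_trans sup_le; apply: sup_ubound; [case: supS|exists nu', mu'].
Qed.
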